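(* Let $f\colon M^N=\prod_{i=0}^rM_i\to\mathbb{R}^N$ be a local isometry of an $N$-dimensional product manifold endowed with a polar metric. Then there exist a product $\tilde f=f_1\times\cdots\times f_r\colon\tilde M=\prod_{a=1}^rM_a\to\mathbb{R}^N$ of immersions with flat normal bundle, a parallel vector bundle isometry $\phi\colon\tilde M\times\mathbb{R}^s\to N_{\tilde f}\tilde M$ and a local isometry $f_0\colon M_0\to\Omega(\tilde f;\phi)\subset\mathbb{R}^s$ such that $f=G\circ\phi\circ(f_0\times\mathrm{id})$, that is, $f(p_0,\tilde p)=G(\phi_{\tilde p}(f_0(p_0)))=\tilde f(\tilde p)+\phi_{\tilde p}(f_0(p_0))$ for all $(p_0,\tilde p)\in M_0\times\tilde M$.
   Context: Product manifolds are connected. On $M=\prod_{i=0}^rM_i$, with projections $\pi_i\colon M\to M_i$, a Riemannian metric $g$ is polar if there are a Riemannian metric $g_0$ on $M_0$ and smooth families $g_a=(g_a(p_0))_{p_0\in M_0}$ of Riemannian metrics on $M_a$ parametrized by $M_0$, $1\le a\le r$, with $g=\pi_0^*g_0+\sum_{a=1}^r\pi_a^*(g_a\circ\pi_0)$, i.e. $g(p)(X,Y)=g_0(\pi_{0*}X,\pi_{0*}Y)+\sum_ag_a(\pi_0(p))(\pi_{a*}X,\pi_{a*}Y)$. A product of immersions $f_a\colon M_a\to\mathbb{R}^{n_a}$, with respect to an orthogonal decomposition $\mathbb{R}^N=\prod_{a=1}^r\mathbb{R}^{n_a}$, is $\tilde f(p_1,\dots,p_r)=(f_1(p_1),\dots,f_r(p_r))$.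 $N_{\tilde f}\tilde M$ is the normal bundle of $\tilde f$ with the normal connection, $\pi\colon N_{\tilde f}\tilde M\to\tilde M$ the bundle projection, and $A^{\tilde f}_\xi$ the shape operators, $\langle A^{\tilde f}_\xi X,Y\rangle=\langle\alpha_{\tilde f}(X,Y),\xi\rangle$. The end-point map $G\colon N_{\tilde f}\tilde M\to\mathbb{R}^N$ is $G(v)=\tilde f(\pi(v))+v$. A parallel vector bundle isometry $\phi\colon\tilde M\times\mathbb{R}^s\to N_{\tilde f}\tilde M$ is a smooth bundle map such that each $\phi_{\tilde p}=\phi(\tilde p,\cdot)$ is a linear isometry onto the fibre and $\tilde p\mapsto\phi_{\tilde p}(y)$ is parallel in the normal connection for each fixed $y\in\mathbb{R}^s$. $\Omega(\tilde f;\phi)=\{Y\in\mathbb{R}^s:\ I-A^{\tilde f}_{\phi_{\tilde p}(Y)}\text{ is nonsingular on }T_{\tilde p}\tilde M\text{ for every }\tilde p\in\tilde M\}$. The points of the domain of $\phi$ are written in the order making $f=G\circ\phi\circ(f_0\times\mathrm{id})$ meaningful, as in the displayed formula. *)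

(* Defs.v *)
From HB Require Import structures.
From mathcomp Require Import all_boot all_order all_algebra.
From mathcomp Require Import all_classical reals interval_inference topology normedtype landau derive.
Set Implicit Arguments.
Unset Strict Implicit.
Unset Printing Implicit Defensive.
Import Order.TTheory GRing.Theory Num.Theory.
Import numFieldNormedType.Exports.
Local Open Scope classical_set_scope.
Local Open Scope ring_scope.

Section calculus.
Context {R : realType}.

Definition dot {n} (u v : 'rV[R]_n) : R := (u *m v^T) 0 0.

(* C^oo on an open set [U]: every iterated directional derivative is
   differentiable at every point of [U]. *)
Definition smooth_on {V W : normedModType R} (U : set V) (f : V -> W) :=
  forall (s : seq V) (x : V), U x ->
    differentiable (foldr (fun v (h : V -> W) => 'D_v h) f s) x.

Lemma near_eq_differentiable (V W : normedModType R) (f g : V -> W) (x : V) :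
  (\near x, f x = g x) -> differentiable f x -> differentiable g x.
Proof.
move=> fg df.
have gE : g \o shift x = cst (g x) + 'd f x +o_ 0 id.
  apply/eqaddoP => _/posnumP[e].
  have /eqaddoP/(_ _ (gt0 e)) fe := diff_locally df.
  have := fg; rewrite (near_shift 0) => fg0.
  near=> h.
  have fgh : f (h + x) = g (h + x) by near: h; move: fg0; rewrite /= subr0.
  have : `|(f \o shift x - (cst (f x) + 'd f x)) h| <= e%:num * `|id h| by near: h.
  by rewrite /GRing.add /GRing.opp /= -(nbhs_singleton fg) -fgh.
have dE := diff_unique (diff_continuous df) gE.
by apply/diff_locallyP; rewrite dE; split; [exact: diff_continuous|].
Unshelve. all: by end_near. Qed.

Lemma mulmxr_differentiable m n (A : 'M[R]_(m, n)) (x : 'rV[R]_m) :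
  differentiable (mulmxr A : 'rV[R]_m -> 'rV[R]_n) x.
Proof.
rewrite (_ : (mulmxr A : 'rV[R]_m -> 'rV[R]_n) =
             \sum_(i < m) (fun y : 'rV[R]_m => y 0 i *: row i A)).
  apply: differentiable_sum => i.
  exact/differentiableZl/differentiable_coord.
by apply/funext => y; rewrite /= mulmx_sum_row fct_sumE.
Qed.

Lemma mulmxr_continuous m n (A : 'M[R]_(m, n)) :
  continuous (mulmxr A : 'rV[R]_m -> 'rV[R]_n).
Proof. by move=> x; exact/differentiable_continuous/mulmxr_differentiable. Qed.

Lemma diff_mulmxr m n (A : 'M[R]_(m, n)) (x : 'rV[R]_m) :
  'd (mulmxr A : 'rV[R]_m -> 'rV[R]_n) x = mulmxr A :> ('rV[R]_m -> 'rV[R]_n).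
Proof. exact: (@diff_lin _ _ _ (mulmxr A) x (@mulmxr_continuous _ _ A)). Qed.

Section blockwise.
Context {k : nat} {m n : 'I_k -> nat}.

Let P (q : 'I_k -> nat) i : 'M[R]_(\sum_i q i, q i) := submxrow 1%:M i.

Let submxrowE q i (x : 'rV[R]_(\sum_i q i)) : submxrow x i = x *m P q i.
Proof. by rewrite mul_submxrow mulmx1. Qed.

Let mxrowE q (B : forall i, 'rV[R]_(q i)) :
  \mxrow_i B i = \sum_i B i *m (P q i)^T.
Proof.
rewrite -(mulmx1 (\mxrow_i B i)) -[X in _ *m X](submxcolK).
rewrite mul_mxrow_mxcol; apply: eq_bigr => i _.
by rewrite /P tr_submxrow trmx1.
Qed.

Lemma submxrow_continuous i :
  continuous (fun x : 'rV[R]_(\sum_i m i) => submxrow x i).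
Proof.
move=> x; rewrite (_ : (fun _ => _) = mulmxr (P m i)); first exact: mulmxr_continuous.
by apply/funext => y; rewrite submxrowE.
Qed.

Lemma mxrow_continuous (T : topologicalType) (h : forall i, T -> 'rV[R]_(n i)) x :
  (forall i, {for x, continuous (h i)}) ->
  {for x, continuous (fun t => \mxrow_i h i t)}.
Proof.
move=> hc; rewrite /prop_for /continuous_at.
rewrite (_ : (fun t => \mxrow_i h i t) = fun t => \sum_i h i t *m (P n i)^T).
  rewrite mxrowE.
  have cA : continuous (fun z : 'rV[R]_(\sum_i n i) * 'rV[R]_(\sum_i n i) =>
    z.1 + z.2) by exact: add_continuous.
  apply: (cvg_big cA (Ff := fun i t => h i t *m (P n i)^T)) => i _.
  exact: (continuous_comp (hc i) (@mulmxr_continuous _ _ (P n i)^T _)).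
by apply/funext => y; rewrite mxrowE.
Qed.

Variable h : forall i, 'rV[R]_(m i) -> 'rV[R]_(n i).
Arguments h : clear implicits.

Definition blockwise (x : 'rV[R]_(\sum_i m i)) : 'rV[R]_(\sum_i n i) :=
  \mxrow_i h i (submxrow x i).

Let blockwiseE :
  blockwise = \sum_(i < k) (mulmxr (P n i)^T \o h i \o mulmxr (P m i)).
Proof.
apply/funext => x; rewrite /blockwise mxrowE fct_sumE.
by apply: eq_bigr => i _; rewrite /= submxrowE.
Qed.

Let hd (x : 'rV[R]_(\sum_i m i)) (i : 'I_k) := differentiable (h i) (submxrow x i).

Let differentiable_block x i : hd x i ->
  differentiable (mulmxr (P n i)^T \o h i \o mulmxr (P m i)) x.
Proof.
rewrite /hd submxrowE => hx.
apply: differentiable_comp; first exact: mulmxr_differentiable.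
by apply: differentiable_comp; [exact: hx|exact: mulmxr_differentiable].
Qed.

Lemma differentiable_blockwise x : (forall i, hd x i) ->
  differentiable blockwise x.
Proof.
by move=> hx; rewrite blockwiseE; apply: differentiable_sum => i;
  exact: differentiable_block.
Qed.

Lemma derive_blockwise x v : (forall i, hd x i) ->
  'D_v blockwise x = \mxrow_i 'D_(submxrow v i) (h i) (submxrow x i).
Proof.
move=> hx; rewrite blockwiseE derive_sum; last first.
  by move=> i; apply: diff_derivable; exact: differentiable_block.
rewrite mxrowE; apply: eq_bigr => i _.
rewrite deriveE; last exact: differentiable_block.
rewrite (@diff_comp _ _ _ _ (mulmxr (P m i))); last 2 first.
- exact: mulmxr_differentiable.
- apply: differentiable_comp; last exact: mulmxr_differentiable.
  by have := hx i; rewrite /hd submxrowE.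
rewrite /= diff_mulmxr (@diff_comp _ _ _ _ (h i)); last 2 first.
- by have := hx i; rewrite /hd submxrowE.
- exact: mulmxr_differentiable.
by rewrite /= diff_mulmxr /= deriveE ?submxrowE//; have := hx i;
  rewrite /hd submxrowE.
Qed.

End blockwise.

Lemma smooth_blockwise k (m n : 'I_k -> nat) (U : forall i, set 'rV[R]_(m i))
    (h : forall i, 'rV[R]_(m i) -> 'rV[R]_(n i)) :
  (forall i, open (U i)) -> (forall i, smooth_on (U i) (h i)) ->
  smooth_on [set x | forall i, U i (submxrow x i)] (blockwise h).
Proof.
move=> oU hU s.
pose D (V W : normedModType R) (s : seq V) (f : V -> W) :=
  foldr (fun v (h : V -> W) => 'D_v h) f s.
pose bs s := blockwise (fun i => D _ _ [seq submxrow v i | v <- s] (h i)).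
have near_U x : (forall i, U i (submxrow x i)) ->
    \forall y \near x, forall i, U i (submxrow y i).
  move=> Ux; apply: (@filter_forall _ _ (fun i => [set y | U i (submxrow y i)]) (nbhs x)) => i.
  exact: (@submxrow_continuous k m i x _ (open_nbhs_nbhs (conj (oU i) (Ux i)))).
suff DE x : (forall i, U i (submxrow x i)) -> D _ _ s (blockwise h) x = bs s x.
  move=> x Ux; apply: (@near_eq_differentiable _ _ (bs s)).
    by near=> y; rewrite -DE//; near: y; exact: near_U.
  by apply: differentiable_blockwise => i; exact: hU.
elim: s x => [//|v s IHs] x Ux.
rewrite /D /= -/(D _ _ s (blockwise h)) -(@near_eq_derive _ _ _ (bs s)).
  by rewrite derive_blockwise// => i; exact: hU.
near=> y; rewrite -IHs//; near: y; exact: near_U.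
Unshelve. all: by end_near. Qed.

End calculus.

Record chart (R : realType) (T : topologicalType) (n : nat) := Chart {
  dom : set T;
  cod : set 'rV[R]_n;
  fwd : T -> 'rV[R]_n;
  bwd : 'rV[R]_n -> T;
  dom_open : open dom;
  cod_open : open cod;
  fwd_cod : forall p, dom p -> cod (fwd p);
  bwd_dom : forall x, cod x -> dom (bwd x);
  fwdK : forall p, dom p -> bwd (fwd p) = p;
  bwdK : forall x, cod x -> fwd (bwd x) = x;
  fwd_continuous : forall p, dom p -> {for p, continuous fwd};
  bwd_continuous : forall x, cod x -> {for x, continuous bwd} }.

(* The tangent space at [p] is 'rV_(mdim M): a tangent vector is given by its
   components in the preferred chart [chart_at p]. *)
Record manifold (R : realType) := Manifold {
  carrier :> topologicalType;
  mdim : nat;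
  atlas : set (chart R carrier mdim);
  chart_at : carrier -> chart R carrier mdim;
  chart_atP : forall p, atlas (chart_at p);
  dom_chart_at : forall p, dom (chart_at p) p;
  atlas_compat : forall c c', atlas c -> atlas c' ->
    smooth_on (cod c `&` bwd c @^-1` dom c') (fwd c' \o bwd c);
  manifold_hausdorff : hausdorff_space carrier;
  manifold_second_countable : @second_countable carrier }.

Arguments atlas {R} _.

Lemma overlap_open (R : realType) (T : topologicalType) n (c c' : chart R T n) :
  open (cod c `&` bwd c @^-1` dom c').
Proof.
rewrite openE => x [cx c'x]; apply: filterI.
  exact: open_nbhs_nbhs (conj (@cod_open _ _ _ c) cx).
exact: (bwd_continuous cx (open_nbhs_nbhs (conj (@dom_open _ _ _ c') c'x))).
Qed.

Lemma cvg_prod_topology (I : Type) (T : I -> topologicalType)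
    (F : set_system (prod_topology T)) (p : prod_topology T) :
  Filter F -> (forall i A, nbhs (p i) A -> F [set q | A (q i)]) -> F --> p.
Proof.
move=> FF Fp; apply/cvg_sup => i A.
rewrite nbhsE => -[B [[C oC <-] Cp] CA].
by apply: filterS CA _; apply: Fp; exact: open_nbhs_nbhs.
Qed.

Section product_chart.
Context {R : realType} {k : nat} {T : 'I_k -> topologicalType} {n : 'I_k -> nat}.
Variable c : forall i, chart R (T i) (n i).
Arguments c : clear implicits.

Let X : topologicalType := prod_topology T.
Let pdom : set X := [set p | forall i, dom (c i) (p i)].
Let pcod : set 'rV[R]_(\sum_i n i) := [set x | forall i, cod (c i) (submxrow x i)].
Let pfwd (p : X) : 'rV[R]_(\sum_i n i) := \mxrow_i fwd (c i) (p i).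
Let pbwd (x : 'rV[R]_(\sum_i n i)) : X := fun i => bwd (c i) (submxrow x i).

Let pdom_open : open pdom.
Proof.
rewrite openE => p pp.
apply: (@filter_forall _ _ (fun i => [set q : X | dom (c i) (q i)]) (nbhs p)) => i.
exact: (@proj_continuous _ T i p _ (open_nbhs_nbhs (conj (@dom_open _ _ _ (c i)) (pp i)))).
Qed.

Let pcod_open : open pcod.
Proof.
rewrite openE => x xx.
apply: (@filter_forall _ _ (fun i => [set y | cod (c i) (submxrow y i)]) (nbhs x)) => i.
exact: (@submxrow_continuous R k n i x _
  (open_nbhs_nbhs (conj (@cod_open _ _ _ (c i)) (xx i)))).
Qed.

Let pfwd_cod p : pdom p -> pcod (pfwd p).
Proof. by move=> pp i; rewrite mxrowK; exact: fwd_cod. Qed.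

Let pbwd_dom x : pcod x -> pdom (pbwd x).
Proof. by move=> xx i; exact: bwd_dom. Qed.

Let pfwdK p : pdom p -> pbwd (pfwd p) = p.
Proof.
by move=> pp; apply: functional_extensionality_dep => i; rewrite /pbwd mxrowK fwdK.
Qed.

Let pbwdK x : pcod x -> pfwd (pbwd x) = x.
Proof.
by move=> xx; rewrite -[RHS]submxrowK; apply: eq_mxrow => i; rewrite bwdK.
Qed.

Let pfwd_continuous p : pdom p -> {for p, continuous pfwd}.
Proof.
move=> pp; apply: (@mxrow_continuous R k n X (fun i q => fwd (c i) (q i))) => i.
apply: (@continuous_comp _ _ _ (fun q : X => q i)); first exact: proj_continuous.
exact: fwd_continuous.
Qed.

Let pbwd_continuous x : pcod x -> {for x, continuous pbwd}.
Proof.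
move=> xx; have FF : Filter (pbwd y @[y --> x]).
  by apply: fmap_filter; exact: nbhs_filter.
apply: cvg_prod_topology => i A /(bwd_continuous (xx i)).
exact: submxrow_continuous.
Qed.

Definition prod_chart : chart R (prod_topology T) (\sum_i n i) :=
  Chart pdom_open pcod_open pfwd_cod pbwd_dom pfwdK pbwdK
    pfwd_continuous pbwd_continuous.

End product_chart.

Lemma second_countable_prod k (T : 'I_k -> topologicalType) :
  (forall i, @second_countable (T i)) -> @second_countable (prod_topology T).
Proof.
move=> T2.
have ex_d i : exists d : nat -> set (T i), (forall j, open (d j)) /\
    forall (p : T i) A, nbhs p A -> exists j, d j p /\ d j `<=` A.
  have [B /countable_injP[f finj] [Bo Bb]] := T2 i.
  exists (fun j => xget set0 [set U | B U /\ f U = j]); split=> [j|p A /Bb[U [BU Up] UA]].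
    by case: xgetP => [_ -> [/Bo]//|_]; exact: open0.
  exists (f U); case: xgetP => [V -> [BV fVU]|/(_ U)[]//].
  by rewrite (finj _ _ _ _ fVU) ?inE.
pose d i := sval (cid (ex_d i)).
have d_open i j : open (d i j) by rewrite /d; case: cid => ? /= [].
have d_basis i (p : T i) A : nbhs p A -> exists j, d i j p /\ d i j `<=` A.
  by rewrite /d; case: cid => ? /= [_]; apply.
pose box (w : {ffun 'I_k -> nat}) : set (prod_topology T) :=
  [set p | forall i, d i (w i) (p i)].
exists (range box); first exact: sub_countable (card_image_le _ _) (countableP _).
split=> [_ [w _ <-]|p].
  rewrite openE => p wp.
  apply: (@filter_forall _ _
    (fun i => [set q : prod_topology T | d i (w i) (q i)]) (nbhs p)) => i.
  by apply: (@proj_continuous _ T i p); apply: open_nbhs_nbhs; split; last exact: wp.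
have box_nbhs (A : forall i, set (T i)) : (forall i, nbhs (p i) (A i)) ->
    exists w, box w p /\ box w `<=` [set q | forall i, A i (q i)].
  move=> pA; pose w i := sval (cid (d_basis i (p i) _ (pA i))).
  have wP i : d i (w i) (p i) /\ d i (w i) `<=` A i by rewrite /w; case: cid.
  exists [ffun i => w i]; split=> [i|q qw i]; first by rewrite ffunE; case: (wP i).
  by have := qw i; rewrite ffunE; case: (wP i) => _; apply.
have box_open w i (q : prod_topology T) : box w q -> nbhs (q i) (d i (w i)).
  by move=> wq; apply: open_nbhs_nbhs; split; last exact: wq.
pose F := filter_from [set U | range box U /\ U p] id.
have FF : Filter F.
  apply: filter_from_filter => [|_ _ [[w _ <-] wp] [[v _ <-] vp]].
    have [w [wp _]] := box_nbhs (fun=> setT) (fun=> filterT).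
    by exists (box w); split=> //; exists w.
  have [] := box_nbhs (fun i => d i (w i) `&` d i (v i)).
    by move=> i; apply: filterI; exact: box_open.
  move=> u [up uwv]; exists (box u); first by split=> //; exists u.
  by move=> q /uwv wvq; split=> i; case: (wvq i).
apply: cvg_prod_topology => i A pA.
have [] := box_nbhs (fun i' => [set q | forall e : i = i', A (ecast x (T x) (esym e) q)]).
  move=> i'; have [e|ne] := eqVneq i i'; last first.
    by apply: filterE => q e; case/eqP: ne.
  by case: _ / e => /=; apply: filterS pA => q Aq e; rewrite (eq_axiomK e).
move=> w [wp wA]; exists (box w); first by split=> //; exists w.
by move=> q /wA/(_ i erefl).
Qed.

Section product_manifold.
Context {R : realType} {k : nat}.
Variable M : 'I_k -> manifold R.

Let patlas : set (chart R (prod_topology M) (\sum_i mdim (M i))) :=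
  [set prod_chart c | c in [set c : forall i, chart R (M i) (mdim (M i)) |
    forall i, atlas (M i) (c i)]].
Let pchart_at (p : prod_topology M) := prod_chart (fun i => chart_at (p i)).

Let pchart_atP p : patlas (pchart_at p).
Proof. by exists (fun i => chart_at (p i)) => // i; exact: chart_atP. Qed.

Let pdom_chart_at p : dom (pchart_at p) p.
Proof. by move=> i; exact: dom_chart_at. Qed.

Let patlas_compat c c' : patlas c -> patlas c' ->
  smooth_on (cod c `&` bwd c @^-1` dom c') (fwd c' \o bwd c).
Proof.
move=> [{}c cM <-] [{}c' cM' <-] s x [xc xc'].
apply: (@smooth_blockwise R k _ _
  (fun i => cod (c i) `&` bwd (c i) @^-1` dom (c' i))
  (fun i => fwd (c' i) \o bwd (c i))).
- by move=> i; exact: overlap_open.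
- by move=> i; exact: atlas_compat.
- by move=> i; split; [exact: xc|exact: xc'].
Qed.

Definition prodM : manifold R :=
  @Manifold R (prod_topology M) _ patlas pchart_at pchart_atP pdom_chart_at
    patlas_compat
    (@hausdorff_product _ _ (fun i => @manifold_hausdorff R (M i)))
    (@second_countable_prod _ _ (fun i => @manifold_second_countable R (M i))).

End product_manifold.

Section geometry.
Context {R : realType}.
Implicit Types M : manifold R.

Definition mdiff M M' (F : M -> M') (p : M) (X : 'rV[R]_(mdim M)) : 'rV[R]_(mdim M') :=
  'd (fwd (chart_at (F p)) \o F \o bwd (chart_at p)) (fwd (chart_at p) p) X.

(* The vector at the point of coordinates [x] in [c] having components [X] in
   the coordinate frame of [c]. *)
Definition coord_vector M (c : chart R M (mdim M)) (x X : 'rV[R]_(mdim M)) :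
    'rV[R]_(mdim M) :=
  'd (fwd (chart_at (bwd c x)) \o bwd c) x X.

Definition smooth_map M N (f : M -> 'rV[R]_N) :=
  forall c, atlas M c -> smooth_on (cod c) (f \o bwd c).

Definition local_rep M N (f : M -> 'rV[R]_N) (p : M) : 'rV[R]_(mdim M) -> 'rV[R]_N :=
  f \o bwd (chart_at p).

Definition coord M (p : M) : 'rV[R]_(mdim M) := fwd (chart_at p) p.

Definition tmap M N (f : M -> 'rV[R]_N) (p : M) (X : 'rV[R]_(mdim M)) : 'rV[R]_N :=
  'd (local_rep f p) (coord p) X.

Record riemannian_metric M := RiemannianMetric {
  gram : M -> 'M[R]_(mdim M);
  gram_sym : forall p, (gram p)^T = gram p;
  gram_pos : forall p (X : 'rV[R]_(mdim M)), X != 0 ->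
    0 < (X *m gram p *m X^T) 0 0;
  gram_smooth : forall c, atlas M c -> forall X Y,
    smooth_on (cod c) (fun x =>
      (coord_vector c x X *m gram (bwd c x) *m (coord_vector c x Y)^T) 0 0) }.

Definition inner M (g : riemannian_metric M) (p : M) (X Y : 'rV[R]_(mdim M)) : R :=
  (X *m gram g p *m Y^T) 0 0.

Definition smooth_family M0 M (g : M0 -> riemannian_metric M) :=
  forall c0 c, atlas M0 c0 -> atlas M c -> forall X Y,
    smooth_on (cod c0 `*` cod c)
      (fun z : 'rV[R]_(mdim M0) * 'rV[R]_(mdim M) =>
        inner (g (bwd c0 z.1)) (bwd c z.2)
          (coord_vector c z.2 X) (coord_vector c z.2 Y)).

Section polar.
Context {r : nat} (M : 'I_r.+1 -> manifold R).

Definition fibers (a : 'I_r) := M (lift ord0 a).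

Definition polar (g : riemannian_metric (prodM M)) (g0 : riemannian_metric (M ord0))
    (ga : forall a : 'I_r, M ord0 -> riemannian_metric (fibers a)) :=
  (forall a, smooth_family (ga a)) /\
  forall (p : prodM M) X Y,
    inner g p X Y =
    inner g0 (p ord0) (mdiff (fun q : prodM M => q ord0) p X)
                      (mdiff (fun q : prodM M => q ord0) p Y) +
    \sum_(a < r) inner (ga a (p ord0)) (p (lift ord0 a))
      (mdiff (fun q : prodM M => q (lift ord0 a)) p X)
      (mdiff (fun q : prodM M => q (lift ord0 a)) p Y).

Definition tail (p : prodM M) : prodM fibers := fun a => p (lift ord0 a).

End polar.

Definition local_isometry M (g : riemannian_metric M) N (f : M -> 'rV[R]_N) :=
  smooth_map f /\
  forall p, (forall X Y, dot (tmap f p X) (tmap f p Y) = inner g p X Y) /\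
            (forall v, exists X, tmap f p X = v).

Definition immersion M N (f : M -> 'rV[R]_N) :=
  smooth_map f /\ forall p, injective (tmap f p).

(* Orthogonal projection of [v] onto the normal space at [x] of the immersion
   [fh] of an open subset of R^n: the row space of ['J fh x] is the tangent
   space, and the kernel of its transpose is the normal space. *)
Definition normal_part n N (fh : 'rV[R]_n -> 'rV[R]_N) (x : 'rV[R]_n)
    (v : 'rV[R]_N) : 'rV[R]_N :=
  v *m proj_mx (kermx ('J fh x)^T) <<'J fh x>>%MS.

(* nabla^perp_X xi, for a normal field [xi] along [fh]. *)
Definition normal_conn n N (fh : 'rV[R]_n -> 'rV[R]_N) (X : 'rV[R]_n -> 'rV[R]_n)
    (xi : 'rV[R]_n -> 'rV[R]_N) (x : 'rV[R]_n) : 'rV[R]_N :=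
  normal_part fh x ('d xi x (X x)).

Definition lie_bracket n (X Y : 'rV[R]_n -> 'rV[R]_n) (x : 'rV[R]_n) : 'rV[R]_n :=
  'd Y x (X x) - 'd X x (Y x).

Definition normal_curvature n N (fh : 'rV[R]_n -> 'rV[R]_N)
    (X Y : 'rV[R]_n -> 'rV[R]_n) (xi : 'rV[R]_n -> 'rV[R]_N) (x : 'rV[R]_n) :=
  normal_conn fh X (normal_conn fh Y xi) x - normal_conn fh Y (normal_conn fh X xi) x
  - normal_conn fh (lie_bracket X Y) xi x.

Definition flat_normal_bundle M N (f : M -> 'rV[R]_N) :=
  forall c, atlas M c -> forall X Y (xi : 'rV[R]_(mdim M) -> 'rV[R]_N),
    smooth_on (cod c) X -> smooth_on (cod c) Y -> smooth_on (cod c) xi ->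
    (forall x, cod c x -> forall Z, dot (xi x) ('d (f \o bwd c) x Z) = 0) ->
    forall x, cod c x -> normal_curvature (f \o bwd c) X Y xi x = 0.

(* The value at [p] of the second fundamental form: the normal part of the
   derivative along X of f_* Y, where Y has constant components in the
   preferred chart. *)
Definition second_form M N (f : M -> 'rV[R]_N) (p : M) (X Y : 'rV[R]_(mdim M)) :
    'rV[R]_N :=
  normal_part (local_rep f p) (coord p)
    ('d (fun x => 'd (local_rep f p) x Y) (coord p) X).

(* The endomorphism X |-> X *m A of the tangent space at [p] is the shape
   operator of [f] in the direction [xi]; for an immersion it exists and is
   unique. *)
Definition shape_operator M N (f : M -> 'rV[R]_N) (p : M) (xi : 'rV[R]_N)
    (A : 'M[R]_(mdim M)) :=
  forall X Y, dot (tmap f p (X *m A)) (tmap f p Y) = dot (second_form f p X Y) xi.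

Record normal_bundle M N (f : M -> 'rV[R]_N) := NormalVector {
  foot : M;
  vec : 'rV[R]_N;
  vec_normal : forall X, dot vec (tmap f foot X) = 0 }.

Definition endpoint M N (f : M -> 'rV[R]_N) (v : normal_bundle f) : 'rV[R]_N :=
  f (foot v) + vec v.

(* Smoothness into the normal bundle is smoothness into the product of [M]
   with the ambient space, in which the bundle is a submanifold. *)
Record parallel_bundle_isometry M N (f : M -> 'rV[R]_N) s
    (phi : M * 'rV[R]_s -> normal_bundle f) : Prop := ParallelBundleIsometry {
  phi_foot : forall p y, foot (phi (p, y)) = p;
  phi_smooth : forall c, atlas M c ->
    smooth_on (cod c `*` setT)
      (fun z : 'rV[R]_(mdim M) * 'rV[R]_s => vec (phi (bwd c z.1, z.2)));
  phi_linear : forall p a y y',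
    vec (phi (p, a *: y + y')) = a *: vec (phi (p, y)) + vec (phi (p, y'));
  phi_isometric : forall p y y',
    dot (vec (phi (p, y))) (vec (phi (p, y'))) = dot y y';
  phi_onto : forall p (v : normal_bundle f), foot v = p -> exists y, phi (p, y) = v;
  phi_parallel : forall y p X,
    normal_part (local_rep f p) (coord p) (tmap (fun q => vec (phi (q, y))) p X) = 0 }.

Definition Omega M N (f : M -> 'rV[R]_N) s (phi : M * 'rV[R]_s -> normal_bundle f) :
    set 'rV[R]_s :=
  [set y | forall p, exists2 A, shape_operator f p (vec (phi (p, y))) A &
                                1%:M - A \in unitmx].

(* [E a] is the isometric inclusion of the a-th factor of an orthogonal
   decomposition of R^N. *)
Definition orthogonal_decomposition r N (n : 'I_r -> nat)
    (E : forall a, 'M[R]_(n a, N)) :=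
  [/\ forall a, E a *m (E a)^T = 1%:M,
      forall a b, a != b -> E a *m (E b)^T = 0 &
      (\sum_a n a)%N = N].

Definition product_map r N (M : 'I_r -> manifold R) (n : 'I_r -> nat)
    (E : forall a, 'M[R]_(n a, N)) (f : forall a, M a -> 'rV[R]_(n a))
    (p : prodM M) : 'rV[R]_N :=
  \sum_a f a (p a) *m E a.

End geometry.

(* Main.v *)
(* By Koszul's formula the numbers <f_XY, f_Z>, for coordinate fields X, Y, Z, are combinations
   of derivatives of the metric coefficients. For a polar metric this makes
   - f_YZ tangent to M_0 for Y, Z tangent to M_0;
   - f_XY tangent to M_a for X tangent to M_a, a > 0, and Y tangent to M_0;
   - f_XX' zero for X, X' tangent to distinct factors M_a, M_b, a, b > 0.
   By the first property f maps each M_0-leaf into an affine subspace. All leaves carry the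
   metric g_0, so by the second property f (p0, p~) = f (o0, p~) + f_0 (p0) T (p~), where T (p~)
   is an orthonormal frame of the leaf through p~, normal to p~ |-> f (o0, p~) and parallel.
   By the third property the tangent spaces of p~ |-> f (o0, p~) along the various M_a span
   mutually orthogonal subspaces, so that this map is a product of immersions. The parallel
   frame T trivializes the normal connection, which is therefore flat. Finally the
   differential of p~ |-> f (p0, p~) is injective, and it is that of p~ |-> f (o0, p~) composed
   with I - A for the shape operator A in the direction f_0 (p0) T (p~). *)

Require Import Defs.
From mathcomp Require Import all_boot all_order all_algebra.
From mathcomp Require Import all_classical reals interval_inference topology normedtype derive.
Set Implicit Arguments.
Unset Strict Implicit.
Unset Printing Implicit Defensive.
Import Order.TTheory GRing.Theory Num.Theory.
Import numFieldNormedType.Exports.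
Local Open Scope classical_set_scope.
Local Open Scope ring_scope.

(** * Calculus of matrix-valued functions *)

(** Isometric leaves could still be placed differently in [R^N], so a single [f_0] for all of them
    needs more than equal metrics: inner products of tangent vectors at two different points of a
    leaf must not depend on the leaf. Along [M_a] the derivative of such a product vanishes, because
    differentiated leaf vectors become tangent to [M_a], hence orthogonal to the leaf, whose tangent
    space is the same at both points.

    Polarity makes distinct factors orthogonal at one point only. By the third property, however,
    the tangent space of [M_a] over [o0] depends on the [M_a]-coordinate alone, so vectors at two
    points can be compared at a third one. The spans obtained need not fill [R^N]; the complement is
    allotted to one summand.

    The frame [T] splits along the summands too, since its derivative along [M_b] is tangent to
    [M_b]. Its [a]-th component is a parallel spanning family of the normal bundle of [f_a], in
    general with dependent rows; this is why flatness is derived from spanning families and not from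
    bases. *)

Section matrix_calculus.
Context {R : realType} {V : normedModType R}.
Implicit Types (x v : V).

Lemma differentiable_entry m n (A : V -> 'M[R]_(m, n)) x i j :
  differentiable A x -> differentiable (fun y => A y i j) x.
Proof.
move=> dA; apply: (@differentiable_comp _ _ _ _ A (fun M : 'M[R]_(m, n) => M i j)) => //.
exact: differentiable_coord.
Qed.

Lemma differentiable_mx m n (A : V -> 'M[R]_(m, n)) x :
  (forall i j, differentiable (fun y => A y i j) x) -> differentiable A x.
Proof.
move=> dA.
rewrite (_ : A = \sum_(i < m) \sum_(j < n) (fun y => A y i j *: delta_mx i j)).
  apply: differentiable_sum => i; apply: differentiable_sum => j.
  exact: differentiableZl.
apply/funext => y; rewrite {1}(matrix_sum_delta (A y)) fct_sumE.
by apply: eq_bigr => i _; rewrite fct_sumE.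
Qed.

Lemma derive_entry m n (A : V -> 'M[R]_(m, n)) x v i j :
  derivable A x v -> 'D_v A x i j = 'D_v (fun y => A y i j) x.
Proof. by move=> dA; rewrite derive_mx// mxE. Qed.

Lemma differentiable_mulmx m n p (A : V -> 'M[R]_(m, n)) (B : V -> 'M[R]_(n, p)) x :
  differentiable A x -> differentiable B x ->
  differentiable (fun y => A y *m B y) x.
Proof.
move=> dA dB; apply: differentiable_mx => i j.
rewrite (_ : (fun y => _) = \sum_(k < n) (fun y => A y i k * B y k j)).
  by apply: differentiable_sum => k; apply: differentiableM;
    exact: differentiable_entry.
by apply/funext => y; rewrite mxE fct_sumE.
Qed.

Lemma derive_mulmx m n p (A : V -> 'M[R]_(m, n)) (B : V -> 'M[R]_(n, p)) x v :
  differentiable A x -> differentiable B x ->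
  'D_v (fun y => A y *m B y) x = 'D_v A x *m B x + A x *m 'D_v B x.
Proof.
move=> dA dB; have dAB := differentiable_mulmx dA dB.
apply/matrixP => i j; rewrite derive_entry; last exact: diff_derivable.
rewrite (_ : (fun y => _) = \sum_(k < n) (fun y => A y i k * B y k j)); last first.
  by apply/funext => y; rewrite mxE fct_sumE.
have dAi k : derivable (fun y => A y i k) x v.
  by apply: diff_derivable; exact: differentiable_entry.
have dBj k : derivable (fun y => B y k j) x v.
  by apply: diff_derivable; exact: differentiable_entry.
rewrite derive_sum; last by move=> k; exact: derivableM.
rewrite !mxE -big_split /=; apply: eq_bigr => k _.
rewrite (@deriveM _ _ (fun y => A y i k) (fun y => B y k j))//.
rewrite !derive_entry//; [|exact: diff_derivable..].
by rewrite addrC; congr (_ + _); rewrite /GRing.scale /= mulrC.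
Qed.

Lemma differentiable_trmx m n (A : V -> 'M[R]_(m, n)) x :
  differentiable A x -> differentiable (fun y => (A y)^T) x.
Proof.
move=> dA; apply: differentiable_mx => i j.
by under eq_fun do rewrite mxE; exact: differentiable_entry.
Qed.

Lemma derive_trmx m n (A : V -> 'M[R]_(m, n)) x v :
  differentiable A x -> 'D_v (fun y => (A y)^T) x = ('D_v A x)^T.
Proof.
move=> dA; have dAT := differentiable_trmx dA.
apply/matrixP => i j; rewrite mxE !derive_entry; [|exact: diff_derivable..].
by congr ('D_v _ x); apply/funext => y; rewrite mxE.
Qed.

Lemma derive_mulmxl m n p (A : 'M[R]_(m, n)) (B : V -> 'M[R]_(n, p)) x v :
  differentiable B x -> 'D_v (fun y => A *m B y) x = A *m 'D_v B x.
Proof.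
move=> dB; rewrite (@derive_mulmx _ _ _ (cst A))//.
by rewrite derive_cst mul0mx add0r.
Qed.

Lemma derive_mulmxr m n p (A : V -> 'M[R]_(m, n)) (B : 'M[R]_(n, p)) x v :
  differentiable A x -> 'D_v (fun y => A y *m B) x = 'D_v A x *m B.
Proof.
move=> dB; rewrite (@derive_mulmx _ _ _ A (cst B))//.
by rewrite derive_cst mulmx0 addr0.
Qed.

Lemma differentiable_det n (A : V -> 'M[R]_n) x :
  differentiable A x -> differentiable (fun y => \det (A y)) x.
Proof.
move=> dA; have dprod (I : Type) (s : seq I) (F : I -> V -> R) :
    (forall i, differentiable (F i) x) ->
    differentiable (fun y => \prod_(i <- s) F i y) x.
  move=> dF; elim: s => [|i s IHs].
    by under eq_fun do rewrite big_nil; exact: differentiable_cst.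
  under eq_fun do rewrite big_cons.
  exact: (differentiableM (dF i) IHs).
rewrite /determinant.
have dsum (I : Type) (s : seq I) (F : I -> V -> R) :
    (forall i, differentiable (F i) x) ->
    differentiable (fun y => \sum_(i <- s) F i y) x.
  move=> dF; elim: s => [|i s IHs].
    by under eq_fun do rewrite big_nil; exact: differentiable_cst.
  under eq_fun do rewrite big_cons.
  exact: (differentiableD (dF i) IHs).
apply: dsum => s.
apply: (differentiableM (differentiable_cst _ _)); apply: dprod => i.
exact: differentiable_entry.
Qed.

(** By Cramer's rule; that formula agrees with [invmx] only on invertible matrices, hence the
    condition on a neighbourhood. *)
Lemma differentiable_invmx n (A : V -> 'M[R]_n) x :
  differentiable A x -> (\forall y \near x, A y \in unitmx) ->
  differentiable (fun y => invmx (A y)) x.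
Proof.
move=> dA uA.
apply: (@near_eq_differentiable _ _ _ (fun y => (\det (A y))^-1 *: \adj (A y))).
  by near=> y; rewrite /invmx (_ : A y \in unitmx)//; near: y.
apply: differentiable_mx => i j.
under eq_fun => y do rewrite mxE [X in _ * X]mxE /cofactor.
apply: differentiableM.
  apply: differentiableV; first exact: differentiable_det.
  by have := nbhs_singleton uA; rewrite /= unitmxE unitfE.
apply: (differentiableM (differentiable_cst _ _)); apply: differentiable_det.
apply: differentiable_mx => k l; under eq_fun do rewrite !mxE.
exact: differentiable_entry.
Unshelve. all: by end_near. Qed.

End matrix_calculus.

(** * Derivatives along lines and the mean value theorem *)

Section lines.
Context {R : realType} {V W : normedModType R}.
Implicit Types (f : V -> W) (x v : V).

(** The difference quotient along the line is literally that of [f] in the direction [v], so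
    derivatives transfer without any differentiability assumption. *)
Lemma line_growth f x v t :
  (fun h : R => h^-1 *: (((fun s : R => f (s *: v + x)) \o shift t) (h *: 1) - f (t *: v + x))) =
  (fun h : R => h^-1 *: ((f \o shift (t *: v + x)) (h *: v) - f (t *: v + x))).
Proof.
by apply/funext => h; rewrite /comp /shift [h *: 1]mulr1 scalerDl addrA.
Qed.

Lemma derive_line f x v t :
  'D_1 (fun s : R => f (s *: v + x)) t = 'D_v f (t *: v + x).
Proof. by rewrite /derive line_growth. Qed.

Lemma derivable_line f x v t :
  derivable f (t *: v + x) v -> derivable (fun s : R => f (s *: v + x)) t 1.
Proof. by rewrite /derivable line_growth. Qed.

End lines.

Lemma continuous_line (R : realType) (V : normedModType R) (x v : V) :
  continuous (fun t : R => t *: v + x).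
Proof. by move=> t; apply: cvgD; [exact: scalel_continuous|exact: cvg_cst]. Qed.

Lemma line_MVT (R : realType) (V : normedModType R) (f : V -> R) (x v : V) :
  (forall t, 0 <= t <= 1 -> differentiable f (t *: v + x)) ->
  exists2 t, 0 < t < 1 & f (v + x) - f x = 'D_v f (t *: v + x).
Proof.
move=> df.
have dg t : 0 <= t <= 1 -> derivable (fun s : R => f (s *: v + x)) t 1.
  by move=> t01; apply: derivable_line; apply: diff_derivable; exact: df.
have [||t] := @MVT R (fun s : R => f (s *: v + x)) (fun t => 'D_v f (t *: v + x)) 0 1 ltr01.
- move=> t; rewrite in_itv /= => /andP[t0 t1].
  split; last exact: derive_line.
  by apply: dg; rewrite !ltW.
- apply: derivable_within_continuous => t; rewrite in_itv /= => t01.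
  exact: dg.
rewrite in_itv /= => t01; rewrite scale1r scale0r add0r subr0 mulr1 => fE.
by exists t.
Qed.

(** Balls are star-shaped about their centre. *)
Lemma near_segment (R : realType) (V : normedModType R) (P : V -> Prop) (x : V) :
  (\forall y \near x, P y) ->
  \forall y \near x, forall t, 0 <= t <= 1 -> P (t *: (y - x) + x).
Proof.
move=> /nbhs_normP[e /= e0 eP]; apply/nbhs_normP; exists e => //= y /= xy t /andP[t0 t1].
apply: eP; rewrite /= opprD addrCA subrr addr0 normrN normrZ ger0_norm//.
rewrite -normrN opprB; apply: le_lt_trans xy.
by rewrite ler_piMl.
Qed.

Lemma locally_constant (R : realType) (V : normedModType R) m n
    (f : V -> 'M[R]_(m, n)) (x : V) :
  (\forall y \near x, differentiable f y /\ forall v, 'D_v f y = 0) ->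
  \forall y \near x, f y = f x.
Proof.
move=> /near_segment fx; near=> y.
have xy : forall t, 0 <= t <= 1 -> differentiable f (t *: (y - x) + x) /\
    forall v, 'D_v f (t *: (y - x) + x) = 0 by near: y.
apply/matrixP => i j.
have [|t t01] := @line_MVT _ _ (fun z => f z i j) x (y - x).
  by move=> t /xy[df _]; exact: differentiable_entry.
have [|df Df] := xy t; first by move: t01 => /andP[? ?]; rewrite !ltW.
rewrite -derive_entry ?Df ?mxE ?subrK; last exact: diff_derivable.
by move/eqP; rewrite subr_eq0 => /eqP.
Unshelve. all: by end_near. Qed.

(** * Closure properties of smooth functions *)

Section smooth_functions.
Context {R : realType} {V W : normedModType R}.
Variable U : set V.
Hypothesis oU : open U.
Implicit Types f g : V -> W.

Lemma smooth_differentiable f x : smooth_on U f -> U x -> differentiable f x.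
Proof. by move=> sf Ux; exact: (sf [::]). Qed.

Lemma smooth_derive f v : smooth_on U f -> smooth_on U ('D_v f).
Proof. by move=> sf s x Ux; have := sf (rcons s v) x Ux; rewrite foldr_rcons. Qed.

Lemma open_near_eq f g x : U x -> (forall y, U y -> f y = g y) ->
  \forall y \near x, f y = g y.
Proof.
by move=> Ux fg; apply: filterS (open_nbhs_nbhs (conj oU Ux)) => y /fg.
Qed.

(** A direct induction on the list of directions fails because one derivative leaves the form at
    hand: a product becomes a sum of products. Here it suffices to exhibit a class of functions
    stable under one derivative. Stability up to equality on the open set [U] is enough, derivatives
    being local. *)
Lemma smooth_on_coind (P : (V -> W) -> Prop) :
  (forall f, P f -> (forall x, U x -> differentiable f x) /\
    forall v, exists2 g, P g & forall x, U x -> 'D_v f x = g x) ->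
  forall f, P f -> smooth_on U f.
Proof.
move=> PP f Pf s x Ux.
have [g Pg fg] : exists2 g, P g & forall y, U y ->
    foldr (fun v (h : V -> W) => 'D_v h) f s y = g y.
  elim: s => [|v s [g Pg fg]] /=; first by exists f.
  have [_ /(_ v)[g' Pg' gg']] := PP _ Pg; exists g' => // y Uy.
  by rewrite -gg'//; apply: near_eq_derive; exact: open_near_eq.
have [/(_ x Ux) dg _] := PP _ Pg.
by apply: near_eq_differentiable dg; apply: open_near_eq => // y /fg.
Qed.

Lemma smooth_on_ext f g : (forall x, U x -> f x = g x) ->
  smooth_on U f -> smooth_on U g.
Proof.
move=> fg sf; apply: (@smooth_on_coind
  (fun h => exists2 k, smooth_on U k & forall x, U x -> k x = h x)); last by exists f.
move=> h [k sk kh]; split=> [x Ux|v].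
  by apply: near_eq_differentiable (smooth_differentiable sk Ux); exact: open_near_eq.
exists ('D_v k); first by exists ('D_v k) => //; exact: smooth_derive.
by move=> x Ux; apply: near_eq_derive; apply: open_near_eq => // y /kh.
Qed.

Lemma smooth_on_cst (w : W) : smooth_on U (cst w).
Proof.
apply: (@smooth_on_coind (fun h => exists w, h = cst w)); last by exists w.
move=> _ [{}w ->]; split=> // v; exists (cst 0); first by exists 0.
by move=> x _; rewrite derive_cst.
Qed.

Lemma smooth_onD f g : smooth_on U f -> smooth_on U g -> smooth_on U (f + g).
Proof.
move=> sf sg; apply: (@smooth_on_coind (fun h => exists f g,
  [/\ smooth_on U f, smooth_on U g & h = f + g])); last by exists f, g.
move=> _ [{sf}f [{sg}g [sf sg ->]]]; split=> [x Ux|v].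
  by apply: differentiableD; exact: smooth_differentiable.
exists ('D_v f + 'D_v g).
  by exists ('D_v f), ('D_v g); split=> //; exact: smooth_derive.
by move=> x Ux; rewrite deriveD//; apply: diff_derivable; exact: smooth_differentiable.
Qed.

Lemma smooth_on_linear (L : {linear V -> W}) : continuous L -> smooth_on U L.
Proof.
move=> cL; apply: (@smooth_on_coind (fun h => h = L \/ exists w, h = cst w)); last by left.
move=> _ [->|[w ->]]; split=> // v.
- by move=> _; exact: linear_differentiable.
- exists (cst (L v)); first by right; exists (L v).
  move=> x _; rewrite deriveE; last exact: linear_differentiable.
  by rewrite diff_lin.
- by exists (cst 0); [right; exists 0|move=> x _; rewrite derive_cst].
Qed.

End smooth_functions.

Section smooth_composition.
Context {R : realType} {V V' W : normedModType R}.

(* Only the values of the affine map matter, so it need not come with a linear structure. *)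
Lemma derive_affine (A : V -> V') (L : V -> V') (f : V' -> W) x v :
  (forall h : R, A (h *: v + x) = h *: L v + A x) ->
  'D_v (f \o A) x = 'D_(L v) f (A x).
Proof. by move=> AE; rewrite /derive /=; under eq_fun do rewrite AE. Qed.

(** Composites with a fixed affine map are stable under differentiation, which spares the higher
    chain rule. Insertions and projections of blocks are of this kind. *)
Lemma smooth_on_affine (U : set V) (U' : set V') (A : V -> V') (L : V -> V') (f : V' -> W) :
  open U ->
  (forall x v (h : R), A (h *: v + x) = h *: L v + A x) ->
  (forall x, U x -> differentiable A x) -> (forall x, U x -> U' (A x)) ->
  smooth_on U' f -> smooth_on U (f \o A).
Proof.
move=> oU AE dA UU sf; apply: (@smooth_on_coind _ _ _ _ oU (fun h => exists2 f,
  smooth_on U' f & h = f \o A)); last by exists f.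
move=> _ [{sf}f sf ->]; split=> [x Ux|v].
  apply: differentiable_comp; first exact: dA.
  by apply: smooth_differentiable sf _; exact: UU.
exists ('D_(L v) f \o A); first by exists ('D_(L v) f) => //; exact: smooth_derive.
by move=> x Ux; exact: derive_affine.
Qed.

End smooth_composition.

Section smooth_matrices.
Context {R : realType} {V : normedModType R}.
Variable U : set V.
Hypothesis oU : open U.

Lemma smooth_on_mulmx m n p (A : V -> 'M[R]_(m, n)) (B : V -> 'M[R]_(n, p)) :
  smooth_on U A -> smooth_on U B -> smooth_on U (fun y => A y *m B y).
Proof.
move=> sA sB; apply: (@smooth_on_coind _ _ _ _ oU (fun h => exists k
  (F : 'I_k -> V -> 'M[R]_(m, n)) (G : 'I_k -> V -> 'M[R]_(n, p)),
  (forall i, smooth_on U (F i) /\ smooth_on U (G i)) /\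
  h = fun y => \sum_i F i y *m G i y)); last first.
  exists 1%N, (fun=> A), (fun=> B); split=> //.
  by apply/funext => y; rewrite big_ord1.
move=> _ [k [F [G [sFG ->]]]].
have dF i x : U x -> differentiable (F i) x.
  by apply: smooth_differentiable; case: (sFG i).
have dG i x : U x -> differentiable (G i) x.
  by apply: smooth_differentiable; case: (sFG i).
have sumE : (fun y => \sum_i F i y *m G i y) = \sum_i (fun y => F i y *m G i y).
  by apply/funext => y; rewrite fct_sumE.
rewrite sumE; split=> [x Ux|v].
  by apply: differentiable_sum => i; apply: differentiable_mulmx; auto.
(* By Leibniz each of the [k] products yields two, so the stable class is that of finite sums of
   products. *)
pose F' (i : 'I_(k + k)) := match fintype.split i with inl i => 'D_v (F i) | inr i => F i end.
pose G' (i : 'I_(k + k)) := match fintype.split i with inl i => G i | inr i => 'D_v (G i) end.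
exists (fun y => \sum_(i < k + k) F' i y *m G' i y).
  exists (k + k)%N, F', G'; split=> // i; rewrite /F' /G'.
  by case: fintype.split => j; case: (sFG j) => ? ?; split=> //; exact: smooth_derive.
move=> x Ux; rewrite derive_sum; last first.
  by move=> i; apply: diff_derivable; apply: differentiable_mulmx; auto.
rewrite big_split_ord /= -big_split /=; apply: eq_bigr => i _.
rewrite /F' /G'; rewrite -[lshift k i]/(unsplit (inl i)) -[rshift k i]/(unsplit (inr i)) !unsplitK.
by rewrite derive_mulmx; auto.
Qed.

Lemma smooth_on_trmx m n (A : V -> 'M[R]_(m, n)) :
  smooth_on U A -> smooth_on U (fun y => (A y)^T).
Proof.
move=> sA; apply: (@smooth_on_coind _ _ _ _ oU (fun h => exists2 A : V -> 'M[R]_(m, n),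
  smooth_on U A & h = fun y => (A y)^T)); last by exists A.
move=> _ [{sA}A sA ->]; split=> [x Ux|v].
  by apply: differentiable_trmx; exact: smooth_differentiable sA Ux.
exists (fun y => ('D_v A y)^T); first by exists ('D_v A) => //; exact: smooth_derive.
by move=> x Ux; rewrite derive_trmx//; exact: smooth_differentiable sA Ux.
Qed.

Lemma smooth_on_entry m n (A : V -> 'M[R]_(m, n)) i j :
  smooth_on U A -> smooth_on U (fun y => A y i j).
Proof.
move=> sA; apply: (@smooth_on_coind _ _ _ _ oU (fun h => exists2 A : V -> 'M[R]_(m, n),
  smooth_on U A & h = fun y => A y i j)); last by exists A.
move=> _ [{sA}A sA ->]; split=> [x Ux|v].
  by apply: differentiable_entry; exact: smooth_differentiable sA Ux.
exists (fun y => 'D_v A y i j); first by exists ('D_v A) => //; exact: smooth_derive.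
by move=> x Ux; rewrite derive_entry//; apply: diff_derivable; exact: smooth_differentiable sA Ux.
Qed.

Lemma smooth_on_mx m n (A : V -> 'M[R]_(m, n)) :
  (forall i j, smooth_on U (fun y => A y i j)) -> smooth_on U A.
Proof.
move=> sA; apply: (@smooth_on_coind _ _ _ _ oU (fun A : V -> 'M[R]_(m, n) =>
  forall i j, smooth_on U (fun y => A y i j))) => // {sA}A sA.
have dA x : U x -> differentiable A x.
  by move=> Ux; apply: differentiable_mx => i j; exact: smooth_differentiable (sA i j) Ux.
split=> // v; exists (fun y => \matrix_(i, j) 'D_v (fun y => A y i j) y).
  move=> i j; rewrite (_ : (fun y => _) = 'D_v (fun y => A y i j)).
    exact: smooth_derive.
  by apply/funext => y; rewrite mxE.
by move=> x Ux; rewrite derive_mx//; apply: diff_derivable; exact: dA.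
Qed.

End smooth_matrices.

(** * Symmetry of second derivatives *)

Lemma second_difference (R : realType) (V : normedModType R) (U : set V) (f : V -> R) x u v :
  open U -> smooth_on U f ->
  (forall s t, 0 <= s <= 1 -> 0 <= t <= 1 -> U (s *: u + (t *: v + x))) ->
  exists s t, [/\ 0 < s < 1, 0 < t < 1 &
    f (u + (v + x)) - f (u + x) - (f (v + x) - f x) =
    'D_v ('D_u f) (s *: u + (t *: v + x))].
Proof.
move=> oU sf Ux.
have UE s : 0 <= s <= 1 -> U (s *: u + x).
  by move=> s01; have := Ux s 0 s01; rewrite scale0r add0r; apply; rewrite lexx ler01.
have UE1 s : 0 <= s <= 1 -> U (s *: u + (v + x)).
  by move=> s01; have := Ux s 1 s01; rewrite scale1r; apply; rewrite lexx ler01.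
(* The mean value theorem is used twice: for the increment in [v] along [u], then for ['D_u f] along
   [v]. *)
pose g y := f (v + y) - f y.
have dfv y : U (v + y) -> differentiable (fun y => f (v + y)) y.
  move=> Uy; apply: (@differentiable_comp _ _ _ _ (fun y => v + y) f).
    by apply: (differentiableD (differentiable_cst _ _)).
  exact: smooth_differentiable Uy.
have [s s01|s s01] := @line_MVT _ _ g x u.
  apply: differentiableB.
    by apply: dfv; rewrite addrCA; exact: UE1.
  by apply: smooth_differentiable (UE _ s01).
rewrite /g (_ : v + (u + x) = u + (v + x)); last by rewrite addrCA.
move=> ->.
have s01' : 0 <= s <= 1 by move: s01 => /andP[? ?]; rewrite !ltW.
rewrite deriveB; last 2 first.
- by apply: diff_derivable; apply: dfv; rewrite addrCA; exact: UE1.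
- by apply: diff_derivable; exact: smooth_differentiable (UE _ s01').
rewrite (_ : 'D_u (fun y => f (v + y)) (s *: u + x) = 'D_u f (v + (s *: u + x))); last first.
  by apply: (@derive_affine _ _ _ _ (fun y => v + y) id) => h; rewrite addrCA.
have [t t01|t t01 ->] := @line_MVT _ _ ('D_u f) (s *: u + x) v.
  apply: (smooth_differentiable (smooth_derive u sf)).
  by rewrite addrCA; exact: Ux.
by exists s, t; rewrite (addrCA (t *: v)).
Qed.

Lemma derive_dirZ (R : realType) (V W : normedModType R) (f : V -> W) x (k : R) v :
  differentiable f x -> 'D_(k *: v) f x = k *: 'D_v f x.
Proof. by move=> df; rewrite !deriveE// linearZ. Qed.

Opaque derive diff.

(** The second difference over a parallelogram with sides [h u] and [h v] is symmetric in [u] and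
    [v], and equals [h ^ 2] times the mixed derivative in either order at some point of the
    parallelogram. For small [h] both mixed derivatives are within [e] of their values at [x]. *)
Lemma schwarz_real (R : realType) (V : normedModType R) (U : set V) (f : V -> R) x u v :
  open U -> smooth_on U f -> U x -> 'D_u ('D_v f) x = 'D_v ('D_u f) x.
Proof.
move=> oU sf Ux.
have near_sq (P : set V) (u' v' : V) : nbhs x P -> \forall e \near (0 : R)^'+,
    forall s t, 0 <= s <= 1 -> 0 <= t <= 1 -> P (s *: (e *: u') + (t *: (e *: v') + x)).
  move=> /nbhs_normP[d /= d0 dP].
  near=> e => s t /andP[s0 s1] /andP[t0 t1]; apply: dP => /=.
  rewrite addrA opprD addrCA subrr addr0 normrN.
  apply: (@le_lt_trans _ _ (e * (`|u'| + `|v'|))).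
    apply: (le_trans (ler_normD _ _)); rewrite !normrZ mulrDr.
    rewrite !(@ger0_norm _ e)// !ger0_norm//.
    by apply: lerD; rewrite ler_piMl// mulr_ge0.
  (* The summand [1] keeps the divisor positive when both sides of the parallelogram vanish. *)
  have n0 : 0 < `|u'| + `|v'| + 1 by rewrite ltr_wpDl// addr_ge0.
  apply: (@le_lt_trans _ _ (e * (`|u'| + `|v'| + 1))).
    by rewrite ler_wpM2l// lerDl.
  by rewrite -ltr_pdivlMr//; near: e; apply: nbhs_right_lt; rewrite divr_gt0.
have small_eq (a b : R) : (forall e, 0 < e -> `|a - b| < e + e) -> a = b.
  move=> abE; apply/eqP; rewrite -subr_eq0 -normr_eq0; apply/negPn/negP => ab.
  have ab0 : 0 < `|a - b| by rewrite lt_def ab normr_ge0.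
  by have := abE (`|a - b| / 2); rewrite divr_gt0// -splitr ltxx => /(_ isT).
apply: small_eq => e e0.
have cuv u' v' : \forall y \near x, `|'D_v' ('D_u' f) x - 'D_v' ('D_u' f) y| < e.
  have : {for x, continuous ('D_v' ('D_u' f))}.
    apply: differentiable_continuous.
    exact: smooth_differentiable (smooth_derive _ (smooth_derive _ sf)) Ux.
  by move=> /cvgrPdist_lt /(_ e e0).
have U1 : nbhs x U by exact: open_nbhs_nbhs.
have N1 := near_sq _ u v U1; have N2 := near_sq _ v u U1.
have N3 := near_sq _ u v (cuv u v); have N4 := near_sq _ v u (cuv v u).
have [h [[[h0 Uuv] [Uvu Cuv]] Cvu]] := filter_ex
  (filterI (filterI (filterI (nbhs_right_gt (0 : R)) N1) (filterI N2 N3)) N4).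
have eE u' v' y : U y ->
   'D_(h *: v') ('D_(h *: u') f) y = h ^+ 2 * 'D_v' ('D_u' f) y.
  move=> Uy.
  rewrite (@near_eq_derive _ _ _ _ (h \*: 'D_u' f)).
    rewrite deriveZ; last first.
      by apply: diff_derivable; exact: smooth_differentiable (smooth_derive _ sf) Uy.
    rewrite derive_dirZ; last by exact: smooth_differentiable (smooth_derive _ sf) Uy.
    by rewrite /GRing.scale /= mulrA expr2.
  apply: (open_near_eq oU Uy) => z Uz.
  by rewrite derive_dirZ//; exact: smooth_differentiable Uz.
have w01 (a : R) : 0 < a < 1 -> 0 <= a <= 1 by move=> /andP[? ?]; rewrite !ltW.
have [s1 [t1 [/w01 s11 /w01 t11 E1]]] := second_difference oU sf Uuv.
have [s2 [t2 [/w01 s21 /w01 t21 E2]]] := second_difference oU sf Uvu.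
have c1 := Cuv _ _ s11 t11; have c2 := Cvu _ _ s21 t21.
rewrite (eE _ _ _ (Uuv _ _ s11 t11)) in E1; rewrite (eE _ _ _ (Uvu _ _ s21 t21)) in E2.
rewrite (addrCA (h *: u) (h *: v) x) in E1.
have fin (a b c d : R) : `|a - c| < e -> `|b - d| < e -> c = d -> `|a - b| < e + e.
  move=> ac bd cd; rewrite -(subrK c a) -addrA.
  by apply: le_lt_trans (ler_normD _ _) _; apply: ltrD => //; rewrite cd distrC.
have swap (a b c d : R) : a - b - (c - d) = a - c - (b - d).
  by rewrite !opprB addrACA [RHS]addrACA [X in _ = _ + X]addrC.
apply: (fin _ _ _ _ c2 c1); apply: (mulfI (lt0r_neq0 (exprn_gt0 2 h0))).
exact: etrans (esym E2) (etrans (swap _ _ _ _) E1).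
Unshelve. all: by end_near. Qed.

Lemma schwarz (R : realType) (V : normedModType R) (U : set V) m n
    (f : V -> 'M[R]_(m, n)) x u v :
  open U -> smooth_on U f -> U x -> 'D_u ('D_v f) x = 'D_v ('D_u f) x.
Proof.
move=> oU sf Ux; apply/matrixP => i j.
have E u' v' : 'D_u' ('D_v' f) x i j = 'D_u' ('D_v' (fun y => f y i j)) x.
  rewrite derive_entry; last first.
    by apply: diff_derivable; exact: smooth_differentiable (smooth_derive _ sf) Ux.
  apply: near_eq_derive; apply: (open_near_eq oU Ux) => y Uy.
  by rewrite derive_entry//; apply: diff_derivable; exact: smooth_differentiable Uy.
have Er := schwarz_real u v oU (smooth_on_entry oU i j sf) Ux.
exact: etrans (E u v) (etrans Er (esym (E v u))).
Qed.

(** * Euclidean linear algebra *)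

Section euclidean_matrices.
Context {R : realType}.

Lemma dotE n (u v : 'rV[R]_n) : u *m v^T = (dot u v)%:M.
Proof. by rewrite /dot -mx11_scalar. Qed.

Lemma dotC n (u v : 'rV[R]_n) : dot u v = dot v u.
Proof. by rewrite /dot -{1}(trmxK u) -trmx_mul mxE. Qed.

Lemma dot_eq0 n (u v : 'rV[R]_n) : (dot u v = 0) <-> (u *m v^T = 0).
Proof.
rewrite dotE; split=> [->|/matrixP/(_ 0 0)]; first by rewrite raddf0.
by rewrite !mxE mulr1n.
Qed.

Lemma dotuu_ge0 n (u : 'rV[R]_n) : 0 <= dot u u.
Proof.
by rewrite /dot mxE sumr_ge0// => i _; rewrite mxE -expr2 sqr_ge0.
Qed.

Lemma dotuu_eq0 n (u : 'rV[R]_n) : dot u u = 0 -> u = 0.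
Proof.
rewrite /dot mxE => /eqP; rewrite psumr_eq0 => [|i _]; last first.
  by rewrite mxE -expr2 sqr_ge0.
move=> /allP u0; apply/rowP => i; rewrite mxE.
by have := u0 i (mem_index_enum _); rewrite mxE -expr2 sqrf_eq0 => /eqP.
Qed.

Lemma mulmx_tr_eq0 m n (A : 'M[R]_(m, n)) : A *m A^T = 0 -> A = 0.
Proof.
move=> A0; apply/row_matrixP => i; rewrite row0; apply: dotuu_eq0.
by apply/dot_eq0; rewrite tr_row colE mulmxA -row_mul A0 raddf0 mul0mx.
Qed.

Lemma orthogonal_submx m1 m2 m n (A : 'M[R]_(m1, n)) (B : 'M[R]_(m2, n)) (C : 'M[R]_(m, n)) :
  (A <= B)%MS -> B *m C^T = 0 -> A *m C^T = 0.
Proof. by move=> /submxP[D ->] BC; rewrite -mulmxA BC mulmx0. Qed.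

Lemma orthogonal_sym m1 m2 n (A : 'M[R]_(m1, n)) (B : 'M[R]_(m2, n)) :
  A *m B^T = 0 -> B *m A^T = 0.
Proof. by move=> AB; rewrite -(trmxK B) -trmx_mul AB trmx0. Qed.

Lemma tangent_normal_eq0 m1 m2 n (A : 'M[R]_(m1, n)) (B : 'M[R]_(m2, n)) :
  (A <= B)%MS -> A *m B^T = 0 -> A = 0.
Proof.
move=> AB AB0; apply: mulmx_tr_eq0; apply: (orthogonal_submx AB).
exact: orthogonal_sym.
Qed.

Lemma gram_unit m n (A : 'M[R]_(m, n)) : row_free A -> A *m A^T \in unitmx.
Proof.
rewrite -row_free_unit -!kermx_eq0 => fA; apply/rowV0P => v /sub_kermxP vA.
move: fA => /rowV0P; apply; apply/sub_kermxP; apply: mulmx_tr_eq0.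
by rewrite trmx_mul mulmxA -(mulmxA v) vA mul0mx.
Qed.

Lemma orthonormal_free m n (B : 'M[R]_(m, n)) : B *m B^T = 1%:M -> row_free B.
Proof. by move=> BB; apply/row_freeP; exists B^T. Qed.

Lemma orthonormal_proj m k n (B : 'M[R]_(m, n)) (A : 'M[R]_(k, n)) :
  B *m B^T = 1%:M -> (A <= B)%MS -> A *m B^T *m B = A.
Proof. by move=> BB /submxP[D ->]; rewrite -(mulmxA D) BB mulmx1. Qed.

Lemma gram_schmidt m n (A : 'M[R]_(m, n)) : row_free A ->
  exists B : 'M[R]_(m, n), B *m B^T = 1%:M /\ (B :=: A)%MS.
Proof.
elim: m A => [|m IHm] A fA.
  by exists A; split=> //; apply/matrixP => -[].
rewrite -[m.+1]/(1 + m)%N in A fA *.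
have fu : row_free (dsubmx A).
  rewrite -kermx_eq0; apply/rowV0P => v /sub_kermxP vA.
  move: fA; rewrite -kermx_eq0 => /rowV0P/(_ (row_mx 0 v)) v0.
  have : row_mx 0 v = 0 :> 'rV[R]_(1 + m).
    by apply/v0/sub_kermxP; rewrite -{1}(vsubmxK A) mul_row_col mul0mx add0r.
  by move/eqP; rewrite row_mx_eq0 => /andP[_ /eqP].
have [B [BB BA]] := IHm _ fu.
pose a := usubmx A - usubmx A *m B^T *m B.
have aB : a *m B^T = 0 by rewrite /a mulmxBl -[X in _ - X]mulmxA BB mulmx1 subrr.
have BleA : (B <= A)%MS.
  by rewrite BA -{2}(vsubmxK A) -addsmxE addsmxSr.
have aA : (a <= A)%MS.
  rewrite addmx_sub//; first by rewrite -{2}(vsubmxK A) -addsmxE addsmxSl.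
  by rewrite eqmx_opp (submx_trans _ BleA)// submxMl.
(* If the first row were in the span of the others, the rank of [A] would drop. *)
have a0 : 0 < dot a a.
  rewrite lt_def dotuu_ge0 andbT; apply/eqP => /dotuu_eq0 /eqP.
  rewrite subr_eq0 => /eqP uA.
  have : (A <= dsubmx A)%MS.
    by rewrite -{1}(vsubmxK A) col_mx_sub submx_refl andbT -BA uA submxMl.
  by move/mxrankS; rewrite (eqP fA) (eqP fu) ltnn.
pose c := (Num.sqrt (dot a a))^-1.
have BB1 : col_mx (c *: a) B *m (col_mx (c *: a) B)^T = 1%:M.
  rewrite tr_col_mx mul_col_row BB linearZ /= -!scalemxAl -!scalemxAr aB.
  rewrite (orthogonal_sym aB) !scaler0 dotE scalerA -expr2 exprVn sqr_sqrtr ?ltW//.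
  by rewrite scale_scalar_mx mulVf ?gt_eqF// -scalar_mx_block.
exists (col_mx (c *: a) B); split=> //; apply/eqmxP.
have := mxrank_leqif_eq (_ : (col_mx (c *: a) B <= A)%MS).
rewrite col_mx_sub (submx_trans (scalemx_sub _ (submx_refl a)) aA) BleA => /(_ isT) [_ <-].
by rewrite (eqP (orthonormal_free BB1)) (eqP fA).
Qed.

Lemma orthonormal_basis m n (A : 'M[R]_(m, n)) :
  exists B : 'M[R]_(\rank A, n), B *m B^T = 1%:M /\ (B :=: A)%MS.
Proof.
have [B [BB BA]] := gram_schmidt (row_base_free A).
by exists B; split=> //; exact: eqmx_trans BA (eq_row_base A).
Qed.

(** The span of a possibly infinite set of vectors, as a matrix. That [U] is not too large is
    phrased dually: whatever is orthogonal to [S] is orthogonal to [U]. A matrix of maximal rank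
    with this property absorbs every vector of [S]. *)
Lemma exists_span n (S : set 'rV[R]_n) : exists U : 'M[R]_n,
  (forall v, S v -> (v <= U)%MS) /\
  forall k (w : 'M[R]_(k, n)), (forall v, S v -> v *m w^T = 0) -> U *m w^T = 0.
Proof.
pose spanned (U : 'M[R]_n) := forall k (w : 'M[R]_(k, n)),
  (forall v, S v -> v *m w^T = 0) -> U *m w^T = 0.
pose P k := `[< exists2 U, spanned U & \rank U = k >].
have exP : exists k, P k.
  by exists 0%N; apply/asboolP; exists 0; [move=> k w _; rewrite mul0mx|rewrite mxrank0].
have ubP k : P k -> (k <= n)%N by move=> /asboolP[U _ <-]; exact: rank_leq_row.
case: (ex_maxnP exP ubP) => k /asboolP[U sU rU] maxU.
exists U; split=> // v Sv.
have sUv : spanned (U + v)%MS.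
  move=> j w Sw; apply: (@orthogonal_submx _ _ _ _ _ (col_mx U v)).
    by rewrite addsmxE.
  by rewrite mul_col_mx (sU _ _ Sw) (Sw _ Sv) col_mx0.
have /maxU : P (\rank (U + v)%MS) by apply/asboolP; exists (U + v)%MS.
rewrite -rU => rUv.
have [_] := mxrank_leqif_sup (addsmxSl U v).
rewrite eqn_leq rUv mxrankS ?addsmxSl// => /esym.
by rewrite addsmx_sub => /andP[].
Qed.

Lemma orthonormal_square m n (A : 'M[R]_(m, n)) :
  m = n -> A *m A^T = 1%:M -> A^T *m A = 1%:M.
Proof. by move=> mn; subst m; exact: mulmx1C. Qed.

Lemma stack_orthonormal r (n : 'I_r -> nat) N (E : forall a, 'M[R]_(n a, N)) :
  (forall a, E a *m (E a)^T = 1%:M) -> (forall a b, a != b -> E a *m (E b)^T = 0) ->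
  (\mxcol_a E a) *m (\mxcol_a E a)^T = 1%:M.
Proof.
move=> E1 E0; rewrite tr_mxcol mul_mxcol_mxrow -mxdiagZ; apply: eq_mxblock => i j.
case: eqVneq => [<-|/E0//]; by rewrite conform_mx_id E1.
Qed.

Lemma decomposition_complete r (n : 'I_r -> nat) N (E : forall a, 'M[R]_(n a, N)) :
  orthogonal_decomposition E -> \sum_a (E a)^T *m E a = 1%:M.
Proof.
move=> [E1 E0 nN]; rewrite -(orthonormal_square nN (stack_orthonormal E1 E0)).
by rewrite tr_mxcol mul_mxrow_mxcol.
Qed.

Lemma exists_decomposition r N (U : 'I_r -> 'M[R]_N) : (0 < r)%N ->
  (forall a b, a != b -> U a *m (U b)^T = 0) ->
  exists (n : 'I_r -> nat) (E : forall a, 'M[R]_(n a, N)),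
    orthogonal_decomposition E /\ forall a b, b != a -> U b *m (E a)^T = 0.
Proof.
move=> r0 UU; pose a0 := Ordinal r0.
(* The first summand absorbs the orthogonal complement of all the U a. *)
pose K := kermx (\sum_(b | b != a0) <<U b>>)%MS^T.
have KU b : b != a0 -> K *m (U b)^T = 0.
  move=> ba0; apply: orthogonal_sym.
  apply: (@orthogonal_submx _ _ _ _ _ (\sum_(b | b != a0) <<U b>>)%MS).
    by apply: (sumsmx_sup b) => //; rewrite genmxE.
  by apply: orthogonal_sym; rewrite /K mulmx_ker.
have subK m (w : 'M_(m, N)) : (forall b, b != a0 -> w *m (U b)^T = 0) -> (w <= K)%MS.
  move=> wU; apply/sub_kermxP; apply: orthogonal_sym.
  have /sub_sums_genmxP[u ->] := submx_refl (\sum_(b | b != a0) <<U b>>)%MS.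
  rewrite mulmx_suml big1// => b ba0; rewrite -mulmxA.
  by rewrite (orthogonal_sym (wU b ba0)) mulmx0.
pose U' a := if a == a0 then K else U a.
have [B] : exists B : forall a, 'M[R]_(\rank (U' a), N),
    forall a, B a *m (B a)^T = 1%:M /\ (B a :=: U' a)%MS.
  exists (fun a => sval (cid (orthonormal_basis (U' a)))) => a.
  by case: cid.
move=> Bb.
have BU a b : b != a -> U b *m (B a)^T = 0.
  move=> ba; apply: orthogonal_sym; apply: (@orthogonal_submx _ _ _ _ _ (U' a)).
    by have [_ ->] := Bb a.
  by rewrite /U'; case: (eqVneq a a0) => [aa0|_]; [apply: KU; rewrite -aa0|apply: UU; rewrite eq_sym].
have BB a b : a != b -> B a *m (B b)^T = 0.
  wlog ba0 : a b / b != a0 => [th|].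
    case: (eqVneq b a0) => [ba ab|/th]; last exact.
    by apply: orthogonal_sym; apply: th; [rewrite -ba|rewrite eq_sym].
  move=> ab; apply: orthogonal_sym; apply: (@orthogonal_submx _ _ _ _ _ (U b)).
    by have [_ ->] := Bb b; rewrite /U' (negPf ba0).
  by apply: BU; rewrite eq_sym.
have B1 a : B a *m (B a)^T = 1%:M by case: (Bb a).
exists (fun a => \rank (U' a)), B; split=> //; split=> //.
have SS := stack_orthonormal B1 BB.
have /eqP <- := orthonormal_free SS.
(* A vector orthogonal to all [B a] is orthogonal to [U b] for [b != a0], hence lies in [K], the
   span of [B a0], to which it is orthogonal as well. So the stacked rows span [R^N] and the ranks
   add up to [N]. *)
have : row_free (\mxcol_a B a)^T.
  rewrite -kermx_eq0; set w := kermx _.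
  have wB a : w *m (B a)^T = 0.
    have : w *m (\mxcol_a B a)^T = 0 by rewrite mulmx_ker.
    rewrite tr_mxcol mul_mxrow -[RHS](submxrowK 0) => /mxrowP/(_ a).
    by rewrite !mxrowK submxrow0.
  have wK : (w <= B a0)%MS.
    have [_ ->] := Bb a0; rewrite /U' eqxx; apply: subK => b ba0.
    apply: orthogonal_sym; apply: (@orthogonal_submx _ _ _ _ _ (B b)).
      by have [_ ->] := Bb b; rewrite /U' (negPf ba0).
    exact: orthogonal_sym.
  by rewrite (tangent_normal_eq0 wK (wB a0)).
by rewrite /row_free mxrank_tr => /eqP.
Qed.

(* The orthogonal projection onto the row space of [P], provided [P] is row-free: [invmx] is
   the identity on singular matrices. *)
Definition row_proj m n (P : 'M[R]_(m, n)) : 'M[R]_n :=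
  P^T *m invmx (P *m P^T) *m P.

Lemma row_proj_sub m n (P : 'M[R]_(m, n)) : (row_proj P <= P)%MS.
Proof. exact: submxMl. Qed.

Lemma row_proj_id m k n (P : 'M[R]_(m, n)) (A : 'M[R]_(k, n)) :
  row_free P -> (A <= P)%MS -> A *m row_proj P = A.
Proof.
move=> fP /submxP[D ->]; rewrite /row_proj !mulmxA -(mulmxA D) mulmxK//.
exact: gram_unit.
Qed.

Lemma tr_row_proj m n (P : 'M[R]_(m, n)) : (row_proj P)^T = row_proj P.
Proof. by rewrite /row_proj !trmx_mul trmx_inv trmx_mul !trmxK mulmxA. Qed.

(** Each projection fixes the rows of the other and both are symmetric, so transposing their product
    identifies them. *)
Lemma eqmx_row_proj m1 m2 n (P : 'M[R]_(m1, n)) (P' : 'M[R]_(m2, n)) :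
  row_free P -> row_free P' -> (P <= P')%MS -> (P' <= P)%MS ->
  row_proj P = row_proj P'.
Proof.
move=> fP fP' PP P'P.
have e1 : row_proj P *m row_proj P' = row_proj P.
  by apply: row_proj_id => //; exact: submx_trans (row_proj_sub _) PP.
have e2 : row_proj P' *m row_proj P = row_proj P'.
  by apply: row_proj_id => //; exact: submx_trans (row_proj_sub _) P'P.
have : (row_proj P *m row_proj P')^T = (row_proj P)^T by rewrite e1.
by rewrite trmx_mul !tr_row_proj e2.
Qed.

End euclidean_matrices.

(** * Normal bundles in coordinates *)

(** Write [Q] for the projection and [D] for a derivative. Differentiating [Q P^T = P^T], where
    [Q DP^T = DP^T] by the last hypothesis, gives [DQ P^T = 0]. So [DQ Q = 0], by symmetry
    [Q DQ = 0], and differentiating [Q Q = Q] leaves [DQ = 0]. *)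
Lemma row_proj_locally_constant (R : realType) (V : normedModType R) (U : set V)
    m n (P : V -> 'M[R]_(m, n)) x :
  open U -> U x -> (forall y, U y -> differentiable P y) ->
  (forall y, U y -> row_free (P y)) ->
  (forall y v, U y -> ('D_v P y <= P y)%MS) ->
  \forall y \near x, row_proj (P y) = row_proj (P x).
Proof.
move=> oU Ux dP fP DP; apply: (locally_constant (f := fun y => row_proj (P y))).
apply: filterS (open_nbhs_nbhs (conj oU Ux)) => y Uy.
have dQ z : U z -> differentiable (fun z => row_proj (P z)) z.
  move=> Uz; apply: differentiable_mulmx; last exact: dP.
  apply: differentiable_mulmx; first exact/differentiable_trmx/dP.
  apply: differentiable_invmx.
    by apply: differentiable_mulmx; [exact: dP|exact/differentiable_trmx/dP].
  apply: filterS (open_nbhs_nbhs (conj oU Uz)) => w Uw.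
  exact/gram_unit/fP.
split=> [|v]; first exact: dQ.
have dPy := dP _ Uy; have dQy := dQ _ Uy; have fPy := fP _ Uy.
pose Q z := row_proj (P z); rewrite -/Q.
have DT : ('D_v Q y)^T = 'D_v Q y.
  rewrite -derive_trmx//; congr ('D_v _ y); apply/funext => z.
  exact: tr_row_proj.
have QP : Q y *m (P y)^T = (P y)^T.
  by rewrite /Q -{1}(tr_row_proj (P y)) -trmx_mul row_proj_id.
have QDP : Q y *m ('D_v P y)^T = ('D_v P y)^T.
  by rewrite /Q -{1}(tr_row_proj (P y)) -trmx_mul row_proj_id// DP.
have DQP : 'D_v Q y *m (P y)^T = 0.
  have : 'D_v (fun z => Q z *m (P z)^T) y = 'D_v (fun z => (P z)^T) y.
    apply: near_eq_derive; apply: (open_near_eq oU Uy) => z Uz.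
    by rewrite /Q -{1}(tr_row_proj (P z)) -trmx_mul row_proj_id// fP.
  rewrite derive_mulmx//; last exact: differentiable_trmx.
  by rewrite derive_trmx// QDP => /(congr1 (fun A => A - ('D_v P y)^T)); rewrite addrK subrr.
have DQQ : 'D_v Q y *m Q y = 0 by rewrite /Q /row_proj !mulmxA DQP !mul0mx.
have QDQ : Q y *m 'D_v Q y = 0.
  by rewrite -DT /Q -{1}(tr_row_proj (P y)) -trmx_mul DQQ trmx0.
have : 'D_v (fun z => Q z *m Q z) y = 'D_v Q y.
  apply: near_eq_derive; apply: (open_near_eq oU Uy) => z Uz.
  by rewrite /Q row_proj_id ?row_proj_sub// fP.
by rewrite derive_mulmx// DQQ QDQ addr0 => <-.
Qed.

Section normal_part_theory.
Context {R : realType} {n N : nat} (fh : 'rV[R]_n -> 'rV[R]_N) (x : 'rV[R]_n).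

(** [proj_mx] acts as a projection for spaces with zero intersection, which positive definiteness
    provides. *)
Let cap0 : (kermx ('J fh x)^T :&: <<'J fh x>> = 0)%MS.
Proof.
apply/eqP; rewrite -submx0; apply/rV_subP => v; rewrite sub_capmx genmxE.
move=> /andP[/sub_kermxP vJ tv]; rewrite submx0; apply/eqP.
exact: tangent_normal_eq0 tv vJ.
Qed.

Lemma normal_part_normal v : v *m ('J fh x)^T = 0 -> normal_part fh x v = v.
Proof. by move=> vJ; rewrite /normal_part proj_mx_id//; exact/sub_kermxP. Qed.

Lemma normal_part_tangent v : (v <= 'J fh x)%MS -> normal_part fh x v = 0.
Proof. by move=> tv; rewrite /normal_part proj_mx_0// genmxE. Qed.

Lemma normal_partD u v : normal_part fh x (u + v) = normal_part fh x u + normal_part fh x v.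
Proof. by rewrite /normal_part mulmxDl. Qed.

Lemma normal_part_decomp u v : u *m ('J fh x)^T = 0 -> (v <= 'J fh x)%MS ->
  normal_part fh x (u + v) = u.
Proof.
by move=> un vt; rewrite normal_partD normal_part_normal// normal_part_tangent// addr0.
Qed.

End normal_part_theory.

Lemma jacobianE (R : realType) n N (f : 'rV[R]_n -> 'rV[R]_N) x v :
  v *m 'J f x = 'd f x v.
Proof. by rewrite /jacobian mul_rV_lin1. Qed.

Lemma jacobian_rowE (R : realType) n N (f : 'rV[R]_n -> 'rV[R]_N) x i :
  row i ('J f x) = 'd f x (delta_mx 0 i).
Proof. by rewrite rowE jacobianE. Qed.

Lemma normal_jacobian (R : realType) n N (f : 'rV[R]_n -> 'rV[R]_N) x k (w : 'M[R]_(k, N)) :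
  (forall v, w *m ('d f x v)^T = 0) -> w *m ('J f x)^T = 0.
Proof.
move=> wf; apply: orthogonal_sym; apply/row_matrixP => i.
by rewrite row_mul jacobian_rowE row0; apply: orthogonal_sym.
Qed.

Lemma jacobian_entry (R : realType) n N (f : 'rV[R]_n -> 'rV[R]_N) x i j :
  differentiable f x -> 'J f x i j = 'D_(delta_mx 0 i) f x 0 j.
Proof. by move=> df; rewrite deriveEjacobian// -rowE [RHS]mxE. Qed.

Lemma differentiable_jacobian (R : realType) n N (U : set 'rV[R]_n)
    (f : 'rV[R]_n -> 'rV[R]_N) x :
  open U -> smooth_on U f -> U x -> differentiable (jacobian f) x.
Proof.
move=> oU sf Ux; apply: differentiable_mx => i j.
apply: (@near_eq_differentiable _ _ _ (fun y => 'D_(delta_mx 0 i) f y 0 j)).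
  apply: (open_near_eq oU Ux) => y Uy; rewrite jacobian_entry//.
  exact: smooth_differentiable sf Uy.
apply: differentiable_entry.
exact: smooth_differentiable (smooth_derive _ sf) Ux.
Qed.

Lemma derive_jacobian (R : realType) n N (U : set 'rV[R]_n)
    (f : 'rV[R]_n -> 'rV[R]_N) x u v :
  open U -> smooth_on U f -> U x -> u *m 'D_v (jacobian f) x = 'D_v ('D_u f) x.
Proof.
move=> oU sf Ux; rewrite -derive_mulmxl; last exact: differentiable_jacobian Ux.
apply: near_eq_derive; apply: (open_near_eq oU Ux) => y Uy.
by rewrite jacobianE deriveE//; exact: smooth_differentiable sf Uy.
Qed.

(** * Flatness from a parallel normal frame *)

Section flatness.
Context {R : realType} {n N s : nat} (U : set 'rV[R]_n).
Variables (F : 'rV[R]_n -> 'rV[R]_N) (tau : 'rV[R]_n -> 'M[R]_(s, N)).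
Hypothesis oU : open U.
Hypothesis smooth_tau : smooth_on U tau.
Hypothesis tau_normal : forall x, U x -> tau x *m ('J F x)^T = 0.
Hypothesis tau_full : forall x (v : 'rV_N), U x -> (v - v *m (tau x)^T *m tau x <= 'J F x)%MS.
Hypothesis tau_parallel : forall x v, U x -> ('D_v tau x <= 'J F x)%MS.

Let dtau x : U x -> differentiable tau x.
Proof. exact: smooth_differentiable. Qed.

(** The defect is tangent by [tau_full] and normal by [tau_normal]. The rows of [tau] are a spanning
    family and not necessarily a basis, to cover the normal bundles of the single factors. *)
Lemma normal_frame_coef x (v : 'rV_N) : U x -> v *m ('J F x)^T = 0 ->
  v = v *m (tau x)^T *m tau x.
Proof.
move=> Ux vn; apply/eqP; rewrite -subr_eq0; apply/eqP.
apply: tangent_normal_eq0 (tau_full _ Ux) _.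
by rewrite mulmxBl vn -(mulmxA _ (tau x)) tau_normal// mulmx0 subrr.
Qed.

Lemma normal_conn_frame (d : 'rV[R]_n -> 'rV[R]_s) (X : 'rV[R]_n -> 'rV[R]_n)
    (xi : 'rV[R]_n -> 'rV[R]_N) x :
  U x -> differentiable d x -> (forall y, U y -> xi y = d y *m tau y) ->
  normal_conn F X xi x = 'D_(X x) d x *m tau x.
Proof.
move=> Ux dd xiE; rewrite /normal_conn.
have dxi : differentiable xi x.
  apply: (@near_eq_differentiable _ _ _ (fun y => d y *m tau y)).
    by apply: (open_near_eq oU Ux) => y Uy; rewrite xiE.
  by apply: differentiable_mulmx => //; exact: dtau.
rewrite -deriveE//.
rewrite (@near_eq_derive _ _ _ _ (fun y => d y *m tau y)); last exact: (open_near_eq oU Ux).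
rewrite derive_mulmx//; last exact: dtau.
apply: normal_part_decomp; first by rewrite -mulmxA tau_normal// mulmx0.
exact: submx_trans (submxMl _ _) (tau_parallel _ Ux).
Qed.

(** In the frame the normal connection is the plain derivative of the coefficients [c], so the
    curvature has the coefficients [D_X D_Y c - D_Y D_X c - D_[X,Y] c], which vanish by symmetry of
    second derivatives. *)
Lemma flat_of_frame (X Y : 'rV[R]_n -> 'rV[R]_n) (xi : 'rV[R]_n -> 'rV[R]_N) :
  smooth_on U X -> smooth_on U Y -> smooth_on U xi ->
  (forall x, U x -> forall Z, dot (xi x) ('d F x Z) = 0) ->
  forall x, U x -> normal_curvature F X Y xi x = 0.
Proof.
move=> sX sY sxi xin x Ux.
pose c y := xi y *m (tau y)^T.
have sc : smooth_on U c.
  by apply: smooth_on_mulmx => //; exact: smooth_on_trmx.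
have dc y : U y -> differentiable c y by exact: smooth_differentiable.
have xiE y : U y -> xi y = c y *m tau y.
  move=> Uy; apply: normal_frame_coef => //; apply: normal_jacobian => v.
  exact/dot_eq0/xin.
have dJ y : U y -> differentiable (jacobian c) y.
  exact: differentiable_jacobian.
(* The first terms, with the derivative of the field [z], make up the bracket; the second ones
   cancel by [schwarz]. *)
have conn Z (z : 'rV[R]_n -> 'rV[R]_n) : smooth_on U z -> U x ->
    normal_conn F Z (normal_conn F z xi) x =
    ('d c x ('d z x (Z x)) + 'D_(Z x) ('D_(z x) c) x) *m tau x.
  move=> sz _; have dz := smooth_differentiable sz Ux.
  rewrite (@normal_conn_frame (fun y => z y *m 'J c y)); last 3 first.
  - exact: Ux.
  - by apply: differentiable_mulmx; [|exact: dJ].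
  - move=> y Uy; rewrite (normal_conn_frame _ Uy (dc _ Uy) xiE).
    by rewrite jacobianE deriveE//; exact: dc.
  rewrite derive_mulmx//; last exact: dJ.
  by rewrite jacobianE (derive_jacobian _ _ oU sc Ux) deriveE.
rewrite /normal_curvature !conn// (normal_conn_frame _ Ux (dc _ Ux) xiE).
rewrite -!mulmxBl /lie_bracket [X in _ - X]deriveE; last exact: dc.
rewrite (schwarz (X x) (Y x) oU sc Ux) linearB /=.
rewrite opprD addrACA subrr addr0 subrr mul0mx //.
Qed.

End flatness.

(** * Manifolds and products *)

(** The level set of [h p] is open, and so is its complement. *)
Lemma connected_locally_constant (T : topologicalType) (A : Type) (h : T -> A) :
  connected [set: T] -> (forall p, \forall q \near p, h q = h p) ->
  forall p q, h p = h q.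
Proof.
move=> cT lh p q.
have oP (P : A -> Prop) : open [set q | P (h q)].
  by rewrite openE => t Pt; rewrite /interior /=; apply: filterS (lh t) => u /= ->.
have : [set q | h q = h p] = [set: T].
  apply: cT; first by exists p.
    by exists [set q | h q = h p]; [exact: (oP (fun a => a = h p))|rewrite setTI].
  exists [set q | h q = h p]; last by rewrite setTI.
  rewrite -openC (_ : ~` _ = [set q | h q <> h p]); last by [].
  exact: (oP (fun a => a <> h p)).
by move=> /seteqP[_ /(_ q I)] /= ->.
Qed.

Section manifolds.
Context {R : realType}.
Implicit Types M : manifold R.

Lemma chart_near M n (c : chart R M n) (p : M) (P : M -> Prop) : dom c p ->
  (\forall y \near fwd c p, P (bwd c y)) -> \forall q \near p, P q.
Proof.
move=> cp nP; have := fwd_continuous cp nP; rewrite /= => fP.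
near=> q; have cq : dom c q.
  by near: q; exact: open_nbhs_nbhs (conj (@dom_open _ _ _ c) cp).
by rewrite -(fwdK cq); near: q.
Unshelve. all: by end_near. Qed.

Lemma chart_near_constant M n (c : chart R M n) (p : M) (A : Type) (h : M -> A) : dom c p ->
  (\forall y \near fwd c p, h (bwd c y) = h (bwd c (fwd c p))) ->
  \forall q \near p, h q = h p.
Proof. by move=> cp; rewrite (fwdK cp) => nh; exact: (chart_near (P := fun q => h q = h p) cp). Qed.

Lemma manifold_constant M m n (h : M -> 'M[R]_(m, n)) : connected [set: M] ->
  (forall c y, atlas M c -> cod c y -> differentiable (h \o bwd c) y /\
    forall v, 'D_v (h \o bwd c) y = 0) ->
  forall p q, h p = h q.
Proof.
move=> cM hM; apply: connected_locally_constant => // p.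
have cp := dom_chart_at p.
apply: (chart_near_constant cp).
apply: (locally_constant (f := h \o bwd (chart_at p))).
apply: filterS (open_nbhs_nbhs (conj (@cod_open _ _ _ (chart_at p)) (fwd_cod cp))) => y.
exact/hM/chart_atP.
Qed.

(** Chain rule through the transition map. Either chart may be the preferred one: [c'] below in
    [diff_coord_vector], [c] in [diff_surjective]. *)
Lemma chart_change M N (h : M -> 'rV[R]_N) c c' x X : atlas M c -> atlas M c' ->
  cod c x -> dom c' (bwd c x) -> differentiable (h \o bwd c') (fwd c' (bwd c x)) ->
  'd (h \o bwd c) x X = 'd (h \o bwd c') (fwd c' (bwd c x)) ('d (fwd c' \o bwd c) x X) /\
  differentiable (h \o bwd c) x.
Proof.
move=> Mc Mc' cx c'x dh.
have dt : differentiable (fwd c' \o bwd c) x.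
  by apply: (smooth_differentiable (atlas_compat Mc Mc')).
have E : \forall y \near x, ((h \o bwd c') \o (fwd c' \o bwd c)) y = (h \o bwd c) y.
  apply: filterS (open_nbhs_nbhs (conj (@overlap_open _ _ _ c c') (conj cx c'x))) => y [_ c'y].
  by rewrite /= fwdK.
have dc := differentiable_comp dt dh.
have dhc := near_eq_differentiable E dc.
split; last exact: dhc.
have e1 := near_eq_derive X E.
have e2 := deriveE X dc; have e3 := deriveE X dhc.
have e4 := congr1 (fun l : 'rV[R]_(mdim M) -> 'rV[R]_N => l X) (diff_comp dt dh).
exact: etrans (esym e3) (etrans (esym e1) (etrans e2 e4)).
Qed.

Lemma diff_coord_vector M N (f : M -> 'rV[R]_N) c x X : smooth_map f -> atlas M c ->
  cod c x -> 'd (f \o bwd c) x X = tmap f (bwd c x) (coord_vector c x X).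
Proof.
move=> sf Mc cx; have Mp := chart_atP (bwd c x); have cp := dom_chart_at (bwd c x).
have df := smooth_differentiable (sf _ Mp) (fwd_cod cp).
by have [e _] := chart_change X Mc Mp cx cp df; exact: e.
Qed.

(** The differential in the preferred chart factors through the one in [c], so surjectivity passes
    to [c] without inverting the transition map. *)
Lemma diff_surjective M N (f : M -> 'rV[R]_N) c x : smooth_map f -> atlas M c ->
  cod c x -> (forall v, exists X, tmap f (bwd c x) X = v) ->
  forall v, exists X, 'd (f \o bwd c) x X = v.
Proof.
move=> sf Mc cx surj v; have [X <-] := surj v.
have Mp := chart_atP (bwd c x); have cp := dom_chart_at (bwd c x).
have cE : bwd (chart_at (bwd c x)) (Defs.coord (bwd c x)) = bwd c x by exact: fwdK.
have df : differentiable (f \o bwd c) (fwd c (bwd (chart_at (bwd c x)) (Defs.coord (bwd c x)))).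
  by rewrite cE bwdK//; exact: smooth_differentiable (sf _ Mc) cx.
have cx' : dom c (bwd (chart_at (bwd c x)) (Defs.coord (bwd c x))).
  by rewrite cE; exact: bwd_dom.
have [e _] := chart_change X Mp Mc (fwd_cod cp) cx' df.
rewrite cE bwdK// in e; eexists; exact: esym e.
Qed.

Section product.
Context {k : nat} (M : 'I_k -> manifold R).

Definition upd (p : prodM M) (i : 'I_k) (q : M i) : prodM M :=
  eqtype.dfwith (p : forall j, M j) q.
Arguments upd p [i] q.

Lemma upd_in p i (q : M i) : upd p q i = q.
Proof. exact: eqtype.dfwith_in. Qed.

Lemma upd_out p i (q : M i) j : i != j -> upd p q j = p j.
Proof. exact: eqtype.dfwith_out. Qed.

Lemma factor_connected : [set: prodM M] !=set0 -> connected [set: prodM M] ->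
  forall i, connected [set: M i].
Proof.
move=> [p _] cM i.
have -> : [set: M i] = (fun q : prodM M => q i) @` [set: prodM M].
  apply/seteqP; split=> // q _; exists (upd p q) => //.
  by rewrite upd_in.
apply: connected_continuous_connected => //.
by apply: continuous_subspaceT => q; exact: (@proj_continuous _ M i q).
Qed.

Lemma upd_id (p : prodM M) i : upd p (p i) = p.
Proof. by apply: functional_extensionality_dep => j;
  have [<-|ij] := eqVneq i j; [rewrite upd_in|rewrite upd_out]. Qed.

Lemma upd_upd (p : prodM M) i (q q' : M i) : upd (upd p q) q' = upd p q'.
Proof.
apply: functional_extensionality_dep => j; have [<-|ij] := eqVneq i j.
  by rewrite !upd_in.
by rewrite !upd_out.
Qed.

Lemma updC (p : prodM M) i j (q : M i) (q' : M j) : i != j ->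
  upd (upd p q) q' = upd (upd p q') q.
Proof.
move=> ij; apply: functional_extensionality_dep => l.
have [<-|jl] := eqVneq j l; first by rewrite upd_in upd_out// upd_in.
rewrite upd_out//; have [<-|il] := eqVneq i l; first by rewrite !upd_in.
by rewrite !upd_out.
Qed.

(* Two points that agree on the factors outside [S] are joined by changing the factors of [S]
   one at a time. *)
Lemma upd_invariant (A : Type) (h : prodM M -> A) (C : prodM M -> Prop) (S : {pred 'I_k}) :
  (forall p i (q : M i), i \in S -> C p -> C (upd p q) /\ h (upd p q) = h p) ->
  forall p p', (forall i, i \notin S -> p i = p' i) -> C p -> h p = h p'.
Proof.
move=> hS p p' pp' Cp.
pose mix (n : nat) : prodM M := fun i => if (i < n)%N then p' i else p i.
have mixS n : C (mix n) /\ h (mix n) = h p.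
  elim: n => [|n [Cn hn]].
    by rewrite (_ : mix 0%N = p)//; apply: functional_extensionality_dep.
  have [nk|nk] := ltnP n k; last first.
    rewrite (_ : mix n.+1 = mix n)//; apply: functional_extensionality_dep => i.
    by rewrite /mix !(leq_trans (ltn_ord i))// ltnW.
  pose j := Ordinal nk.
  have E : mix n.+1 = upd (mix n) (p' j).
    apply: functional_extensionality_dep => i; have [<-|ji] := eqVneq j i; [rewrite upd_in|rewrite upd_out//].
      by rewrite /mix /= ltnSn.
    rewrite /mix ltnS leq_eqVlt.
    by case: eqVneq => [e|//]; case/eqP: ji; exact/val_inj.
  have [jS|jS] := boolP (j \in S).
    by rewrite E; have [? ->] := hS _ _ (p' j) jS Cn.
  rewrite E (_ : p' j = mix n j) ?upd_id//.
  by rewrite /mix ltnn pp'.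
have [_ <-] := mixS k; congr h; apply: functional_extensionality_dep => i.
by rewrite /mix ltn_ord.
Qed.

End product.
End manifolds.

(** * Blocks of product coordinates *)

Section block_embedding.
Context {R : realType} {k : nat} {m : 'I_k -> nat}.

Definition emb (i : 'I_k) (X : 'rV[R]_(m i)) : 'rV[R]_(\sum_i m i) :=
  X *m submxcol 1%:M i.

Lemma submxrow_emb i (X : 'rV[R]_(m i)) : submxrow (emb X) i = X.
Proof.
by rewrite /emb -mul_submxrow -submxblockEv -(mxdiagZ (p_:=m) (1 : R)) submxblock_diag mulmx1.
Qed.

Lemma submxrow_emb_out i j (X : 'rV[R]_(m i)) : i != j -> submxrow (emb X) j = 0.
Proof.
move=> ij; rewrite /emb -mul_submxrow -submxblockEv -(mxdiagZ (p_:=m) (1 : R)) mxblockK.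
by rewrite (negPf ij) mulmx0.
Qed.

Lemma emb_sum (X : 'rV[R]_(\sum_i m i)) : X = \sum_i emb (submxrow X i).
Proof.
apply/mxrowP => j; rewrite submxrow_sum (bigD1 j)//= submxrow_emb big1 ?addr0//.
by move=> i ij; rewrite submxrow_emb_out.
Qed.

(** The counterpart of [upd] in product coordinates, affine in [y] with linear part [emb]. *)
Definition slot_path (x : 'rV[R]_(\sum_i m i)) (i : 'I_k) (y : 'rV[R]_(m i)) :=
  emb (y - submxrow x i) + x.

Lemma slot_path_in x i (y : 'rV[R]_(m i)) : submxrow (slot_path x y) i = y.
Proof. by rewrite submxrowD submxrow_emb subrK. Qed.

Lemma slot_path_out x i j (y : 'rV[R]_(m i)) : i != j ->
  submxrow (slot_path x y) j = submxrow x j.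
Proof. by move=> ij; rewrite submxrowD submxrow_emb_out// add0r. Qed.

Lemma slot_path_id x i : slot_path x (submxrow x i) = x.
Proof. by rewrite /slot_path subrr /emb mul0mx add0r. Qed.

Lemma slot_path_affine x i (y v : 'rV[R]_(m i)) (h : R) :
  slot_path x (h *: v + y) = h *: emb v + slot_path x y.
Proof. by rewrite /slot_path -addrA /emb mulmxDl -scalemxAl addrA. Qed.

Lemma differentiable_slot_path x i (y : 'rV[R]_(m i)) :
  differentiable (fun y : 'rV[R]_(m i) => slot_path x y) y.
Proof.
apply: (@differentiableD _ _ _ (fun y => emb (y - submxrow x i)) (cst x)) => //.
rewrite /emb; apply: (@differentiable_mulmx _ _ _ _ _ (fun y => y - submxrow x i) (cst _)) => //.
Qed.

End block_embedding.

Section product_chart.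
Context {R : realType} {k : nat} {T : 'I_k -> topologicalType} {n : 'I_k -> nat}.
Variable c : forall i, chart R (T i) (n i).
Arguments c : clear implicits.

Lemma cod_prodE x : cod (prod_chart c) x = (forall i, cod (c i) (submxrow x i)).
Proof. by []. Qed.

Lemma bwd_prodE x i : bwd (prod_chart c) x i = bwd (c i) (submxrow x i).
Proof. by []. Qed.

Lemma submxrow_fwd_prod p i : submxrow (fwd (prod_chart c) p) i = fwd (c i) (p i).
Proof. exact: mxrowK. Qed.

End product_chart.

(** * Restriction of a map to one factor *)

Section slots.
Context {R : realType} {k : nat} (M : 'I_k -> manifold R).
Variables (N : nat) (f : prodM M -> 'rV[R]_N).
Hypothesis sf : smooth_map f.

Definition slotD (p : prodM M) (i : 'I_k) (ci : chart R (M i) (mdim (M i)))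
    (X : 'rV[R]_(mdim (M i))) : 'rV[R]_N :=
  'D_X (fun y => f (upd p (bwd ci y))) (fwd ci (p i)).

Variable c : forall i, chart R (M i) (mdim (M i)).
Arguments c : clear implicits.
Hypothesis cA : forall i, atlas (M i) (c i).

Let pc : chart R (prodM M) (mdim (prodM M)) := prod_chart c.
Definition chart_rep : 'rV[R]_(\sum_i mdim (M i)) -> 'rV[R]_N := f \o bwd pc.

Lemma smooth_chart_rep : smooth_on (cod pc) chart_rep.
Proof. by apply: sf; exists c. Qed.

Lemma cod_slot_path x i (y : 'rV[R]_(mdim (M i))) : cod pc x -> cod (c i) y ->
  cod pc (slot_path x y).
Proof.
rewrite /pc !cod_prodE => cx cy j; have [<-|ij] := eqVneq i j.
  by rewrite slot_path_in.
by rewrite slot_path_out//; exact: cx.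
Qed.

Lemma bwd_slot_path x i (y : 'rV[R]_(mdim (M i))) :
  bwd pc (slot_path x y) = upd (bwd pc x) (bwd (c i) y).
Proof.
apply: functional_extensionality_dep => j; have [<-|ij] := eqVneq i j.
  by rewrite upd_in /pc bwd_prodE slot_path_in.
by rewrite upd_out// /pc !bwd_prodE slot_path_out.
Qed.

Lemma smooth_slot_path (W : normedModType R) (G : 'rV[R]_(\sum_i mdim (M i)) -> W) x i :
  cod pc x -> smooth_on (cod pc) G ->
  smooth_on (cod (c i)) (fun y : 'rV[R]_(mdim (M i)) => G (slot_path x y)).
Proof.
move=> cx sG.
apply: (@smooth_on_affine _ _ _ _ _ (cod pc) (fun y => slot_path x y) (fun v => emb v)) => //.
- exact: cod_open.
- by move=> y v h; exact: slot_path_affine.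
- by move=> y _; exact: differentiable_slot_path.
- by move=> y; exact: cod_slot_path.
Qed.

Lemma derive_slot_path (W : normedModType R) (G : 'rV[R]_(\sum_i mdim (M i)) -> W) x i
    (y X : 'rV[R]_(mdim (M i))) :
  'D_X (fun y : 'rV[R]_(mdim (M i)) => G (slot_path x y)) y = 'D_(emb X) G (slot_path x y).
Proof.
by apply: (@derive_affine _ _ _ _ (fun y => slot_path x y) (fun v => emb v)) => h;
  exact: slot_path_affine.
Qed.

Lemma slotE x i (y : 'rV[R]_(mdim (M i))) :
  f (upd (bwd pc x) (bwd (c i) y)) = chart_rep (slot_path x y).
Proof. by rewrite -bwd_slot_path. Qed.

Lemma slotD_chart x i X : cod pc x -> slotD (bwd pc x) (c i) X = 'D_(emb X) chart_rep x.
Proof.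
move=> cx; rewrite /slotD (_ : fwd _ _ = submxrow x i); last exact: bwdK (cx i).
rewrite (_ : (fun y => _) = (fun y : 'rV[R]_(mdim (M i)) => chart_rep (slot_path x y))).
  by rewrite derive_slot_path slot_path_id.
by apply/funext => y; exact: slotE.
Qed.

End slots.

(** * Metric identities of a polar isometric immersion *)

Section product_vectors.
Context {R : realType} {k : nat} (M : 'I_k -> manifold R).

(** The preferred chart of the product at [p] is the product of the preferred charts, so in
    coordinates the projection is the linear map selecting a block. *)
Lemma mdiff_proj (p : prodM M) i X : mdiff (fun q : prodM M => q i) p X = submxrow X i.
Proof.
pose G (y : 'rV[R]_(\sum_i mdim (M i))) : 'rV[R]_(mdim (M i)) := mulmxr (submxrow 1%:M i) y.
pose H : 'rV[R]_(\sum_i mdim (M i)) -> 'rV[R]_(mdim (M i)) :=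
  fwd (chart_at (p i)) \o (fun q : prodM M => q i) \o bwd (chart_at p).
pose x := fwd (chart_at p) p.
have cx : cod (chart_at p) x by exact: fwd_cod (dom_chart_at p).
have GH : \forall y \near x, G y = H y.
  apply: filterS (open_nbhs_nbhs (conj (@cod_open _ _ _ (chart_at p)) cx)) => y cy.
  rewrite /G /H /= mul_submxrow mulmx1.
  by rewrite bwdK//; exact: cy.
have dG : differentiable G x by exact: mulmxr_differentiable.
have dH := near_eq_differentiable GH dG.
have e1 := near_eq_derive X GH; have e2 := deriveE X dG; have e3 := deriveE X dH.
have e4 := congr1 (fun l : 'rV[R]_(\sum_i mdim (M i)) -> 'rV[R]_(mdim (M i)) => l X)
  (diff_mulmxr (submxrow 1%:M i) x).
apply: etrans (etrans (esym e3) (etrans (esym e1) (etrans e2 e4))) _.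
by rewrite /= mul_submxrow mulmx1.
Qed.

Lemma submxrow_coord_vector (c : forall i, chart R (M i) (mdim (M i)))
    (x X : 'rV[R]_(\sum_i mdim (M i))) i :
  (forall i, atlas (M i) (c i)) -> cod (prod_chart c) x ->
  submxrow (@coord_vector R (prodM M) (prod_chart c) x X) i =
  coord_vector (c i) (submxrow x i) (submxrow X i).
Proof.
move=> cA cx; pose p := bwd (prod_chart c) x.
pose h j : 'rV[R]_(mdim (M j)) -> 'rV[R]_(mdim (M j)) :=
  fwd (chart_at (p j)) \o bwd (c j).
have dh j : differentiable (h j) (submxrow x j).
  have := atlas_compat (cA j) (chart_atP (p j)).
  move=> /smooth_differentiable; apply; split; first exact: cx.
  exact: dom_chart_at.
have E1 := deriveE X (differentiable_blockwise dh).
have E2 := deriveE (submxrow X i) (dh i).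
have E3 := derive_blockwise X dh.
rewrite -[RHS]/('d (h i) (submxrow x i) (submxrow X i)) -E2.
rewrite -[X in submxrow X]/('d (blockwise h) x X) -E1.
by rewrite E3 mxrowK.
Qed.

End product_vectors.

Lemma inner0l (R : realType) (M : manifold R) (g : riemannian_metric M) p X :
  inner g p 0 X = 0.
Proof. by rewrite /inner !mul0mx mxE. Qed.

Lemma inner0r (R : realType) (M : manifold R) (g : riemannian_metric M) p X :
  inner g p X 0 = 0.
Proof. by rewrite /inner trmx0 mulmx0 mxE. Qed.

Lemma coord_vector0 (R : realType) (M : manifold R) c (x : 'rV[R]_(mdim M)) :
  coord_vector c x 0 = 0.
Proof. exact: linear0. Qed.

(* [T(X, Y, Z) = <F_XY, F_Z>] is symmetric in [X, Y]; the three hypotheses make it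
   antisymmetric under the transposition of [Z] with either other argument. *)
Lemma koszul (R : realType) (V : normedModType R) (U : set V) N (F : V -> 'rV[R]_N) x X Y Z :
  open U -> smooth_on U F -> U x ->
  'D_X (fun y => dot ('D_Y F y) ('D_Z F y)) x = 0 ->
  'D_Y (fun y => dot ('D_Z F y) ('D_X F y)) x = 0 ->
  'D_Z (fun y => dot ('D_X F y) ('D_Y F y)) x = 0 ->
  dot ('D_X ('D_Y F) x) ('D_Z F x) = 0.
Proof.
move=> oU sF Ux.
have dF v : differentiable ('D_v F) x.
  exact: smooth_differentiable (smooth_derive v sF) Ux.
pose T u v w := dot ('D_u ('D_v F) x) ('D_w F x).
have dotD u v w : 'D_u (fun y => dot ('D_v F y) ('D_w F y)) x = T u v w + T u w v.
  have dvw : differentiable (fun y => 'D_v F y *m ('D_w F y)^T) x.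
    by apply: differentiable_mulmx; [exact: dF|exact/differentiable_trmx/dF].
  have e0 : derivable (fun y => 'D_v F y *m ('D_w F y)^T) x u by exact: diff_derivable.
  have e1 := derive_entry 0 0 e0.
  have e2 := derive_mulmx u (dF v) (differentiable_trmx (dF w)).
  have e3 := derive_trmx u (dF w).
  apply: etrans (esym e1) (etrans (congr1 (fun A : 'M_1 => A 0 0) e2) _).
  by rewrite e3 mxE; congr (_ + _); exact: dotC.
have Tsym u v w : T u v w = T v u w.
  have sch : 'D_u ('D_v F) x = 'D_v ('D_u F) x := schwarz u v oU sF Ux.
  exact: (congr1 (fun z : 'rV[R]_N => dot z ('D_w F x)) sch).
move=> /(etrans (esym (dotD X Y Z))) h1 /(etrans (esym (dotD Y Z X))) h2.
move=> /(etrans (esym (dotD Z X Y))) h3; rewrite -/(T X Y Z).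
move: {dotD} T Tsym h1 h2 h3 => T Tsym.
rewrite (Tsym Y X) (Tsym Z X) (Tsym Z Y).
move=> /eqP; rewrite addr_eq0 => /eqP ab /eqP; rewrite addr_eq0 => /eqP da.
move=> /eqP; rewrite addr_eq0 => /eqP bd.
have : T X Y Z = - T X Y Z by rewrite {1}ab bd opprK da.
by move/eqP; rewrite -addr_eq0 -mulr2n mulrn_eq0 => /eqP.
Qed.

Lemma derive_line_constant (R : realType) (V W : normedModType R) (f : V -> W) x v :
  (\forall h \near (0 : R), f (h *: v + x) = f x) -> 'D_v f x = 0.
Proof.
move=> fx; have := derive_line f x v 0; rewrite scale0r add0r => <-.
by rewrite (near_eq_derive (g := cst (f x)) _ fx) derive_cst.
Qed.

Section polar_isometry.
Context {R : realType} {r : nat} (M : 'I_r.+1 -> manifold R).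
Variables (g : riemannian_metric (prodM M)) (g0 : riemannian_metric (M ord0)).
Variable ga : forall a : 'I_r, M ord0 -> riemannian_metric (fibers M a).
Hypothesis hg : polar g g0 ga.
Variables (N : nat) (f : prodM M -> 'rV[R]_N).
Hypothesis hf : local_isometry g f.

Let sf : smooth_map f. Proof. by case: hf. Qed.

Section chart.
Variable c : forall i, chart R (M i) (mdim (M i)).
Arguments c : clear implicits.
Hypothesis cA : forall i, atlas (M i) (c i).
Let pc : chart R (prodM M) (mdim (prodM M)) := prod_chart c.
Let F := chart_rep f c.
Implicit Types x : 'rV[R]_(\sum_i mdim (M i)).

Local Notation embM := (@emb R r.+1 (fun i => mdim (M i)) _).

Let pcA : atlas (prodM M) pc. Proof. by exists c. Qed.
Let oU : open (cod pc). Proof. exact: cod_open. Qed.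
Let sF : smooth_on (cod pc) F. Proof. exact: smooth_chart_rep. Qed.
Let dF x : cod pc x -> differentiable F x. Proof. exact: smooth_differentiable. Qed.

Lemma dot_chart_rep x X Y : cod pc x ->
  dot ('D_X F x) ('D_Y F x) =
  inner g0 (bwd pc x ord0) (coord_vector (c ord0) (submxrow x ord0) (submxrow X ord0))
                           (coord_vector (c ord0) (submxrow x ord0) (submxrow Y ord0)) +
  \sum_(a < r) inner (ga a (bwd pc x ord0)) (bwd pc x (lift ord0 a))
    (coord_vector (c (lift ord0 a)) (submxrow x (lift ord0 a)) (submxrow X (lift ord0 a)))
    (coord_vector (c (lift ord0 a)) (submxrow x (lift ord0 a)) (submxrow Y (lift ord0 a))).
Proof.
move=> cx.
have DE Z : 'D_Z F x = tmap f (bwd pc x) (@coord_vector R (prodM M) pc x Z).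
  by rewrite (deriveE Z (dF cx)) -(@diff_coord_vector R (prodM M) N f pc x Z sf pcA cx).
have [iso _] := hf.2 (bwd pc x); rewrite !DE iso; have [_ ->] := hg.
rewrite !mdiff_proj !submxrow_coord_vector//; congr (_ + _).
by apply: eq_bigr => a _; rewrite !mdiff_proj !submxrow_coord_vector.
Qed.

Lemma chart_rep_orthogonal i j (X : 'rV[R]_(mdim (M i))) (Y : 'rV[R]_(mdim (M j))) x :
  i != j -> cod pc x -> dot ('D_(emb X) F x) ('D_(emb Y) F x) = 0.
Proof.
move=> ij cx.
have z l : submxrow (embM X) l = 0 \/ submxrow (embM Y) l = 0.
  have [il|il] := eqVneq i l; [right|by left; exact: submxrow_emb_out].
  by apply: submxrow_emb_out; rewrite -il eq_sym.
rewrite dot_chart_rep// big1 ?addr0 => [|a _].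
  by case: (z ord0) => ->; rewrite coord_vector0 ?inner0l ?inner0r.
by case: (z (lift ord0 a)) => ->; rewrite coord_vector0 ?inner0l ?inner0r.
Qed.

(** In [dot_chart_rep] only the term of the factor [i] survives, and it depends on the points of
    [M_0] and [M_i] alone. *)
Lemma chart_rep_metric i (X Y : 'rV[R]_(mdim (M i))) x x' :
  cod pc x -> cod pc x' -> submxrow x ord0 = submxrow x' ord0 ->
  submxrow x i = submxrow x' i ->
  dot ('D_(emb X) F x) ('D_(emb Y) F x) = dot ('D_(emb X) F x') ('D_(emb Y) F x').
Proof.
move=> cx cx' x0 xi.
apply: etrans (dot_chart_rep _ _ cx) (etrans _ (esym (dot_chart_rep _ _ cx'))).
have b l : submxrow x l = submxrow x' l -> bwd pc x l = bwd pc x' l.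
  by move=> e; rewrite -[LHS]/(bwd (c l) (submxrow x l)) e.
rewrite (b _ x0) x0; apply: (congr1 (fun z => _ + z)).
apply: eq_bigr => a _; rewrite !bwd_prodE.
have [ia|ia] := eqVneq i (lift ord0 a); first by subst i; rewrite xi.
rewrite (@submxrow_emb_out _ _ (fun i => mdim (M i)) _ _ X ia) !coord_vector0.
exact: etrans (inner0l _ _ _) (esym (inner0l _ _ _)).
Qed.

(** For distinct [j] and [l] the coefficient vanishes identically by orthogonality; for [j = l] it
    depends on the blocks [0] and [j] only, and the condition keeps [i] away from both. *)
Lemma derive_metric i j l (X : 'rV[R]_(mdim (M i))) (Y : 'rV[R]_(mdim (M j)))
    (Z : 'rV[R]_(mdim (M l))) x :
  cod pc x -> (j == l) ==> ((i != ord0) && (i != j)) ->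
  'D_(emb X) (fun y => dot ('D_(emb Y) F y) ('D_(emb Z) F y)) x = 0.
Proof.
move=> cx ijl; apply: derive_line_constant.
have nU : \forall h \near (0 : R), cod pc (h *: embM X + x).
  have := @continuous_line _ _ x (embM X) 0; rewrite /continuous_at scale0r add0r.
  by apply; exact: open_nbhs_nbhs.
apply: filterS nU => h ch; have [jl|jl] := eqVneq j l; last first.
  exact: etrans (chart_rep_orthogonal _ _ jl ch) (esym (chart_rep_orthogonal _ _ jl cx)).
case: _ / jl Z ijl => Z; rewrite eqxx /= => /andP[i0 ij].
have sub q : i != q -> submxrow (h *: embM X + x) q = submxrow x q.
  by move=> iq; rewrite submxrowD /emb scalemxAl -/(embM _) submxrow_emb_out// add0r.
by apply: chart_rep_metric; rewrite ?sub.
Qed.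

(** The conditions are those of [derive_metric] under cyclic permutation. They hold for
    [i = j = 0 < l], for [i > 0 = j] with [l] other than [i], and for distinct [i, j > 0] with any
    [l]: these cases are the three properties of polar metrics. *)
Lemma koszul_chart i j l (X : 'rV[R]_(mdim (M i))) (Y : 'rV[R]_(mdim (M j)))
    (Z : 'rV[R]_(mdim (M l))) x :
  cod pc x -> (j == l) ==> ((i != ord0) && (i != j)) ->
  (l == i) ==> ((j != ord0) && (j != l)) -> (i == j) ==> ((l != ord0) && (l != i)) ->
  'D_(emb X) ('D_(emb Y) F) x *m ('D_(emb Z) F x)^T = 0.
Proof.
move=> cx h1 h2 h3; apply/dot_eq0.
by apply: (koszul oU sF cx); exact: derive_metric.
Qed.

Lemma chart_rep_onto x (v : 'rV_N) : cod pc x -> exists X, 'D_X F x = v.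
Proof.
move=> cx; have [X <-] := diff_surjective sf pcA cx (hf.2 (bwd pc x)).2 v.
by exists X; rewrite deriveE//; exact: dF.
Qed.

End chart.
End polar_isometry.

(** * Tangent spaces of the factors *)

Section slot_jacobian.
Context {R : realType} {r : nat} (M : 'I_r.+1 -> manifold R).
Variables (g : riemannian_metric (prodM M)) (g0 : riemannian_metric (M ord0)).
Variable ga : forall a : 'I_r, M ord0 -> riemannian_metric (fibers M a).
Hypothesis hg : polar g g0 ga.
Variables (N : nat) (f : prodM M -> 'rV[R]_N).
Hypothesis hf : local_isometry g f.
Hypothesis hN : mdim (prodM M) = N.
Hypothesis cM : forall i, connected [set: M i].
Local Notation chartM i := (chart R (M i) (mdim (M i))).
Local Notation embM := (@emb R r.+1 (fun i => mdim (M i)) _).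
Implicit Types p : prodM M.

Let sf : smooth_map f. Proof. by case: hf. Qed.

Definition good (p : prodM M) (c : forall i, chartM i) :=
  forall i, atlas (M i) (c i) /\ dom (c i) (p i).

(** With preferred charts on the remaining factors, statements about one or two factors reduce to
    computations in a product chart. *)
Lemma exists_charts2 p i j (ci : chartM i) (cj : chartM j) : i != j ->
  atlas (M i) ci -> dom ci (p i) -> atlas (M j) cj -> dom cj (p j) ->
  exists c, [/\ good p c, c i = ci & c j = cj].
Proof.
move=> ij Mi di Mj dj.
pose c0 l : chartM l := chart_at (p l).
pose c := eqtype.dfwith (eqtype.dfwith c0 cj) ci.
have ci_ : c i = ci by exact: eqtype.dfwith_in.
have cj_ : c j = cj by rewrite /c eqtype.dfwith_out// eqtype.dfwith_in.
exists c; split=> // l.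
have [il|il] := eqVneq i l; first by subst l; rewrite ci_.
have [jl|jl] := eqVneq j l; first by subst l; rewrite cj_.
rewrite /c !eqtype.dfwith_out//; split; [exact: chart_atP|exact: dom_chart_at].
Qed.

Lemma exists_charts p i (ci : chartM i) : atlas (M i) ci -> dom ci (p i) ->
  exists c, good p c /\ c i = ci.
Proof.
move=> Mi di; pose c0 l : chartM l := chart_at (p l).
have ci_ : eqtype.dfwith c0 ci i = ci by exact: eqtype.dfwith_in.
exists (eqtype.dfwith c0 ci); split=> // l.
have [il|il] := eqVneq i l; first by subst l; rewrite ci_.
by rewrite !eqtype.dfwith_out//; split; [exact: chart_atP|exact: dom_chart_at].
Qed.

(* The rows of [slotJ p ci] form the basis of [f_* T_p M_i] given by the chart [ci]. *)
Definition slotJ p i (ci : chartM i) : 'M[R]_(mdim (M i), N) :=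
  'J (fun y => f (upd p (bwd ci y))) (fwd ci (p i)).

Section chart.
Variables (p : prodM M) (c : forall i, chartM i).
Hypothesis gc : good p c.
Let pc : chart R (prodM M) (mdim (prodM M)) := prod_chart c.
Let F := chart_rep f c.
Let x : 'rV[R]_(\sum_i mdim (M i)) := fwd pc p.

Let cA i : atlas (M i) (c i). Proof. by case: (gc i). Qed.
Let cp : dom pc p. Proof. by move=> i; case: (gc i). Qed.
Let cx : cod pc x. Proof. exact: fwd_cod. Qed.
Let xp : bwd pc x = p. Proof. exact: fwdK. Qed.
Let sF : smooth_on (cod pc) F. Proof. exact: smooth_chart_rep. Qed.

Lemma smooth_slot i : smooth_on (cod (c i)) (fun y => f (upd p (bwd (c i) y))).
Proof.
rewrite -xp.
rewrite (_ : (fun y => _) = (fun y : 'rV[R]_(mdim (M i)) => F (slot_path x y))).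
  exact: (@smooth_slot_path R r.+1 M c _ F x i cx sF).
by apply/funext => y; exact: slotE.
Qed.

Lemma slotJ_chart i (X : 'rV[R]_(mdim (M i))) : X *m slotJ p (c i) = 'D_(embM X) F x.
Proof.
have ds := smooth_differentiable (@smooth_slot i) (fwd_cod (gc i).2).
have e1 := deriveE X ds.
have e2 : slotD f (bwd pc x) (c i) X = 'D_(embM X) F x by exact: slotD_chart.
rewrite xp in e2; exact: etrans (jacobianE _ _ _) (etrans (esym e1) e2).
Qed.

Lemma slotJ_orthogonal_chart i j : i != j -> slotJ p (c i) *m (slotJ p (c j))^T = 0.
Proof.
move=> ij; apply/row_matrixP => u; rewrite row0 row_mul rowE.
apply: orthogonal_sym; apply/row_matrixP => v; rewrite row0 row_mul rowE.
rewrite !slotJ_chart; apply/dot_eq0.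
by apply: (chart_rep_orthogonal hg hf cA) cx; rewrite eq_sym.
Qed.

Lemma slotJ_span (v : 'rV_N) : exists X : forall i, 'rV[R]_(mdim (M i)),
  v = \sum_i X i *m slotJ p (c i).
Proof.
have [X <-] := chart_rep_onto hf cA v cx.
have dF : differentiable F x by exact: smooth_differentiable sF cx.
exists (fun i => submxrow X i); rewrite deriveE// {1}(emb_sum X) linear_sum.
apply: eq_bigr => i _; rewrite slotJ_chart; exact: esym (deriveE _ dF).
Qed.

(** By [slotJ_span], [w] is a vector of the factor [i] plus a part [u] in the other factors; [u] is
    orthogonal to each of these, hence to itself. *)
Lemma slot_sub i (w : 'rV_N) : (forall l, l != i -> w *m (slotJ p (c l))^T = 0) ->
  (w <= slotJ p (c i))%MS.
Proof.
move=> wl; have [X wE] := slotJ_span w.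
pose u := \sum_(l | l != i) X l *m slotJ p (c l).
suff w0 : u = 0 by rewrite wE (bigD1 i)//= -/u w0 addr0 submxMl.
have uE : u = w - X i *m slotJ p (c i) by rewrite wE (bigD1 i)//= addrAC subrr add0r.
apply: mulmx_tr_eq0; rewrite {2}/u raddf_sum mulmx_sumr big1// => l li.
rewrite /= trmx_mul mulmxA uE mulmxBl wl// -mulmxA slotJ_orthogonal_chart 1?eq_sym//.
by rewrite mulmx0 subrr mul0mx.
Qed.

(* The rows of all the [slotJ p (c l)] span [R^N] and there are [N] of them. *)
Lemma slotJ_free_chart i : row_free (slotJ p (c i)).
Proof.
have S1 : row_full (\mxcol_l slotJ p (c l)).
  rewrite -sub1mx; apply/rV_subP => v _; have [X ->] := slotJ_span v.
  by rewrite -mul_mxrow_mxcol submxMl.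
have S2 : row_free (\mxcol_l slotJ p (c l)).
  by rewrite /row_free; have /eqP -> := S1; rewrite -hN.
rewrite -kermx_eq0; apply/rowV0P => v /sub_kermxP vJ.
have : embM v *m (\mxcol_l slotJ p (c l)) = 0.
  by rewrite /emb -mulmxA submxcol_mul mul1mx mxcolK.
move/(congr1 (mulmx^~ (pinvmx (\mxcol_l slotJ p (c l))))); rewrite mul0mx mulmxKp//.
by move=> /(congr1 (fun A => submxrow A i)); rewrite submxrow_emb submxrow0.
Qed.

Lemma good_upd a y : cod (c a) y -> good (upd p (bwd (c a) y)) c.
Proof.
move=> cy i; split=> //; have [ai|ai] := eqVneq a i; last by rewrite upd_out//; case: (gc i).
by subst i; rewrite upd_in; exact: bwd_dom.
Qed.

End chart.

Section chart_derivative.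
Variables (p : prodM M) (c : forall i, chartM i).
Hypothesis gc : good p c.
Let pc : chart R (prodM M) (mdim (prodM M)) := prod_chart c.
Let F := chart_rep f c.
Let x : 'rV[R]_(\sum_i mdim (M i)) := fwd pc p.

Let cA i : atlas (M i) (c i). Proof. by case: (gc i). Qed.
Let cp : dom pc p. Proof. by move=> i; case: (gc i). Qed.
Let cx : cod pc x. Proof. exact: fwd_cod. Qed.
Let xp : bwd pc x = p. Proof. exact: fwdK. Qed.
Let sF : smooth_on (cod pc) F. Proof. exact: smooth_chart_rep. Qed.

Variable a : 'I_r.+1.
Implicit Types y : 'rV[R]_(mdim (M a)).

Lemma slotJ_path b y (X : 'rV[R]_(mdim (M b))) : cod (c a) y ->
  X *m slotJ (upd p (bwd (c a) y)) (c b) = 'D_(embM X) F (slot_path x y).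
Proof.
move=> cy; rewrite (slotJ_chart (good_upd gc cy)).
have cs := cod_slot_path cx cy.
have e : upd p (bwd (c a) y) = bwd pc (slot_path x y).
  by rewrite -{1}xp; exact: esym (bwd_slot_path _ _ _).
by rewrite e bwdK.
Qed.

Lemma smooth_slotJ_chart b :
  smooth_on (cod (c a)) (fun y => slotJ (upd p (bwd (c a) y)) (c b)).
Proof.
apply: (smooth_on_mx (@cod_open _ _ _ (c a))) => u v.
pose h (y : 'rV[R]_(mdim (M a))) : 'rV[R]_N := 'D_(embM (delta_mx 0 u)) F (slot_path x y).
apply: (@smooth_on_ext _ _ _ _ (@cod_open _ _ _ (c a)) (fun y => h y 0 v)).
  by move=> y cy; rewrite /h -slotJ_path// -rowE mxE.
apply: (smooth_on_entry (@cod_open _ _ _ (c a))).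
exact: (@smooth_slot_path R r.+1 M c _ ('D_(embM (delta_mx 0 u)) F) x a cx (smooth_derive _ sF)).
Qed.

(** The matrix form of [koszul_chart]: [Z] is the field along the factor [a], and the rows [u] and
    [v] are coordinate fields of the factors [b] and [l]. *)
Lemma derive_slotJ b l y Z : cod (c a) y ->
  (b == l) ==> ((a != ord0) && (a != b)) ->
  (l == a) ==> ((b != ord0) && (b != l)) -> (a == b) ==> ((l != ord0) && (l != a)) ->
  'D_Z (fun y => slotJ (upd p (bwd (c a) y)) (c b)) y *m
    (slotJ (upd p (bwd (c a) y)) (c l))^T = 0.
Proof.
move=> cy h1 h2 h3; pose P z := slotJ (upd p (bwd (c a) z)) (c b).
have dP : differentiable P y := smooth_differentiable (@smooth_slotJ_chart b) cy.
have cs := cod_slot_path cx cy.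
apply/row_matrixP => u; rewrite row0 row_mul rowE.
apply: orthogonal_sym; apply/row_matrixP => v; rewrite row0 row_mul rowE.
apply: orthogonal_sym; rewrite slotJ_path//.
have e1 := derive_mulmxl (delta_mx 0 u : 'rV_(mdim (M b))) Z dP.
pose G := 'D_(embM (delta_mx 0 u)) F.
have n1 : \forall z \near y, delta_mx 0 u *m P z = G (slot_path x z).
  by apply: (open_near_eq (@cod_open _ _ _ (c a)) cy) => z cz; exact: slotJ_path.
have e3 := near_eq_derive Z n1.
have e4 : 'D_Z (fun z : 'rV[R]_(mdim (M a)) => G (slot_path x z)) y =
  'D_(embM Z) G (slot_path x y) by exact: derive_slot_path.
have e5 : delta_mx 0 u *m 'D_Z P y = 'D_(embM Z) G (slot_path x y).
  exact: etrans (esym e1) (etrans e3 e4).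
rewrite e5; exact: (koszul_chart hg hf cA _ _ _ cs h1 h2 h3).
Qed.

End chart_derivative.
Lemma slotJ_orthogonal p i j (ci : chartM i) (cj : chartM j) : i != j ->
  atlas (M i) ci -> dom ci (p i) -> atlas (M j) cj -> dom cj (p j) ->
  slotJ p ci *m (slotJ p cj)^T = 0.
Proof.
move=> ij Mi di Mj dj; have [c [gc <- <-]] := exists_charts2 ij Mi di Mj dj.
exact: slotJ_orthogonal_chart.
Qed.

Lemma slotJ_free p i (ci : chartM i) : atlas (M i) ci -> dom ci (p i) ->
  row_free (slotJ p ci).
Proof.
by move=> Mi di; have [c [gc <-]] := exists_charts Mi di; exact: slotJ_free_chart.
Qed.

(** The point [p i] may lie outside the domain of [ci], as [upd] overwrites it. Smoothness being
    pointwise, the base point is moved to [p'] and the other charts are chosen after [y]. *)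
Lemma smooth_slot_upd p i (ci : chartM i) : atlas (M i) ci ->
  smooth_on (cod ci) (fun y => f (upd p (bwd ci y))).
Proof.
move=> Mi s y cy; pose p' := upd p (bwd ci y).
have di : dom ci (p' i) by rewrite /p' upd_in; exact: bwd_dom.
have [c [gc cE]] := exists_charts Mi di; subst ci.
have -> : (fun z => f (upd p (bwd (c i) z))) = (fun z => f (upd p' (bwd (c i) z))).
  by apply/funext => z; rewrite /p' upd_upd.
exact: smooth_slot gc i s y cy.
Qed.

Lemma slotJ_updE p i (ci : chartM i) y : cod ci y ->
  slotJ (upd p (bwd ci y)) ci = 'J (fun z => f (upd p (bwd ci z))) y.
Proof.
move=> cy; have e : fwd ci (upd p (bwd ci y) i) = y by rewrite upd_in bwdK.
have h : (fun z => f (upd (upd p (bwd ci y)) (bwd ci z))) = (fun z => f (upd p (bwd ci z))).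
  by apply/funext => z; rewrite upd_upd.
by rewrite /slotJ e h.
Qed.

Lemma derive_slot_upd p i (ci : chartM i) y X : atlas (M i) ci -> cod ci y ->
  'D_X (fun z => f (upd p (bwd ci z))) y = X *m slotJ (upd p (bwd ci y)) ci.
Proof.
move=> Mi cy; have ds := smooth_differentiable (@smooth_slot_upd p i ci Mi) cy.
by rewrite slotJ_updE// jacobianE; exact: deriveE.
Qed.

Lemma slotJ_chart_change p i (ci ci' : chartM i) :
  atlas (M i) ci -> dom ci (p i) -> atlas (M i) ci' -> dom ci' (p i) ->
  (slotJ p ci <= slotJ p ci')%MS.
Proof.
move=> Mi di Mi' di'; apply/row_subP => u; rewrite rowE jacobianE.
pose h (q : M i) := f (upd p q).
have cy := fwd_cod di; have K := fwdK di.
have di2 : dom ci' (bwd ci (fwd ci (p i))) by rewrite K.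
have dh : differentiable (h \o bwd ci') (fwd ci' (bwd ci (fwd ci (p i)))).
  by rewrite K; exact: smooth_differentiable (@smooth_slot_upd p i ci' Mi') (fwd_cod di').
have [e _] := chart_change (delta_mx 0 u) Mi Mi' cy di2 dh.
have e' := etrans e (esym (jacobianE _ _ _)).
move: e'; rewrite K => e'; apply/submxP; eexists; exact: e'.
Qed.

Lemma slot0_dot p (c0 : chartM ord0) X Y : atlas (M ord0) c0 -> dom c0 (p ord0) ->
  dot (X *m slotJ p c0) (Y *m slotJ p c0) =
  inner g0 (p ord0) (coord_vector c0 (fwd c0 (p ord0)) X)
                    (coord_vector c0 (fwd c0 (p ord0)) Y).
Proof.
move=> M0 d0; have [c [gc cE]] := exists_charts M0 d0; subst c0.
have cp : dom (prod_chart c) p by move=> i; case: (gc i).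
rewrite !(slotJ_chart gc).
have dE := dot_chart_rep hg hf (fun i => (gc i).1) (embM X) (embM Y) (fwd_cod cp).
apply: etrans dE _; rewrite [X in _ + X = _]big1 => [|a _]; last first.
  have z := @submxrow_emb_out R _ (fun i => mdim (M i)) ord0 (lift ord0 a) X isT.
  by rewrite z coord_vector0; exact: inner0l.
by apply: etrans (addr0 _) _; rewrite !submxrow_emb submxrow_fwd_prod fwdK.
Qed.

(** By [slot0_dot] the Gram matrix is a function of [p ord0]. Hence a matrix that orthonormalizes
    the basis on one leaf does so on all of them. *)
Lemma slot0_gram p p' (c0 : chartM ord0) : atlas (M ord0) c0 -> dom c0 (p ord0) ->
  p ord0 = p' ord0 ->
  slotJ p c0 *m (slotJ p c0)^T = slotJ p' c0 *m (slotJ p' c0)^T.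
Proof.
move=> M0 d0 pp'; have d0' : dom c0 (p' ord0) by rewrite -pp'.
have E (A : 'M[R]_(mdim (M ord0), N)) u v : (A *m A^T) u v = dot (delta_mx 0 u *m A) (delta_mx 0 v *m A).
  by rewrite /dot trmx_mul mulmxA -(mulmxA _ A) -rowE trmx_delta -colE !mxE.
apply/matrixP => u v.
apply: etrans (etrans (E _ u v) (slot0_dot _ _ M0 d0)) _.
by apply: etrans _ (esym (etrans (E _ u v) (slot0_dot _ _ M0 d0'))); rewrite pp'.
Qed.

Lemma smooth_slotJ p a b (ca : chartM a) (cb : chartM b) : a != b ->
  atlas (M a) ca -> atlas (M b) cb -> dom cb (p b) ->
  smooth_on (cod ca) (fun y => slotJ (upd p (bwd ca y)) cb).
Proof.
move=> ab Ma Mb db s y cy; pose p' := upd p (bwd ca y).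
have da : dom ca (p' a) by rewrite /p' upd_in; exact: bwd_dom.
have db' : dom cb (p' b) by rewrite /p' upd_out.
have [c [gc caE cbE]] := exists_charts2 ab Ma da Mb db'; subst ca cb.
have -> : (fun z => slotJ (upd p (bwd (c a) z)) (c b)) =
          (fun z => slotJ (upd p' (bwd (c a) z)) (c b)).
  by apply/funext => z; rewrite /p' upd_upd.
exact: (@smooth_slotJ_chart p' c gc a b).
Qed.

Lemma smooth_slotJ_diag p a (ca : chartM a) : atlas (M a) ca ->
  smooth_on (cod ca) (fun y => slotJ (upd p (bwd ca y)) ca).
Proof.
move=> Ma s y cy; pose p' := upd p (bwd ca y).
have da : dom ca (p' a) by rewrite /p' upd_in; exact: bwd_dom.
have [c [gc caE]] := exists_charts Ma da; subst ca.
have -> : (fun z => slotJ (upd p (bwd (c a) z)) (c a)) =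
          (fun z => slotJ (upd p' (bwd (c a) z)) (c a)).
  by apply/funext => z; rewrite /p' upd_upd.
exact: (@smooth_slotJ_chart p' c gc a a).
Qed.

Lemma slot_sub_mx p c i m (A : 'M[R]_(m, N)) : good p c ->
  (forall l, l != i -> A *m (slotJ p (c l))^T = 0) -> (A <= slotJ p (c i))%MS.
Proof.
move=> gc Al; apply/row_subP => u; apply: (slot_sub gc) => l li.
by rewrite -row_mul Al// row0.
Qed.

(* The mixed second derivatives [F_ab] vanish, being orthogonal to every factor. *)
Lemma slotJ_upd p a b (cb : chartM b) (q : M a) : a != b -> a != ord0 -> b != ord0 ->
  atlas (M b) cb -> dom cb (p b) -> slotJ (upd p q) cb = slotJ p cb.
Proof.
move=> ab a0 b0 Mb db.
pose h (t : M a) := slotJ (upd p t) cb.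
suff /(_ q (p a)) : forall t t', h t = h t' by rewrite /h upd_id.
apply: (manifold_constant (@cM a)) => ca y Ma cy.
have sh := @smooth_slotJ p a b ca cb ab Ma Mb db.
split; first exact: smooth_differentiable sh cy.
move=> Z; pose p' := upd p (bwd ca y).
have da : dom ca (p' a) by rewrite /p' upd_in; exact: bwd_dom.
have db' : dom cb (p' b) by rewrite /p' upd_out.
have [c [gc caE cbE]] := exists_charts2 ab Ma da Mb db'; subst ca cb.
have hE : h \o bwd (c a) = (fun z => slotJ (upd p' (bwd (c a) z)) (c b)).
  by apply/funext => z; rewrite /p' upd_upd.
have p'E : upd p' (bwd (c a) y) = p' by rewrite /p' upd_upd.
have D l : 'D_Z (h \o bwd (c a)) y *m (slotJ p' (c l))^T = 0.
  rewrite hE -{2}p'E; apply: (derive_slotJ gc Z cy).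
  - by rewrite a0 ab implybT.
  - by apply/implyP => /eqP ->; rewrite b0 eq_sym.
  - by rewrite (negPf ab).
exact: tangent_normal_eq0 (slot_sub_mx gc (fun l _ => D l)) (D b).
Qed.

(** The case [b = 0] of [derive_slotJ]: all [l] other than [a] are admissible, so only the
    [M_a]-component survives. *)
Lemma derive_slotJ0 p a (ca : chartM a) (c0 : chartM ord0) y Z : a != ord0 ->
  atlas (M a) ca -> atlas (M ord0) c0 -> dom c0 (p ord0) -> cod ca y ->
  ('D_Z (fun y => slotJ (upd p (bwd ca y)) c0) y <= slotJ (upd p (bwd ca y)) ca)%MS.
Proof.
move=> a0 Ma M0 d0 cy; pose p' := upd p (bwd ca y).
have da : dom ca (p' a) by rewrite /p' upd_in; exact: bwd_dom.
have d0' : dom c0 (p' ord0) by rewrite /p' upd_out.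
have [c [gc caE c0E]] := exists_charts2 a0 Ma da M0 d0'; subst ca c0.
have hE : (fun z => slotJ (upd p (bwd (c a) z)) (c ord0)) =
          (fun z => slotJ (upd p' (bwd (c a) z)) (c ord0)).
  by apply/funext => z; rewrite /p' upd_upd.
have p'E : upd p' (bwd (c a) y) = p' by rewrite /p' upd_upd.
rewrite hE; apply: (slot_sub_mx gc) => l la.
rewrite -{2}p'E; apply: (derive_slotJ gc Z cy).
- by rewrite a0 implybT.
- by rewrite (negPf la).
- by rewrite (negPf a0).
Qed.

(** The case [a = b = 0] of [derive_slotJ], where all nonzero [l] are admissible. *)
Lemma derive_slotJ00 p (c0 : chartM ord0) y Z : atlas (M ord0) c0 -> cod c0 y ->
  ('D_Z (fun y => slotJ (upd p (bwd c0 y)) c0) y <= slotJ (upd p (bwd c0 y)) c0)%MS.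
Proof.
move=> M0 cy; pose p' := upd p (bwd c0 y).
have d0 : dom c0 (p' ord0) by rewrite /p' upd_in; exact: bwd_dom.
have [c [gc c0E]] := exists_charts M0 d0; subst c0.
have hE : (fun z => slotJ (upd p (bwd (c ord0) z)) (c ord0)) =
          (fun z => slotJ (upd p' (bwd (c ord0) z)) (c ord0)).
  by apply/funext => z; rewrite /p' upd_upd.
have p'E : upd p' (bwd (c ord0) y) = p' by rewrite /p' upd_upd.
rewrite hE; apply: (slot_sub_mx gc) => l l0.
rewrite -{2}p'E; apply: (derive_slotJ gc Z cy).
- by rewrite eq_sym (negPf l0).
- by rewrite (negPf l0).
- by rewrite l0.
Qed.

End slot_jacobian.

Opaque slotJ.

(** * Splitting off the first factor *)

Section splitting.
Context {R : realType} {r : nat} (M : 'I_r.+1 -> manifold R).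
Variables (g : riemannian_metric (prodM M)) (g0 : riemannian_metric (M ord0)).
Variable ga : forall a : 'I_r, M ord0 -> riemannian_metric (fibers M a).
Hypothesis hg : polar g g0 ga.
Variables (N : nat) (f : prodM M -> 'rV[R]_N).
Hypothesis hf : local_isometry g f.
Hypothesis hN : mdim (prodM M) = N.
Hypothesis cM : forall i, connected [set: M i].
Local Notation chartM i := (chart R (M i) (mdim (M i))).
Local Notation slotJ := (slotJ f).
Implicit Types p : prodM M.

(* The [M_0]-leaves are totally geodesic, so their tangent spaces are constant. *)
Lemma slot0_constant p (q : M ord0) (c c' : chartM ord0) :
  atlas (M ord0) c -> dom c (p ord0) -> atlas (M ord0) c' -> dom c' q ->
  (slotJ (upd p q) c' <= slotJ p c)%MS.
Proof.
move=> Mc dc Mc' dc'.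
have free t (d : chartM ord0) : atlas (M ord0) d -> dom d t -> row_free (slotJ (upd p t) d).
  by move=> Md dt; apply: (slotJ_free hf hN Md); rewrite upd_in.
have change t (d d' : chartM ord0) : atlas (M ord0) d -> dom d t ->
    atlas (M ord0) d' -> dom d' t ->
    row_proj (slotJ (upd p t) d) = row_proj (slotJ (upd p t) d').
  move=> Md dt Md' dt'; apply: eqmx_row_proj; [exact: free|exact: free| |].
  - by apply: (slotJ_chart_change hf Md _ Md'); rewrite upd_in.
  - by apply: (slotJ_chart_change hf Md' _ Md); rewrite upd_in.
(* The basis [slotJ] depends on the chart while the projection onto its span does not, so [Q] can be
   compared between charts and shown to be locally constant. *)
pose Q (t : M ord0) := row_proj (slotJ (upd p t) (chart_at t)).
have QC : forall t t', Q t = Q t'.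
  apply: (connected_locally_constant (@cM ord0)) => t.
  have dt := dom_chart_at t; pose d := chart_at t.
  have Md : atlas (M ord0) d by exact: chart_atP.
  have lc := @row_proj_locally_constant R _ (cod d) _ _
    (fun y => slotJ (upd p (bwd d y)) d) (fwd d t) (@cod_open _ _ _ d) (fwd_cod dt).
  apply: (chart_near_constant dt); rewrite -/d.
  have {}lc : \forall y \near fwd d t,
      row_proj (slotJ (upd p (bwd d y)) d) = row_proj (slotJ (upd p (bwd d (fwd d t))) d).
    apply: lc.
    - by move=> y; exact: (smooth_differentiable (smooth_slotJ_diag hf p Md)).
    - by move=> y cy; apply: free => //; exact: bwd_dom.
    - by move=> y v cy; exact: (derive_slotJ00 hg hf p v Md cy).
  near=> y.
  have cy : cod d y by near: y; exact: open_nbhs_nbhs (conj (@cod_open _ _ _ d) (fwd_cod dt)).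
  have QE z : cod d z -> Q (bwd d z) = row_proj (slotJ (upd p (bwd d z)) d).
    move=> cz; apply: change => //; [exact: chart_atP|exact: dom_chart_at|exact: bwd_dom].
  rewrite (QE _ cy) (QE _ (fwd_cod dt)); near: y; exact: lc.
have fp := free _ _ Mc' dc'.
rewrite -(row_proj_id fp (submx_refl _)).
rewrite (change q c' (chart_at q) Mc' dc' (chart_atP q) (dom_chart_at q)).
rewrite -/(Q q) (QC q (p ord0)) /Q.
rewrite -(change _ c _ Mc dc (chart_atP _) (dom_chart_at _)) upd_id.
exact: submx_trans (submxMl _ _) (row_proj_sub _).
Unshelve. all: by end_near. Qed.

(** Two points of one leaf are compared, which equality of the induced metrics does not give. The
    derivative along [M_a] of either basis is tangent to [M_a] at its own point, hence orthogonal to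
    the leaf there, and the leaf has the same tangent space at the other point. *)
Lemma slot0_inner p p' (q : M ord0) (c c' : chartM ord0) :
  atlas (M ord0) c -> dom c (p ord0) -> atlas (M ord0) c' -> dom c' q ->
  p ord0 = p' ord0 ->
  slotJ p c *m (slotJ (upd p q) c')^T = slotJ p' c *m (slotJ (upd p' q) c')^T.
Proof.
move=> Mc dc Mc' dc' pp'.
pose h p := slotJ p c *m (slotJ (upd p q) c')^T.
pose C p := dom c (p ord0); pose S := [pred i : 'I_r.+1 | i != ord0].
have agree i : i \notin S -> p i = p' i by rewrite !inE negbK => /eqP ->.
suff inv p1 i (t : M i) : i \in S -> C p1 -> C (upd p1 t) /\ h (upd p1 t) = h p1.
  exact: (upd_invariant inv agree dc).
move: p1 i t => {agree dc pp'}p a t; rewrite inE => a0 dc; split.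
  by rewrite /C upd_out.
pose k (t : M a) := h (upd p t).
suff /(_ t (p a)) : forall t t', k t = k t' by rewrite /k upd_id.
apply: (manifold_constant (@cM a)) => ca y Ma cy.
pose A z := slotJ (upd p (bwd ca z)) c.
pose B z := slotJ (upd (upd p q) (bwd ca z)) c'.
have kE : k \o bwd ca = fun z => A z *m (B z)^T.
  by apply/funext => z; rewrite /k /h /A /B /= updC.
have dcq : dom c' ((upd p q) ord0) by rewrite upd_in.
have dA : differentiable A y := smooth_differentiable (smooth_slotJ hf a0 Ma Mc dc) cy.
have dB : differentiable B y := smooth_differentiable (smooth_slotJ hf a0 Ma Mc' dcq) cy.
have dBT := differentiable_trmx dB.
rewrite kE; have dAB := differentiable_mulmx dA dBT; split; first exact: dAB.
move=> v; apply: etrans (derive_mulmx v dA dBT) _; rewrite (derive_trmx v dB).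
have DA : ('D_v A y <= slotJ (upd p (bwd ca y)) ca)%MS.
  exact: (derive_slotJ0 hg hf v a0 Ma Mc dc cy).
have DB : ('D_v B y <= slotJ (upd (upd p q) (bwd ca y)) ca)%MS.
  exact: (derive_slotJ0 hg hf v a0 Ma Mc' dcq cy).
have da p1 : dom ca (upd p1 (bwd ca y) a) by rewrite upd_in; exact: bwd_dom.
have dc1 : dom c (upd p (bwd ca y) ord0) by rewrite upd_out.
have dc2 : dom c' (upd (upd p q) (bwd ca y) ord0) by rewrite upd_out.
have BA : (B y <= A y)%MS.
  have : (slotJ (upd (upd p (bwd ca y)) q) c' <= slotJ (upd p (bwd ca y)) c)%MS.
    exact: slot0_constant.
  by rewrite (updC p (bwd ca y) q a0).
have AB : (A y <= B y)%MS.
  pose p2 := upd (upd p q) (bwd ca y).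
  have : (slotJ (upd p2 (p ord0)) c <= slotJ p2 c')%MS by exact: slot0_constant.
  have p2E : upd p2 (p ord0) = upd p (bwd ca y).
    by rewrite /p2 (updC _ _ _ a0) upd_upd upd_id.
  by rewrite p2E.
have e1 : 'D_v A y *m (B y)^T = 0.
  apply: orthogonal_sym; apply: (orthogonal_submx BA); apply: orthogonal_sym.
  apply: (orthogonal_submx DA); exact: (slotJ_orthogonal hg hf a0 Ma (da _) Mc dc1).
have e2 : A y *m ('D_v B y)^T = 0.
  apply: orthogonal_sym; apply: (orthogonal_submx DB); apply: orthogonal_sym.
  apply: (orthogonal_submx AB); apply: orthogonal_sym.
  exact: (slotJ_orthogonal hg hf a0 Ma (da _) Mc' dc2).
by rewrite e1 e2 addr0.
Qed.

End splitting.

(** * Orthonormal frame of the leaves *)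

Section normal_frame.
Context {R : realType} {r : nat} (M : 'I_r.+1 -> manifold R).
Variables (g : riemannian_metric (prodM M)) (g0 : riemannian_metric (M ord0)).
Variable ga : forall a : 'I_r, M ord0 -> riemannian_metric (fibers M a).
Hypothesis hg : polar g g0 ga.
Variables (N : nat) (f : prodM M -> 'rV[R]_N).
Hypothesis hf : local_isometry g f.
Hypothesis hN : mdim (prodM M) = N.
Hypothesis cM : forall i, connected [set: M i].
Local Notation chartM i := (chart R (M i) (mdim (M i))).
Local Notation slotJ := (slotJ f).
Implicit Types p : prodM M.
Variable o : prodM M.
Let o0 : M ord0 := o ord0.
Let cs : chartM ord0 := chart_at o0.
Variable C : 'M[R]_(mdim (M ord0)).
Hypothesis hC : (C *m slotJ o cs) *m (C *m slotJ o cs)^T = 1%:M.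

(* An orthonormal frame of the tangent space of the [M_0]-leaf at [upd p o0]; it is normal
   to the product immersion. *)
Definition frame p := C *m slotJ (upd p (o ord0)) (chart_at (o ord0)).

Let Mcs : atlas (M ord0) cs. Proof. exact: chart_atP. Qed.
Let dcs : dom cs o0. Proof. exact: dom_chart_at. Qed.

Let C_unit : C \in unitmx.
Proof.
have : C *m (slotJ o cs *m (C *m slotJ o cs)^T) = 1%:M by rewrite mulmxA.
by move=> /mulmx1_unit[].
Qed.

Lemma frame_upd0 p (q : M ord0) : frame (upd p q) = frame p.
Proof. by rewrite /frame upd_upd. Qed.

(** [C] orthonormalizes the basis at [o], and the Gram matrix over [o ord0] is the same on every
    leaf. *)
Lemma frame_orthonormal p : frame p *m (frame p)^T = 1%:M.
Proof.
have e : slotJ o cs *m (slotJ o cs)^T =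
  slotJ (upd p o0) cs *m (slotJ (upd p o0) cs)^T.
  by apply: (slot0_gram hg hf Mcs dcs); rewrite upd_in.
rewrite /frame trmx_mul mulmxA -(mulmxA C) -/cs -/o0 -e mulmxA -mulmxA -trmx_mul.
exact: hC.
Qed.

Lemma frame_eqmx p : (frame p :=: slotJ (upd p o0) cs)%MS.
Proof. by apply: eqmxMfull; rewrite row_full_unit. Qed.

(** The frame is taken over [o0], but the tangent space is constant along the leaf. *)
Lemma sub_frame p (c : chartM ord0) : atlas (M ord0) c -> dom c (p ord0) ->
  (slotJ p c <= frame p)%MS.
Proof.
move=> Mc dc; rewrite frame_eqmx.
have e : upd (upd p o0) (p ord0) = p by rewrite upd_upd upd_id.
have dc0 : dom cs (upd p o0 ord0) by rewrite upd_in.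
by have := slot0_constant hg hf hN cM Mcs dc0 Mc dc; rewrite e.
Qed.

Lemma frame_sub p (c : chartM ord0) : atlas (M ord0) c -> dom c (p ord0) ->
  (frame p <= slotJ p c)%MS.
Proof. by move=> Mc dc; rewrite frame_eqmx; exact: (slot0_constant hg hf hN cM Mc dc Mcs dcs). Qed.

(** Coordinate fields of [M_0] have the same frame components on all leaves; this makes [base_map]
    common to them. *)
Lemma frame_inner p p' (c : chartM ord0) : atlas (M ord0) c -> dom c (p ord0) ->
  p ord0 = p' ord0 -> slotJ p c *m (frame p)^T = slotJ p' c *m (frame p')^T.
Proof.
move=> Mc dc pp'; have e := slot0_inner hg hf hN cM Mc dc Mcs dcs pp'.
have e' (A B : 'M[R]_(mdim (M ord0), N)) : A *m (C *m B)^T = A *m B^T *m C^T.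
  by rewrite trmx_mul mulmxA.
apply: etrans (e' _ _) (etrans _ (esym (e' _ _))).
exact: (congr1 (fun Z => Z *m C^T) e).
Qed.

Lemma frame_normal p a (ca : chartM a) : a != ord0 -> atlas (M a) ca -> dom ca (p a) ->
  frame p *m (slotJ p ca)^T = 0.
Proof.
move=> a0 Ma da; have [M0 d0] := (chart_atP (p ord0), dom_chart_at (p ord0)).
apply: (orthogonal_submx (frame_sub M0 d0)).
by apply: (slotJ_orthogonal hg hf) => //; rewrite eq_sym.
Qed.

Lemma smooth_frame p a (ca : chartM a) : a != ord0 -> atlas (M a) ca ->
  smooth_on (cod ca) (fun y => frame (upd p (bwd ca y))).
Proof.
move=> a0 Ma.
have -> : (fun y => frame (upd p (bwd ca y))) =
          (fun y => C *m slotJ (upd (upd p o0) (bwd ca y)) cs).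
  by apply/funext => y; rewrite /frame (updC _ _ _ a0).
have d0 : dom cs (upd p o0 ord0) by rewrite upd_in.
have sJ := smooth_slotJ hf a0 Ma Mcs d0.
exact: (smooth_on_mulmx (@cod_open _ _ _ ca) (smooth_on_cst (@cod_open _ _ _ ca) C) sJ).
Qed.

Lemma derive_frame p a (ca : chartM a) y Z : a != ord0 -> atlas (M a) ca -> cod ca y ->
  p ord0 = o ord0 ->
  ('D_Z (fun y => frame (upd p (bwd ca y))) y <= slotJ (upd p (bwd ca y)) ca)%MS.
Proof.
move=> a0 Ma cy p0.
have d0 : dom cs (p ord0) by rewrite p0.
have -> : (fun y => frame (upd p (bwd ca y))) =
          (fun y => C *m slotJ (upd p (bwd ca y)) cs).
  by apply/funext => z; rewrite /frame (updC _ _ _ a0) -p0 upd_id p0.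
have dJ := smooth_differentiable (smooth_slotJ hf a0 Ma Mcs d0) cy.
have e := derive_mulmxl C Z dJ; rewrite [X in (X <= _)%MS]e.
exact: submx_trans (submxMl _ _) (derive_slotJ0 hg hf Z a0 Ma Mcs d0 cy).
Qed.

(** The map [f_0], read off from the leaf through [o]. *)
Definition base_map (q : M ord0) : 'rV[R]_(mdim (M ord0)) :=
  (f (upd o q) - f o) *m (frame o)^T.

Let differentiable_slot p a (ca : chartM a) y : atlas (M a) ca -> cod ca y ->
  differentiable (fun y => f (upd p (bwd ca y))) y.
Proof. by move=> Ma; exact: (smooth_differentiable (smooth_slot_upd hf p Ma)). Qed.

Lemma leaf_splitting p : f p = f (upd p (o ord0)) + base_map (p ord0) *m frame p.
Proof.
pose u (q : M ord0) := f (upd p q) - f (upd p o0).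
have dk q c y : atlas (M ord0) c -> cod c y ->
    differentiable (fun z => f (upd q (bwd c z)) - f (upd q o0)) y.
  move=> Mc cy; have dq := differentiable_slot q Mc cy.
  exact: (differentiableB dq (differentiable_cst _ _)).
have Dk q c y v : atlas (M ord0) c -> cod c y ->
    'D_v (fun z => f (upd q (bwd c z)) - f (upd q o0)) y = v *m slotJ (upd q (bwd c y)) c.
  move=> Mc cy; have dq := @diff_derivable _ _ _ _ _ v (differentiable_slot q Mc cy).
  have e1 := deriveB dq (derivable_cst (f (upd q o0)) y v).
  by apply: etrans e1 _; rewrite derive_cst subr0; exact: (derive_slot_upd hf).
have dy c y : atlas (M ord0) c -> cod c y -> dom c (upd p (bwd c y) ord0).
  by move=> Mc cy; rewrite upd_in; exact: bwd_dom.
(* The part of the displacement off the frame: constant because the leaf is tangent to the frame,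
   and zero at [o0]. *)
pose k1 q := u q *m (1%:M - (frame p)^T *m frame p).
have k1C : forall q q', k1 q = k1 q'.
  apply: (manifold_constant (@cM ord0)) => c y Mc cy.
  have duy : differentiable (u \o bwd c) y := dk p c y Mc cy.
  have d1 := differentiable_mulmx duy (differentiable_cst (1%:M - (frame p)^T *m frame p) y).
  split; first exact: d1.
  move=> v; apply: etrans (derive_mulmxr _ _ duy) _.
  have e : 'D_v (u \o bwd c) y = v *m slotJ (upd p (bwd c y)) c := Dk p c y v Mc cy.
  rewrite e -(frame_upd0 p (bwd c y)) mulmxBr mulmx1 mulmxA.
  rewrite (orthonormal_proj (frame_orthonormal _)) ?subrr//.
  exact: submx_trans (submxMl _ _) (sub_frame Mc (dy _ _ Mc cy)).
(* The frame components of the displacement compared with those on the leaf through [o]: constant by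
   [frame_inner], and zero at [o0]. *)
pose k2 q := u q *m (frame p)^T - base_map q.
have k2C : forall q q', k2 q = k2 q'.
  apply: (manifold_constant (@cM ord0)) => c y Mc cy.
  have duy : differentiable (u \o bwd c) y := dk p c y Mc cy.
  have e : forall v, 'D_v (u \o bwd c) y = v *m slotJ (upd p (bwd c y)) c.
    by move=> v; exact: Dk p c y v Mc cy.
  pose w := fun z => f (upd o (bwd c z)) - f (upd o o0).
  have dwy : differentiable w y := dk o c y Mc cy.
  have dA := differentiable_mulmx duy (differentiable_cst (frame p)^T y).
  have dB := differentiable_mulmx dwy (differentiable_cst (frame o)^T y).
  have kE : k2 \o bwd c = (fun z => (u \o bwd c) z *m (frame p)^T) - (fun z => w z *m (frame o)^T).
    by apply/funext => z; rewrite /k2 /w /base_map /= /o0 upd_id.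
  rewrite kE; have dAB := differentiableB dA dB; split; first exact: dAB.
  move=> v; have e1 := deriveB (@diff_derivable _ _ _ _ _ v dA) (@diff_derivable _ _ _ _ _ v dB).
  apply: etrans e1 _.
  have e2 := derive_mulmxr (frame p)^T v duy; have e3 := derive_mulmxr (frame o)^T v dwy.
  have e4 : 'D_v w y = v *m slotJ (upd o (bwd c y)) c := Dk o c y v Mc cy.
  have po : upd p (bwd c y) ord0 = upd o (bwd c y) ord0 by rewrite !upd_in.
  have := frame_inner Mc (dy _ _ Mc cy) po; rewrite !frame_upd0 => fi.
  have e5 := etrans e2 (congr1 (fun z => z *m (frame p)^T) (e v)).
  have e6 := etrans e3 (congr1 (fun z => z *m (frame o)^T) e4).
  apply: etrans (congr2 (fun a b => a - b) e5 e6) _.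
  have ass m n (A B : 'M[R]_(m, n)) (A' B' : 'M[R]_(n, m)) (w' : 'rV[R]_m) :
      A *m A' = B *m B' -> w' *m A *m A' - w' *m B *m B' = 0.
    by move=> h; rewrite -!mulmxA h subrr.
  exact: ass fi.
have u0 : u o0 = 0 by rewrite /u subrr.
have e1 : u (p ord0) *m (1%:M - (frame p)^T *m frame p) = 0.
  by rewrite -/(k1 _) (k1C _ o0) /k1 u0 mul0mx.
have e2 : u (p ord0) *m (frame p)^T = base_map (p ord0).
  apply/eqP; rewrite -subr_eq0 -/(k2 _) (k2C _ o0) /k2 u0 mul0mx.
  by rewrite /base_map /o0 upd_id !subrr mul0mx subr0.
move: e1; rewrite mulmxBr mulmx1 mulmxA e2 => /eqP; rewrite subr_eq0 => /eqP <-.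
by rewrite /u upd_id addrC subrK.
Qed.

End normal_frame.

Opaque frame.

(** * Orthogonal splitting of the remaining factors *)

Section factors.
Context {R : realType} {r : nat} (M : 'I_r.+1 -> manifold R).
Variables (g : riemannian_metric (prodM M)) (g0 : riemannian_metric (M ord0)).
Variable ga : forall a : 'I_r, M ord0 -> riemannian_metric (fibers M a).
Hypothesis hg : polar g g0 ga.
Variables (N : nat) (f : prodM M -> 'rV[R]_N).
Hypothesis hf : local_isometry g f.
Hypothesis hN : mdim (prodM M) = N.
Hypothesis cM : forall i, connected [set: M i].
Local Notation chartM i := (chart R (M i) (mdim (M i))).
Local Notation slotJ := (slotJ f).
Local Notation up a := (lift ord0 a).
Implicit Types p : prodM M.
Variable o : prodM M.

Let up0 (a : 'I_r) : up a != ord0. Proof. by []. Qed.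

Let up_neq (a b : 'I_r) : a != b -> up a != up b.
Proof. by apply: contra => /eqP /lift_inj ->. Qed.

(** By [slotJ_upd] the coordinates in the factors other than [M_0] and [M_b] can be moved to those
    of [o] one at a time. *)
Lemma slotJ_leaf p b (cb : chartM (up b)) : p ord0 = o ord0 ->
  atlas (M (up b)) cb -> dom cb (p (up b)) ->
  slotJ p cb = slotJ (upd o (p (up b))) cb.
Proof.
move=> p0 Mb db; pose S := [pred i : 'I_r.+1 | (i != ord0) && (i != up b)].
have agree i : i \notin S -> p i = upd o (p (up b)) i.
  rewrite !inE negb_and !negbK => /orP[/eqP ->|/eqP ->]; last by rewrite upd_in.
  by rewrite upd_out.
pose C p1 := dom cb (p1 (up b)).
have inv p1 i (t : M i) : i \in S -> C p1 -> C (upd p1 t) /\ slotJ (upd p1 t) cb = slotJ p1 cb.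
  rewrite inE => /andP[i0 ib] d1; split; first by rewrite /C upd_out.
  exact: (slotJ_upd hg hf cM t ib i0 (up0 b) Mb d1).
exact: (upd_invariant inv agree db).
Qed.

Lemma exists_factor_spaces : (0 < r)%N ->
  exists (n : 'I_r -> nat) (E : forall a, 'M[R]_(n a, N)),
    orthogonal_decomposition E /\
    forall (a b : 'I_r) p (cb : chartM (up b)), b != a -> p ord0 = o ord0 ->
      atlas (M (up b)) cb -> dom cb (p (up b)) -> slotJ p cb *m (E a)^T = 0.
Proof.
move=> r0.
(* The vectors tangent to [M_a] along its slice through [o]; by [slotJ_leaf] other points over
   [o ord0] give nothing new. *)
pose S (a : 'I_r) : set 'rV[R]_N := [set v | exists (q : M (up a)) (ca : chartM (up a)),
  [/\ atlas (M (up a)) ca, dom ca q & (v <= slotJ (upd o q) ca)%MS]].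
pose U a := sval (cid (exists_span (S a))).
have US a v : S a v -> (v <= U a)%MS.
  by rewrite /U; case: cid => u /= [+ _]; apply.
have UO a k (w : 'M[R]_(k, N)) : (forall v, S a v -> v *m w^T = 0) -> U a *m w^T = 0.
  by rewrite /U; case: cid => u /= [_]; apply.
have SS a b v w : a != b -> S a v -> S b w -> v *m w^T = 0.
  move=> ab [q [ca [Ma da va]]] [t [cb [Mb db wb]]].
  (* The two vectors come from different points, but both are tangent at [p], where the factors are
     orthogonal. *)
  pose p := upd (upd o q) t.
  have pa : p (up a) = q by rewrite /p upd_out ?upd_in// up_neq// eq_sym.
  have pb : p (up b) = t by rewrite /p upd_in.
  have p0 : p ord0 = o ord0 by rewrite /p !upd_out.
  have da' : dom ca (p (up a)) by rewrite pa.
  have db' : dom cb (p (up b)) by rewrite pb.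
  have ea := slotJ_leaf p0 Ma da'; have eb := slotJ_leaf p0 Mb db'.
  rewrite pa in ea; rewrite pb in eb.
  have oo := slotJ_orthogonal hg hf (up_neq ab) Ma da' Mb db'.
  rewrite ea eb in oo.
  apply: (orthogonal_submx va); apply: orthogonal_sym; apply: (orthogonal_submx wb).
  exact: orthogonal_sym oo.
have UU a b : a != b -> U a *m (U b)^T = 0.
  move=> ab; apply: (UO a) => v Sv; apply: orthogonal_sym; apply: (UO b) => w Sw.
  exact: orthogonal_sym (SS _ _ _ _ ab Sv Sw).
have [n [E [dE UE]]] := exists_decomposition r0 UU.
exists n, E; split=> // a b p cb ba p0 Mb db; rewrite (slotJ_leaf p0 Mb db).
apply: (@orthogonal_submx _ _ _ _ _ _ (U b)); last exact: UE.
apply/row_subP => i; apply: US; exists (p (up b)), cb; split=> //; exact: row_sub.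
Qed.

(** For use with the components of [f] and of the frame in the [a]-th summand, whose derivatives
    along the other [M_b] vanish. *)
Lemma factor_invariant m n (h : prodM M -> 'M[R]_(m, n)) (a : 'I_r) :
  (forall (b : 'I_r) p (cb : chartM (up b)) y, b != a -> p ord0 = o ord0 ->
    atlas (M (up b)) cb -> cod cb y ->
    differentiable (fun y => h (upd p (bwd cb y))) y /\
    forall v, 'D_v (fun y => h (upd p (bwd cb y))) y = 0) ->
  forall p, p ord0 = o ord0 -> h p = h (upd o (p (up a))).
Proof.
move=> hh p p0; pose S := [pred i : 'I_r.+1 | (i != ord0) && (i != up a)].
have agree i : i \notin S -> p i = upd o (p (up a)) i.
  rewrite !inE negb_and !negbK => /orP[/eqP ->|/eqP ->]; last by rewrite upd_in.
  by rewrite upd_out.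
pose C p1 := p1 ord0 = o ord0.
have inv p1 i (t : M i) : i \in S -> C p1 -> C (upd p1 t) /\ h (upd p1 t) = h p1.
  rewrite inE => /andP[i0 ia] C1; split; first by rewrite /C upd_out.
  case: (unliftP ord0 i) t i0 ia => [b|] -> // t i0 ba.
  have {}ba : b != a by apply: contra ba => /eqP ->.
  pose k (t : M (up b)) := h (upd p1 t).
  suff /(_ t (p1 (up b))) : forall t t', k t = k t' by rewrite /k upd_id.
  by apply: (manifold_constant (@cM (up b))) => cb y Mb cy; exact: hh.
exact: (upd_invariant inv agree p0).
Qed.

End factors.

(** * Sums of functions of single blocks *)

Section block_sums.
Context {R : realType} {k : nat} {m : 'I_k -> nat} {p q : nat}.
Variable U : forall i, set 'rV[R]_(m i).
Arguments U : clear implicits.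
Hypothesis oU : forall i, open (U i).
Variable h : forall i, 'rV[R]_(m i) -> 'M[R]_(p, q).
Arguments h : clear implicits.
Hypothesis sh : forall i, smooth_on (U i) (h i).

Let UU := [set x : 'rV[R]_(\sum_i m i) | forall i, U i (submxrow x i)].
Definition block_sum (x : 'rV[R]_(\sum_i m i)) := \sum_i h i (submxrow x i).

Let oUU : open UU.
Proof.
rewrite openE => x Ux.
apply: (@filter_forall _ _ (fun i => [set y | U i (submxrow y i)]) (nbhs x)) => i.
exact: (@submxrow_continuous R k m i x _ (open_nbhs_nbhs (conj (@oU i) (Ux i)))).
Qed.

Let submxrow_affine i (x v : 'rV[R]_(\sum_i m i)) (t : R) :
  submxrow (t *: v + x) i = t *: submxrow v i + submxrow x i.
Proof. by rewrite submxrowD; congr (_ + _); apply/matrixP => u w; rewrite !mxE. Qed.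

Let differentiable_submxrow i (x : 'rV[R]_(\sum_i m i)) :
  differentiable (fun x : 'rV[R]_(\sum_i m i) => submxrow x i) x.
Proof.
rewrite (_ : (fun _ => _) = mulmxr (submxrow 1%:M i)); first exact: mulmxr_differentiable.
by apply/funext => y; rewrite /= mul_submxrow mulmx1.
Qed.

Let smooth_block i : smooth_on UU (fun x => h i (submxrow x i)).
Proof.
apply: (@smooth_on_affine _ _ _ _ _ (U i) (fun x => submxrow x i) (fun v => submxrow v i)) => //.
by move=> x v t; exact: submxrow_affine.
Qed.

Let block_sumE : block_sum = \sum_i (fun x => h i (submxrow x i)).
Proof. by apply/funext => x; rewrite fct_sumE. Qed.

Lemma smooth_block_sum : smooth_on UU block_sum.
Proof.
rewrite block_sumE; apply: (big_ind (fun h => smooth_on UU h)) => [|a b sa sb|i _].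
- exact: (smooth_on_cst oUU 0).
- exact (smooth_onD oUU sa sb).
- exact: smooth_block.
Qed.

Lemma derive_block_sum x X : UU x ->
  'D_X block_sum x = \sum_i 'D_(submxrow X i) (h i) (submxrow x i).
Proof.
move=> Ux; rewrite block_sumE derive_sum; last first.
  by move=> i; apply: diff_derivable; exact: (smooth_differentiable (@smooth_block i) Ux).
apply: eq_bigr => i _.
apply: (@derive_affine _ _ _ _ (fun x => submxrow x i) (fun v => submxrow v i) (h i)) => t.
exact: submxrow_affine.
Qed.

End block_sums.

Lemma coord_vector_chart_at (R : realType) (M : manifold R) (q : M) X :
  coord_vector (chart_at q) (fwd (chart_at q) q) X = X.
Proof.
rewrite /coord_vector (fwdK (dom_chart_at q)).
pose c := chart_at q; pose x := fwd c q.
have cx : cod c x by exact: fwd_cod (dom_chart_at q).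
have E : \forall y \near x, id y = (fwd c \o bwd c) y.
  apply: filterS (open_nbhs_nbhs (conj (@cod_open _ _ _ c) cx)) => y cy.
  by rewrite /= bwdK.
have did : differentiable (id : 'rV[R]_(mdim M) -> 'rV[R]_(mdim M)) x by [].
have dt := near_eq_differentiable E did.
exact: etrans (esym (deriveE X dt)) (etrans (esym (near_eq_derive X E)) (derive_id _ _)).
Qed.

Lemma exists_family r (T : 'I_r.+1 -> Type) (x0 : T ord0) (x : forall a, T (lift ord0 a)) :
  exists y : forall i, T i, y ord0 = x0 /\ forall a, y (lift ord0 a) = x a.
Proof.
pose y i : T i := match unliftP ord0 i with
  | UnliftSome a e => ecast j (T j) (esym e) (x a)
  | UnliftNone e => ecast j (T j) (esym e) x0 end.
exists y; split=> [|a]; rewrite /y.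
  case: unliftP => [a e|e]; first by have := congr1 val e.
  by rewrite (eq_axiomK (esym e)).
case: unliftP => [b e|e]; last by have := congr1 val e.
have ab := lift_inj e; subst b; by rewrite (eq_axiomK (esym e)).
Qed.

(** * The product immersion and its normal frame *)

Section final.
Context {R : realType} {r : nat} (M : 'I_r.+1 -> manifold R).
Variables (g : riemannian_metric (prodM M)) (g0 : riemannian_metric (M ord0)).
Variable ga : forall a : 'I_r, M ord0 -> riemannian_metric (fibers M a).
Hypothesis hg : polar g g0 ga.
Variables (N : nat) (f : prodM M -> 'rV[R]_N).
Hypothesis hf : local_isometry g f.
Hypothesis hN : mdim (prodM M) = N.
Hypothesis cM : forall i, connected [set: M i].
Local Notation chartM i := (chart R (M i) (mdim (M i))).
Local Notation slotJ := (slotJ f).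
Local Notation up a := (lift ord0 a).
Local Notation s := (mdim (M ord0)).
Implicit Types p : prodM M.
Variable o : prodM M.
Variable C : 'M[R]_(mdim (M ord0)).
Hypothesis hC : (C *m slotJ o (chart_at (o ord0))) *m
                (C *m slotJ o (chart_at (o ord0)))^T = 1%:M.
Variables (n : 'I_r -> nat) (E : forall a, 'M[R]_(n a, N)).
Arguments E : clear implicits.
Hypothesis dE : orthogonal_decomposition E.
Hypothesis UE : forall (a b : 'I_r) p (cb : chartM (up b)), b != a -> p ord0 = o ord0 ->
  atlas (M (up b)) cb -> dom cb (p (up b)) -> slotJ p cb *m (E a)^T = 0.
Local Notation T := (frame f o C).

Let E1 := decomposition_complete dE.
Let EE a : E a *m (E a)^T = 1%:M. Proof. by case: dE. Qed.
Let sumE k (A : 'M[R]_(k, N)) : A = \sum_a A *m (E a)^T *m E a.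
Proof.
rewrite -{1}(mulmx1 A) -E1 mulmx_sumr; apply: eq_bigr => a _; exact: mulmxA.
Qed.

Lemma exists_join (q0 : M ord0) (pt : prodM (fibers M)) :
  exists p : prodM M, p ord0 = q0 /\ tail p = pt.
Proof.
have [F [F0 Fa]] := @exists_family r (fun i => M i) q0 pt; exists F; split=> //.
exact: functional_extensionality_dep.
Qed.

Lemma tail_upd0 p (q : M ord0) : tail (upd p q) = tail p.
Proof. by apply: functional_extensionality_dep => a; rewrite /tail upd_out. Qed.

(** By [UE] the tangent vectors of [M_b] over [o ord0] have no component in the other summands. *)
Lemma slotJ_E p b (cb : chartM (up b)) : p ord0 = o ord0 ->
  atlas (M (up b)) cb -> dom cb (p (up b)) ->
  slotJ p cb *m (E b)^T *m E b = slotJ p cb.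
Proof.
move=> p0 Mb db; rewrite [RHS]sumE (bigD1 b)//= big1 ?addr0// => a ab.
by rewrite (UE _ p0 Mb db) ?mul0mx// eq_sym.
Qed.

(** The tangent vectors of all factors span [R^N]. Once its frame part is removed, [w] is orthogonal
    to the frame, so its [M_0]-component is zero. *)
Lemma normal_split p c (w : 'rV[R]_N) : good p c ->
  exists X : forall b : 'I_r, 'rV[R]_(mdim (M (up b))),
    w = w *m (T p)^T *m T p + \sum_b X b *m slotJ p (c (up b)).
Proof.
move=> gc; have TT := frame_orthonormal hg hf hC p.
have [X uE] := slotJ_span hf gc (w - w *m (T p)^T *m T p).
have S0 := sub_frame hg hf hN cM hC (gc ord0).1 (gc ord0).2.
have Sb b : slotJ p (c (up b)) *m (T p)^T = 0.
  apply: orthogonal_sym; apply: (frame_normal hg hf hN cM hC _ (gc _).1 (gc _).2).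
  by [].
exists (fun b => X (up b)).
rewrite big_ord_recl in uE.
have X0 : X ord0 *m slotJ p (c ord0) = 0.
  rewrite -(orthonormal_proj TT (submx_trans (submxMl _ _) S0)).
  have : (w - w *m (T p)^T *m T p) *m (T p)^T = 0.
    by rewrite mulmxBl -(mulmxA _ (T p)) TT mulmx1 subrr.
  rewrite uE mulmxDl mulmx_suml big1 ?addr0 => [->|b _]; first by rewrite mul0mx.
  by rewrite -mulmxA Sb mulmx0.
by rewrite X0 add0r in uE; rewrite -uE addrC subrK.
Qed.

(** The immersion [f_a]: the [a]-th component of [f] on the slice of [M_a] through [o]. *)
Definition factor_map (a : 'I_r) (q : fibers M a) : 'rV[R]_(n a) :=
  f (upd o (q : M (up a))) *m (E a)^T.
Definition factor_frame (a : 'I_r) (q : fibers M a) : 'M[R]_(s, n a) :=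
  T (upd o (q : M (up a))) *m (E a)^T.
Definition prod_frame (pt : prodM (fibers M)) : 'M[R]_(s, N) :=
  \sum_a factor_frame (pt a) *m E a.
Local Notation ft := (product_map E factor_map).

Let upo a (q : M (up a)) : upd o q ord0 = o ord0. Proof. by rewrite upd_out. Qed.

Section factor_chart.
Variables (a : 'I_r) (c : chartM (up a)).
Hypothesis Mc : atlas (M (up a)) c.

Lemma smooth_factor_map : smooth_on (cod c) (@factor_map a \o bwd c).
Proof.
have oc := @cod_open _ _ _ c.
exact: (smooth_on_mulmx oc (smooth_slot_upd hf o Mc) (smooth_on_cst oc (E a)^T)).
Qed.

Lemma smooth_factor_frame : smooth_on (cod c) (@factor_frame a \o bwd c).
Proof.
have oc := @cod_open _ _ _ c.
have sT := smooth_frame hf o C o (erefl : up a != ord0) Mc.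
exact: (smooth_on_mulmx oc sT (smooth_on_cst oc (E a)^T)).
Qed.

Lemma derive_factor_map y X : cod c y ->
  'D_X (@factor_map a \o bwd c) y = X *m slotJ (upd o (bwd c y)) c *m (E a)^T.
Proof.
move=> cy; have ds := smooth_differentiable (smooth_slot_upd hf o Mc) cy.
have e1 := derive_mulmxr (E a)^T X ds; have e2 := derive_slot_upd hf o X Mc cy.
exact: etrans e1 (congr1 (fun z => z *m (E a)^T) e2).
Qed.

Lemma derive_factor_frame y X : cod c y ->
  ('D_X (@factor_frame a \o bwd c) y <= slotJ (upd o (bwd c y)) c *m (E a)^T)%MS.
Proof.
move=> cy.
have sT := smooth_frame hf o C o (erefl : up a != ord0) Mc.
have ds := smooth_differentiable sT cy.
have e1 := derive_mulmxr (E a)^T X ds; rewrite [X in (X <= _)%MS]e1.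
apply: submxMr; exact: (derive_frame hg hf C X _ Mc cy).
Qed.

End factor_chart.

(** The derivative of [T] along [M_b] is tangent to [M_b], hence orthogonal to the [a]-th summand,
    so the [a]-th component of [T] varies along [M_a] only. *)
Lemma frame_tail0 p : p ord0 = o ord0 -> T p = prod_frame (tail p).
Proof.
move=> p0; apply: etrans (sumE _) _; apply: eq_bigr => a _.
apply: (congr1 (fun z => z *m E a)).
apply: (@factor_invariant _ _ M cM o _ _ (fun p => T p *m (E a)^T) a _ p p0).
move=> b p1 cb y ba p10 Mb cy.
have ds := smooth_differentiable (smooth_frame hf o C p1 (erefl : up b != ord0) Mb) cy.
split=> [|v]; first exact: (differentiable_mulmx ds (differentiable_cst (E a)^T y)).
apply: etrans (derive_mulmxr (E a)^T v ds) _.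
have db : dom cb (upd p1 (bwd cb y) (up b)) by rewrite upd_in; exact: bwd_dom.
have p1o : upd p1 (bwd cb y) ord0 = o ord0 by rewrite upd_out.
exact: (orthogonal_submx (derive_frame hg hf C v (erefl : up b != ord0) Mb cy p10)
  (UE ba p1o Mb db)).
Qed.

Lemma frame_tail p : T p = prod_frame (tail p).
Proof.
have p0 : upd p (o ord0) ord0 = o ord0 by rewrite upd_in.
have e := etrans (esym (frame_upd0 f o C p (o ord0))) (frame_tail0 p0).
exact (etrans e (congr1 prod_frame (tail_upd0 p (o ord0)))).
Qed.

Lemma map_tail0 p : p ord0 = o ord0 -> f p = ft (tail p).
Proof.
move=> p0; apply: etrans (sumE _) _; apply: eq_bigr => a _.
apply: (congr1 (fun z => z *m E a)).
apply: (@factor_invariant _ _ M cM o _ _ (fun p => f p *m (E a)^T) a _ p p0).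
move=> b p1 cb y ba p10 Mb cy.
have ds := smooth_differentiable (smooth_slot_upd hf p1 Mb) cy.
split=> [|v]; first exact: (differentiable_mulmx ds (differentiable_cst (E a)^T y)).
apply: etrans (derive_mulmxr (E a)^T v ds) _.
have db : dom cb (upd p1 (bwd cb y) (up b)) by rewrite upd_in; exact: bwd_dom.
have p1o : upd p1 (bwd cb y) ord0 = o ord0 by rewrite upd_out.
have e := derive_slot_upd hf p1 v Mb cy.
apply: etrans (congr1 (fun z => z *m (E a)^T) e) _.
by rewrite -mulmxA (UE ba p1o Mb db) mulmx0.
Qed.

Lemma map_tail p : f p = ft (tail p) + base_map f o C (p ord0) *m prod_frame (tail p).
Proof.
have p0 : upd p (o ord0) ord0 = o ord0 by rewrite upd_in.
have e1 := etrans (map_tail0 p0) (congr1 ft (tail_upd0 p (o ord0))).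
have e2 := congr1 (mulmx (base_map f o C (p ord0))) (frame_tail p).
exact (etrans (leaf_splitting hg hf hN cM hC p) (congr2 +%R e1 e2)).
Qed.

Section prod_chart_frame.
Variable c : forall a, chart R (fibers M a) (mdim (fibers M a)).
Arguments c : clear implicits.
Hypothesis Mc : forall a, atlas (fibers M a) (c a).
Let pc : chart R (prodM (fibers M)) (mdim (prodM (fibers M))) := prod_chart c.
Let F : 'rV[R]_(\sum_a mdim (fibers M a)) -> 'rV[R]_N := ft \o bwd pc.
Let tau : 'rV[R]_(\sum_a mdim (fibers M a)) -> 'M[R]_(s, N) := prod_frame \o bwd pc.
Implicit Types x : 'rV[R]_(\sum_a mdim (fibers M a)).

Let oc a : open (cod (c a)). Proof. exact: cod_open. Qed.

Let sh a : smooth_on (cod (c a)) (fun y => factor_map (bwd (c a) y) *m E a).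
Proof.
exact: (smooth_on_mulmx (@oc a) (smooth_factor_map (Mc a)) (smooth_on_cst (@oc a) (E a))).
Qed.

Let st a : smooth_on (cod (c a)) (fun y => factor_frame (bwd (c a) y) *m E a).
Proof.
exact: (smooth_on_mulmx (@oc a) (smooth_factor_frame (Mc a)) (smooth_on_cst (@oc a) (E a))).
Qed.

Lemma smooth_prod_map : smooth_on (cod pc) F.
Proof. exact: (smooth_block_sum oc sh). Qed.

Lemma smooth_prod_frame : smooth_on (cod pc) tau.
Proof. exact: (smooth_block_sum oc st). Qed.

Section point.
Variables (x : 'rV[R]_(\sum_a mdim (fibers M a))) (p : prodM M).
Hypothesis cx : cod pc x.
Hypothesis p0 : p ord0 = o ord0.
Hypothesis px : tail p = bwd pc x.

Let pa a : p (up a) = bwd (c a) (submxrow x a).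
Proof. exact: (congr1 (fun q : prodM (fibers M) => q a) px). Qed.

Let da a : dom (c a) (p (up a)).
Proof. by rewrite pa; apply: bwd_dom; exact: cx. Qed.

Let slotE a : slotJ (upd o (bwd (c a) (submxrow x a) : M (up a))) (c a) = slotJ p (c a).
Proof. by rewrite -pa -(slotJ_leaf hg hf cM p0 (Mc a) (@da a)). Qed.

Lemma derive_prod_map X : 'D_X F x = \sum_a submxrow X a *m slotJ p (c a).
Proof.
apply: etrans (derive_block_sum oc sh X cx) _; apply: eq_bigr => a _.
have ds := smooth_differentiable (smooth_factor_map (Mc a)) (cx a).
apply: etrans (derive_mulmxr (E a) _ ds) _.
have e := derive_factor_map (Mc a) (submxrow X a) (cx a).
apply: etrans (congr1 (fun z => z *m E a) e) _.
by rewrite slotE -!mulmxA (mulmxA (slotJ _ _)) (slotJ_E p0 (Mc a) (@da a)).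
Qed.

Lemma jacobian_prod_map (X : 'rV[R]_(\sum_a mdim (fibers M a))) : X *m 'J F x = \sum_a submxrow X a *m slotJ p (c a).
Proof.
have ds := smooth_differentiable smooth_prod_map cx.
exact: etrans (jacobianE _ _ _) (etrans (esym (deriveE X ds)) (derive_prod_map X)).
Qed.

Lemma slot_sub_jacobian a : (slotJ p (c a) <= 'J F x)%MS.
Proof.
apply/row_subP => i; rewrite rowE; apply/submxP.
exists (@emb R r (fun a => mdim (fibers M a)) a (delta_mx 0 i)).
rewrite jacobian_prod_map (bigD1 a)//= submxrow_emb big1 ?addr0// => b ba.
by rewrite submxrow_emb_out 1?eq_sym// mul0mx.
Qed.

Lemma tauE : tau x = T p. Proof. by rewrite frame_tail px. Qed.

Lemma prod_frame_normal : tau x *m ('J F x)^T = 0.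
Proof.
rewrite tauE; apply: orthogonal_sym; apply/row_matrixP => i.
rewrite row0 row_mul rowE jacobian_prod_map mulmx_suml big1// => a _.
rewrite -mulmxA (orthogonal_sym _) ?mulmx0//.
by rewrite (frame_normal hg hf hN cM hC _ (Mc a) (@da a)).
Qed.

Lemma prod_frame_full (v : 'rV[R]_N) : (v - v *m (tau x)^T *m tau x <= 'J F x)%MS.
Proof.
rewrite tauE.
have [c' [c'0 c'a]] := @exists_family r (fun i => chartM i) (chart_at (p ord0)) c.
have gc : good p c'.
  move=> i; case: (unliftP ord0 i) => [a|] ->.
    by rewrite c'a; split; [exact: Mc|exact: da].
  by rewrite c'0; split; [exact: chart_atP|exact: dom_chart_at].
have [X e] := normal_split v gc.
have -> : v - v *m (T p)^T *m T p = \sum_b X b *m slotJ p (c' (up b)).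
  by apply/eqP; rewrite subr_eq addrC; apply/eqP.
apply: summx_sub => b _; rewrite c'a.
exact: submx_trans (submxMl _ _) (slot_sub_jacobian b).
Qed.

Lemma prod_frame_parallel v : ('D_v tau x <= 'J F x)%MS.
Proof.
have e := derive_block_sum oc st v cx.
rewrite [X in (X <= _)%MS]e; apply: summx_sub => a _.
have ds := smooth_differentiable (smooth_factor_frame (Mc a)) (cx a).
have e1 := derive_mulmxr (E a) (submxrow v a) ds; rewrite [X in (X <= _)%MS]e1.
have := submxMr (E a) (derive_factor_frame (Mc a) (submxrow v a) (cx a)).
rewrite slotE (slotJ_E p0 (Mc a) (@da a)) => h.
exact: submx_trans h (slot_sub_jacobian a).
Qed.

End point.
End prod_chart_frame.

Section factor_flatness.
Variables (a : 'I_r) (c : chart R (fibers M a) (mdim (fibers M a))).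
Hypothesis Mc : atlas (fibers M a) c.
Variable y : 'rV[R]_(mdim (fibers M a)).
Hypothesis cy : cod c y.
Let p : prodM M := upd o (bwd c y : M (up a)).

Let p0 : p ord0 = o ord0. Proof. exact: upo. Qed.

Let dc : dom (c : chartM (up a)) (p (up a)).
Proof. by rewrite /p upd_in; exact: bwd_dom. Qed.

Lemma jacobian_factor_map :
  'J (@factor_map a \o bwd c) y = slotJ p (c : chartM (up a)) *m (E a)^T.
Proof.
apply/row_matrixP => i; rewrite row_mul !rowE jacobianE.
have ds := smooth_differentiable (smooth_factor_map Mc) cy.
exact (etrans (esym (deriveE _ ds)) (derive_factor_map Mc _ cy)).
Qed.

Lemma factor_frame_normal :
  factor_frame (bwd c y) *m ('J (@factor_map a \o bwd c) y)^T = 0.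
Proof.
rewrite jacobian_factor_map /factor_frame -/p.
have e k m (A : 'M[R]_(k, N)) (B : 'M[R]_(m, N)) :
    A *m (E a)^T *m (B *m (E a)^T)^T = A *m (B *m (E a)^T *m E a)^T.
  by rewrite !trmx_mul !trmxK !mulmxA.
rewrite e (slotJ_E p0 Mc dc); exact: (frame_normal hg hf hN cM hC (erefl : up a != ord0) Mc dc).
Qed.

(** The [a]-th component of the splitting of [v *m E a]; the tangent vectors of the other factors
    are orthogonal to this summand and drop out. *)
Lemma factor_frame_full (v : 'rV[R]_(n a)) :
  (v - v *m (factor_frame (bwd c y))^T *m factor_frame (bwd c y)
    <= 'J (@factor_map a \o bwd c) y)%MS.
Proof.
rewrite jacobian_factor_map /factor_frame -/p.
have [c' [gc ca]] := exists_charts (Mc : atlas (M (up a)) c) dc.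
have [X e] := normal_split (v *m E a) gc.
have := congr1 (fun w => w *m (E a)^T) e.
rewrite -mulmxA EE mulmx1 mulmxDl mulmx_suml (bigD1 a)//= big1 ?addr0 => [ve|b ba]; last first.
  by rewrite -mulmxA (UE ba p0 (gc _).1 (gc _).2) mulmx0.
have -> : v - v *m (T p *m (E a)^T)^T *m (T p *m (E a)^T) = X a *m slotJ p (c' (up a)) *m (E a)^T.
  have gen (A : 'M[R]_(s, N)) : v *m (A *m (E a)^T)^T *m (A *m (E a)^T) =
      v *m E a *m A^T *m A *m (E a)^T by rewrite (trmx_mul A) trmxK !mulmxA.
  by rewrite gen; apply/eqP; rewrite subr_eq addrC; apply/eqP; exact: ve.
by rewrite ca -mulmxA submxMl.
Qed.

Lemma factor_frame_parallel v :
  ('D_v (@factor_frame a \o bwd c) y <= 'J (@factor_map a \o bwd c) y)%MS.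
Proof. by rewrite jacobian_factor_map; exact: derive_factor_frame. Qed.

End factor_flatness.

Lemma flat_factor_map a : flat_normal_bundle (@factor_map a).
Proof.
move=> c Mc X Y xi sX sY sxi xin x cx.
exact: (flat_of_frame (@cod_open _ _ _ c) (smooth_factor_frame Mc)
  (factor_frame_normal Mc) (fun y v cy => factor_frame_full Mc cy v)
  (fun y v cy => factor_frame_parallel Mc cy v) sX sY sxi xin cx).
Qed.

Lemma immersion_factor_map a : immersion (@factor_map a).
Proof.
split=> [c Mc|q X Y]; first exact: smooth_factor_map.
have Mc : atlas (fibers M a) (chart_at q) by exact: chart_atP.
have dq : dom (chart_at q) q by exact: dom_chart_at.
have tE Z : tmap (@factor_map a) q Z =
    Z *m (slotJ (upd o (q : M (up a))) (chart_at q : chartM (up a)) *m (E a)^T).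
  have := jacobian_factor_map Mc (fwd_cod dq); rewrite (fwdK dq) => <-.
  exact: esym (jacobianE _ _ _).
have dq' : dom (chart_at q : chartM (up a)) (upd o (q : M (up a)) (up a)) by rewrite upd_in.
have K := slotJ_E (upo q) Mc dq'; have fr := slotJ_free hf hN Mc dq'.
(* Tangent vectors of [M_a] lie in the [a]-th summand, so [E a] undoes the projection. *)
rewrite !tE => /(congr1 (fun w => w *m E a)); rewrite -!mulmxA !(mulmxA (slotJ _ _)) K.
exact: row_free_inj.
Qed.

Lemma flat_product_map : flat_normal_bundle ft.
Proof.
move=> _ [c Mc <-] X Y xi sX sY sxi xin x cx.
have join y : exists p : prodM M, p ord0 = o ord0 /\ tail p = bwd (prod_chart c) y.
  exact: exists_join.
have h1 y : cod (prod_chart c) y ->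
    prod_frame (bwd (prod_chart c) y) *m ('J (ft \o bwd (prod_chart c)) y)^T = 0.
  by move=> cy; have [p [p0 px]] := join y; exact: (prod_frame_normal Mc cy p0 px).
have h2 y (v : 'rV_N) : cod (prod_chart c) y ->
    (v - v *m (prod_frame (bwd (prod_chart c) y))^T *m prod_frame (bwd (prod_chart c) y)
      <= 'J (ft \o bwd (prod_chart c)) y)%MS.
  by move=> cy; have [p [p0 px]] := join y; exact: (prod_frame_full Mc cy p0 px).
have h3 y v : cod (prod_chart c) y ->
    ('D_v (prod_frame \o bwd (prod_chart c)) y <= 'J (ft \o bwd (prod_chart c)) y)%MS.
  by move=> cy; have [p [p0 px]] := join y; exact: (prod_frame_parallel Mc cy p0 px).
exact: (flat_of_frame (@cod_open _ _ _ (prod_chart c)) (smooth_prod_frame Mc)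
  h1 h2 h3 sX sY sxi xin cx).
Qed.

Lemma smooth_base_map : smooth_map (base_map f o C).
Proof.
move=> c Mc; have oc := @cod_open _ _ _ c.
have sB := smooth_onD oc (smooth_slot_upd hf o Mc) (smooth_on_cst oc (- f o)).
exact: (smooth_on_mulmx oc sB (smooth_on_cst oc (T o)^T)).
Qed.

Lemma tmap_base_map q X :
  tmap (base_map f o C) q X = X *m (slotJ (upd o q) (chart_at q) *m (T o)^T).
Proof.
have Mq := chart_atP q; have dq := dom_chart_at q.
pose c := chart_at q; pose x := fwd c q.
have cx : cod c x by exact: fwd_cod.
have ds := smooth_differentiable (smooth_slot_upd hf o Mq) cx.
pose w y := f (upd o (bwd c y)) - f o.
have dw : differentiable w x by exact: (differentiableB ds (differentiable_cst (f o) x)).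
have e0 : 'D_X w x = X *m slotJ (upd o q) c.
  have dd : derivable (fun y => f (upd o (bwd c y))) x X by exact: diff_derivable.
  have e1 := deriveB dd (derivable_cst (f o) x X).
  have e2 := derive_slot_upd hf o X Mq cx; rewrite (fwdK dq) in e2.
  apply: etrans e1 _; rewrite derive_cst subr0; exact: e2.
have sf0 := smooth_differentiable (smooth_base_map Mq) cx.
have e3 := derive_mulmxr (T o)^T X dw.
have e4 := etrans e3 (congr1 (fun z => z *m (T o)^T) e0).
rewrite mulmxA; exact (etrans (esym (deriveE X sf0)) e4).
Qed.

Lemma slot0_frame (q : M ord0) : slotJ (upd o q) (chart_at q) *m (T o)^T *m T o =
  slotJ (upd o q) (chart_at q).
Proof.
have dq : dom (chart_at q) (upd o q ord0) by rewrite upd_in; exact: dom_chart_at.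
apply: (orthonormal_proj (frame_orthonormal hg hf hC o)).
rewrite -(frame_upd0 f o C o q); exact: (sub_frame hg hf hN cM hC (chart_atP q) dq).
Qed.

Lemma base_map_isometry : local_isometry g0 (base_map f o C).
Proof.
split=> [|q]; first exact: smooth_base_map.
have Mq := chart_atP q.
have dq : dom (chart_at q) (upd o q ord0) by rewrite upd_in; exact: dom_chart_at.
pose S := slotJ (upd o q) (chart_at q); pose A := S *m (T o)^T.
split=> [X Y|v].
  rewrite !tmap_base_map -/S -/A.
  have -> : dot (X *m A) (Y *m A) = dot (X *m S) (Y *m S).
    have dd k (B : 'M[R]_(s, k)) : dot (X *m B) (Y *m B) = (X *m (B *m B^T) *m Y^T) 0 0.
      by rewrite /dot (trmx_mul Y) !mulmxA.
    (* Taking frame components is isometric on the tangent space of the leaf, which the frame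
       spans. *)
    have AA : A *m A^T = S *m S^T.
      by rewrite /A (trmx_mul S) trmxK mulmxA slot0_frame.
    by rewrite !dd AA.
  apply: etrans (slot0_dot hg hf X Y Mq dq) _.
  by rewrite upd_in !coord_vector_chart_at.
(* [A] is square, so injectivity of the differential yields surjectivity. *)
have fA : A \in unitmx.
  rewrite -row_free_unit -kermx_eq0; apply/rowV0P => w /sub_kermxP wA.
  have fS : row_free S by exact: (slotJ_free hf hN Mq dq).
  apply: (row_free_inj fS); rewrite mul0mx /S -slot0_frame -/S -/A mulmxA wA.
  by rewrite mul0mx.
by exists (v *m invmx A); rewrite tmap_base_map -/S -/A mulmxKV.
Qed.

Lemma join_tail pt : exists p : prodM M, p ord0 = o ord0 /\ tail p = pt.
Proof. exact: exists_join. Qed.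

(** * The parallel bundle isometry *)

Section point_frame.
Variable pt : prodM (fibers M).
Let c a : chart R (fibers M a) (mdim (fibers M a)) := chart_at (pt a).
Arguments c : clear implicits.
Let Mc a : atlas (fibers M a) (c a). Proof. exact: chart_atP. Qed.
Let x : 'rV[R]_(\sum_a mdim (fibers M a)) := fwd (prod_chart c) pt.
Let cx : cod (prod_chart c) x. Proof. exact: fwd_cod (dom_chart_at pt). Qed.
Let xpt : bwd (prod_chart c) x = pt. Proof. exact: fwdK (dom_chart_at pt). Qed.
Let J := 'J (local_rep ft pt) (Defs.coord pt).
Let tau := (prod_frame \o bwd (chart_at pt)) : 'rV[R]_(mdim (prodM (fibers M))) -> 'M[R]_(s, N).

Lemma point_frame_orthonormal : prod_frame pt *m (prod_frame pt)^T = 1%:M.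
Proof.
have [p [_ <-]] := join_tail pt.
rewrite -frame_tail; exact: (frame_orthonormal hg hf hC).
Qed.

Lemma point_frame_normal : prod_frame pt *m J^T = 0.
Proof.
have [p [p0 px]] := join_tail pt; rewrite -[in LHS]xpt.
by apply: (prod_frame_normal Mc cx p0); rewrite px xpt.
Qed.

Lemma point_frame_full (v : 'rV[R]_N) :
  (v - v *m (prod_frame pt)^T *m prod_frame pt <= J)%MS.
Proof.
have [p [p0 px]] := join_tail pt; rewrite -[in X in (X <= _)%MS]xpt.
by apply: (prod_frame_full Mc cx p0); rewrite px xpt.
Qed.

Lemma point_frame_parallel v : ('D_v tau (Defs.coord pt) <= J)%MS.
Proof.
have [p [p0 px]] := join_tail pt.
by apply: (prod_frame_parallel Mc cx p0); rewrite px xpt.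
Qed.

Lemma smooth_point_frame : smooth_on (cod (chart_at pt)) tau.
Proof. exact: smooth_prod_frame Mc. Qed.

Lemma smooth_point_map : smooth_on (cod (chart_at pt)) (local_rep ft pt).
Proof. exact: smooth_prod_map Mc. Qed.

Lemma diff_point_frame (y : 'rV[R]_s) X :
  'd (fun z => y *m tau z) (Defs.coord pt) X = y *m 'D_X tau (Defs.coord pt) /\
  differentiable (fun z => y *m tau z) (Defs.coord pt).
Proof.
have dt := smooth_differentiable smooth_point_frame (fwd_cod (dom_chart_at pt)).
have dyt := differentiable_mulmx (differentiable_cst y (Defs.coord pt)) dt.
split; last exact: dyt.
exact (etrans (esym (deriveE X dyt)) (derive_mulmxl y X dt)).
Qed.

End point_frame.

Lemma frame_vector_normal pt (y : 'rV[R]_s) X : dot (y *m prod_frame pt) (tmap ft pt X) = 0.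
Proof.
apply/dot_eq0.
have e : tmap ft pt X = X *m 'J (local_rep ft pt) (Defs.coord pt) by exact: esym (jacobianE _ _ _).
by rewrite e trmx_mul mulmxA -(mulmxA y) point_frame_normal mulmx0 mul0mx.
Qed.

Definition frame_bundle (z : prodM (fibers M) * 'rV[R]_s) : normal_bundle ft :=
  NormalVector (frame_vector_normal z.1 z.2).

Lemma frame_bundle_onto pt (v : normal_bundle ft) : foot v = pt ->
  exists y, frame_bundle (pt, y) = v.
Proof.
case: v => q w wn /= qpt; subst q; pose J := 'J (local_rep ft pt) (Defs.coord pt).
have wJ : w *m J^T = 0 by apply: normal_jacobian => X; apply/dot_eq0; exact: wn.
have e : w *m (prod_frame pt)^T *m prod_frame pt = w.
  apply/esym/eqP; rewrite -subr_eq0; apply/eqP.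
  apply: tangent_normal_eq0 (point_frame_full pt w) _.
  by rewrite mulmxBl wJ -(mulmxA _ (prod_frame pt)) point_frame_normal mulmx0 subrr.
exists (w *m (prod_frame pt)^T); rewrite /frame_bundle /=.
move: (frame_vector_normal _ _); rewrite /= e => wn'.
by congr NormalVector; exact: Prop_irrelevance.
Qed.

Lemma frame_bundle_parallel : parallel_bundle_isometry frame_bundle.
Proof.
split=> [pt y|_ [c Mc <-]|pt a y y'|pt y y'|pt v|y pt X] //=.
- pose pc : chart R (prodM (fibers M)) (mdim (prodM (fibers M))) := prod_chart c.
  pose U : set ('rV[R]_(mdim (prodM (fibers M))) * 'rV[R]_s) := cod pc `*` setT.
  have oU : open U.
    rewrite openE => -[z y] [/= cz _]; exists (cod pc, setT) => //=.
    by split; [exact: open_nbhs_nbhs (conj (@cod_open _ _ _ pc) cz)|exact: filterT].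
  have s1 : smooth_on U (prod_frame \o bwd pc \o fst).
    apply: (@smooth_on_affine _ _ _ _ U (cod pc) fst fst) => //.
    + by move=> z _; apply: linear_differentiable => t; exact: cvg_fst.
    + by move=> z [].
    + exact: smooth_prod_frame.
  have s2 : smooth_on U snd.
    by apply: (@smooth_on_linear _ _ _ U oU snd); move=> t; exact: cvg_snd.
  exact: (smooth_on_mulmx oU s2 s1).
- by rewrite mulmxDl -scalemxAl.
- by rewrite /dot trmx_mul mulmxA -(mulmxA y) point_frame_orthonormal mulmx1.
- exact: frame_bundle_onto.
- apply: normal_part_tangent.
  have [e _] := diff_point_frame pt y X; rewrite [X in (X <= _)%MS]e.
  exact: submx_trans (submxMl _ _) (point_frame_parallel pt X).
Qed.

(** Multiplication by one [slotJ] transposed isolates its term by orthogonality, and the Gram matrix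
    of that factor is invertible. *)
Lemma slot_sum_inj p (c : forall i, chartM i) (X : forall a, 'rV[R]_(mdim (M (up a)))) :
  good p c -> \sum_a X a *m slotJ p (c (up a)) = 0 -> forall a, X a = 0.
Proof.
move=> gc /(congr1 (fun w => w *m (slotJ p (c (up _)))^T)) X0 a.
have {}X0 := X0 a; move: X0; rewrite mul0mx mulmx_suml (bigD1 a)//= big1 ?addr0 => [|b ba].
  rewrite -mulmxA => XG; have [Mc dc] := gc (up a).
  have fr := slotJ_free hf hN Mc dc.
  by rewrite -(mulmxK (gram_unit fr) (X a)) XG mul0mx.
have [Mc dc] := gc (up a); have [Mb db] := gc (up b).
have ab : up b != up a by apply: contra ba => /eqP /lift_inj ->.
by rewrite -mulmxA (slotJ_orthogonal hg hf ab Mb db Mc dc) mulmx0.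
Qed.

(** * Nonsingularity of [I - A] *)

Section omega.
Variables (q0 : M ord0) (pt : prodM (fibers M)).
Let y := base_map f o C q0.
Let c a : chart R (fibers M a) (mdim (fibers M a)) := chart_at (pt a).
Arguments c : clear implicits.
Let Mc a : atlas (fibers M a) (c a). Proof. exact: chart_atP. Qed.
Let x : 'rV[R]_(\sum_a mdim (fibers M a)) := fwd (prod_chart c) pt.
Let cx : cod (prod_chart c) x. Proof. exact: fwd_cod (dom_chart_at pt). Qed.
Let xpt : bwd (prod_chart c) x = pt. Proof. exact: fwdK (dom_chart_at pt). Qed.
Let oc a : open (cod (c a)). Proof. exact: cod_open. Qed.

(** The [a]-th summand of [f (q0, .)], a function on [M_a] alone; unlike the leaves above, this
    slice fixes the point of [M_0]. *)
Let leaf a (z : fibers M a) : 'rV[R]_N := (factor_map z + y *m factor_frame z) *m E a.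

Let sleaf a : smooth_on (cod (c a)) (fun z => leaf (bwd (c a) z)).
Proof.
have sy := smooth_on_mulmx (@oc a) (smooth_on_cst (@oc a) y) (smooth_factor_frame (Mc a)).
exact: (smooth_on_mulmx (@oc a) (smooth_onD (@oc a) (smooth_factor_map (Mc a)) sy)
  (smooth_on_cst (@oc a) (E a))).
Qed.

Let leaf_sum p : p ord0 = q0 -> f p = \sum_a leaf (p (up a)).
Proof.
move=> p0; apply: etrans (map_tail p) _; rewrite p0 -/y /prod_frame mulmx_sumr -big_split.
by apply: eq_bigr => a _; rewrite /leaf /= mulmxDl mulmxA.
Qed.

(** When only the [M_a]-coordinate moves, [f] differs from this summand by the constant [K]. *)
Lemma derive_leaf p a X : p ord0 = q0 -> p (up a) = pt a ->
  'D_X (fun z => leaf (bwd (c a) z)) (submxrow x a) =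
  X *m slotJ p (c a : chartM (up a)).
Proof.
move=> p0 pa.
have xa : submxrow x a = fwd (c a) (pt a) by exact: submxrow_fwd_prod.
have cy : cod (c a) (submxrow x a) := cx a.
pose K := \sum_(b | b != a) leaf (p (up b)).
have fE z : f (upd p (bwd (c a) z : M (up a))) = leaf (bwd (c a) z) + K.
  have p0' : upd p (bwd (c a) z : M (up a)) ord0 = q0 by rewrite upd_out.
  have e2 : leaf (upd p (bwd (c a) z : M (up a)) (up a)) = leaf (bwd (c a) z).
    by rewrite upd_in.
  have e3 : \sum_(b | b != a) leaf (upd p (bwd (c a) z : M (up a)) (up b)) = K.
    rewrite /K; apply: eq_bigr => b ba.
    have ne : up a != up b by apply: contra ba => /eqP /lift_inj ->.
    by rewrite (upd_out _ _ ne).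
  have e1 := leaf_sum p0'; rewrite (bigD1 a isT) in e1.
  exact (etrans e1 (congr2 +%R e2 e3)).
have e z : leaf (bwd (c a) z) = f (upd p (bwd (c a) z : M (up a))) - K.
  exact: esym (etrans (congr1 (fun w => w - K) (fE z)) (addrK _ _)).
have ds := smooth_differentiable (smooth_slot_upd hf p (Mc a)) cy.
have dd : derivable (fun z => f (upd p (bwd (c a) z : M (up a)))) (submxrow x a) X.
  exact: diff_derivable.
have -> : (fun z => leaf (bwd (c a) z)) = (fun z => f (upd p (bwd (c a) z : M (up a)))) - cst K.
  exact/funext.
apply: etrans (deriveB dd (derivable_cst K _ X)) _; rewrite derive_cst subr0.
have := derive_slot_upd hf p X (Mc a) cy; rewrite xa (fwdK (dom_chart_at (pt a))) -pa upd_id.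
by rewrite pa.
Qed.

Let F : 'rV[R]_(mdim (prodM (fibers M))) -> 'rV[R]_N := local_rep ft pt.
Let x0 : 'rV[R]_(mdim (prodM (fibers M))) := Defs.coord pt.
Let tau : 'rV[R]_(mdim (prodM (fibers M))) -> 'M[R]_(s, N) := prod_frame \o bwd (chart_at pt).
Let J := 'J F x0.
Let B := 'J (fun z => y *m tau z) x0.
Let cx0 : cod (chart_at pt) x0. Proof. exact: cx. Qed.
Let ocp : open (cod (chart_at pt)). Proof. exact: cod_open. Qed.

Let sub_BJ : (B <= J)%MS.
Proof.
apply/row_subP => i; rewrite rowE jacobianE.
have [e _] := diff_point_frame pt y (delta_mx 0 i); rewrite [X in (X <= _)%MS]e.
exact: submx_trans (submxMl _ _) (point_frame_parallel pt _).
Qed.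

Let mulBE X : X *m B = 'D_X (fun z => y *m tau z) x0.
Proof.
have [_ d] := diff_point_frame pt y X.
exact (etrans (jacobianE _ _ _) (esym (deriveE X d))).
Qed.

Let mulJE X z : cod (chart_at pt) z -> X *m 'J F z = 'D_X F z.
Proof.
move=> cz; have d := smooth_differentiable (smooth_point_map (pt := pt)) cz.
exact (etrans (jacobianE _ _ _) (esym (deriveE X d))).
Qed.

(* Moving along the parallel normal field [y *m tau] turns the immersion into the leaf
   [f (q0, .)], whose differential is injective. *)
Let sum_free (X : 'rV[R]_(\sum_a mdim (fibers M a))) : X *m (J + B) = 0 -> X = 0.
Proof.
have [p [p0 px]] := exists_join q0 pt.
have pa a : p (up a) = pt a by exact: (congr1 (fun t : prodM (fibers M) => t a) px).
have dJ := smooth_differentiable (smooth_point_map (pt := pt)) cx0.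
have [_ dB] := diff_point_frame pt y X.
have dD := deriveD (@diff_derivable _ _ _ _ _ X dJ) (@diff_derivable _ _ _ _ _ X dB).
have FE : F + (fun z => y *m tau z) = block_sum (fun a z => leaf (bwd (c a) z)).
  apply/funext => z; rewrite /block_sum.
  have e1 : F z = \sum_a factor_map (bwd (c a) (submxrow z a)) *m E a by [].
  have e2 : tau z = \sum_a factor_frame (bwd (c a) (submxrow z a)) *m E a by [].
  rewrite -[LHS]/(F z + y *m tau z) e1 e2 mulmx_sumr -big_split; apply: eq_bigr => a _.
  by rewrite /leaf /= mulmxDl mulmxA.
have e : X *m (J + B) = \sum_a submxrow X a *m slotJ p (c a : chartM (up a)).
  have m1 := etrans (mulmxDr X J B) (congr2 +%R (mulJE X cx0) (mulBE X)).
  have m2 := congr1 (fun G : 'rV[R]_(mdim (prodM (fibers M))) -> 'rV[R]_N => 'D_X G x0) FE.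
  have m3 := derive_block_sum oc sleaf X cx.
  have m4 : \sum_a 'D_(submxrow X a) (fun z => leaf (bwd (c a) z)) (submxrow x a) =
      \sum_a submxrow X a *m slotJ p (c a : chartM (up a)).
    by apply: eq_bigr => a _; exact: derive_leaf.
  exact (etrans m1 (etrans (esym dD) (etrans m2 (etrans m3 m4)))).
rewrite e.
have [c' [c'0 c'a]] := @exists_family r (fun i => chartM i) (chart_at (p ord0)) c.
have gc : good p c'.
  move=> i; case: (unliftP ord0 i) => [a|] ->.
    by rewrite c'a pa; split; [exact: chart_atP|exact: dom_chart_at].
  by rewrite c'0; split; [exact: chart_atP|exact: dom_chart_at].
move=> X0; apply/mxrowP => a; rewrite submxrow0.
apply: (slot_sum_inj (X := fun a => submxrow X a) gc _ a).
by apply: etrans _ X0; apply: eq_bigr => b _; rewrite c'a.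
Qed.

(** Weingarten's formula: differentiate [<F_Y, y tau> = 0] along [X]; the derivative of the normal
    field [y tau] is [X *m B]. *)
Let dot_second_form (X Y : 'rV[R]_(mdim (prodM (fibers M)))) :
  dot (second_form ft pt X Y) (y *m prod_frame pt) = - dot (X *m B) (Y *m J).
Proof.
have taux : tau x0 = prod_frame pt by exact (congr1 prod_frame xpt).
pose w := 'd (fun z => 'd F z Y) x0 X.
have nw : second_form ft pt X Y = w *m (prod_frame pt)^T *m prod_frame pt.
  rewrite /second_form -/F -/x0 -/w.
  rewrite -[X in normal_part _ _ X](subrK (w *m (prod_frame pt)^T *m prod_frame pt)) addrC.
  apply: normal_part_decomp; last exact: point_frame_full.
  by rewrite -mulmxA point_frame_normal mulmx0.
have sD : smooth_on (cod (chart_at pt)) ('D_Y F) := smooth_derive Y (smooth_point_map (pt := pt)).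
have dDF := smooth_differentiable sD cx0.
have nE : \forall z \near x0, 'D_Y F z = 'd F z Y.
  apply: (open_near_eq ocp cx0) => z cz.
  exact: deriveE (smooth_differentiable (smooth_point_map (pt := pt)) cz).
have wE : w = 'D_X ('D_Y F) x0.
  have ddF := near_eq_differentiable nE dDF.
  exact (etrans (esym (deriveE X ddF)) (esym (near_eq_derive X nE))).
have [_ dB] := diff_point_frame pt y X.
have dBT := differentiable_trmx dB.
have prod0 : \forall z \near x0, 'D_Y F z *m (y *m tau z)^T = 0.
  apply: (open_near_eq ocp cx0) => z cz; rewrite -(mulJE Y cz).
  have [p [p0 px]] := join_tail (bwd (prod_chart c) z).
  have n0 : tau z *m ('J F z)^T = 0 := prod_frame_normal Mc cz p0 px.
  by rewrite (trmx_mul y) !mulmxA -(mulmxA Y) (orthogonal_sym n0) mulmx0 mul0mx.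
have D0 : 'D_X ('D_Y F) x0 *m (y *m tau x0)^T + 'D_Y F x0 *m ('D_X (fun z => y *m tau z) x0)^T = 0.
  have e1 := derive_mulmx X dDF dBT; rewrite (derive_trmx X dB) in e1.
  apply: etrans (esym e1) _; apply: etrans (near_eq_derive (g := cst 0) X prod0) _.
  exact: derive_cst.
have D1 : w *m (y *m prod_frame pt)^T + (Y *m J) *m (X *m B)^T = 0.
  have c1 := congr2 mulmx wE (congr1 (fun P => (y *m P)^T) (esym taux)).
  have c2 := congr2 mulmx (mulJE Y cx0) (congr1 trmx (mulBE X)).
  exact (etrans (congr2 +%R c1 c2) D0).
have e5 : w *m (prod_frame pt)^T *m prod_frame pt *m (y *m prod_frame pt)^T =
    w *m (y *m prod_frame pt)^T.
  rewrite (trmx_mul y) !mulmxA -(mulmxA _ (prod_frame pt)).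
  by rewrite point_frame_orthonormal mulmx1.
have gen (P Q : 'M[R]_1) : P + Q = 0 -> P 0 0 = - Q 0 0.
  move=> /(congr1 (fun A : 'M_1 => A 0 0)); rewrite mxE [RHS]mxE => /eqP.
  by rewrite addr_eq0 => /eqP.
have e6 := congr1 (fun A : 'M[R]_1 => A 0 0) e5.
have e7 := congr1 -%R (dotC (Y *m J) (X *m B)).
have e8 := congr1 (fun v => dot v (y *m prod_frame pt)) nw.
exact (etrans e8 (etrans e6 (etrans (gen _ _ D1) e7))).
Qed.

Lemma omega_point : exists2 A, shape_operator ft pt (y *m prod_frame pt) A & 1%:M - A \in unitmx.
Proof.
(* With [B = S J], Weingarten's formula identifies the shape operator as [- S]. Then
   [(1 - A) J = J + B], which is injective by [sum_free]. *)
have /submxP[S BE] := sub_BJ; exists (- S) => [X Y|].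
  have tE Z : tmap ft pt Z = Z *m J by exact: esym (jacobianE _ _ _).
  by rewrite dot_second_form BE !tE mulmxA mulmxN mulNmx /dot mulNmx mxE.
rewrite opprK -row_free_unit -kermx_eq0; apply/rowV0P => w /sub_kermxP wS.
by apply: sum_free; rewrite BE -{1}(mul1mx J) -mulmxDl mulmxA wS mul0mx.
Qed.

End omega.

End final.

Theorem corollary22 (R : realType) (r : nat) (hr : (0 < r)%N)
    (M : 'I_r.+1 -> manifold R)
    (hM0 : [set: prodM M] !=set0) (hM : connected [set: prodM M])
    (g : riemannian_metric (prodM M)) (g0 : riemannian_metric (M ord0))
    (ga : forall a : 'I_r, M ord0 -> riemannian_metric (fibers M a))
    (hg : polar g g0 ga)
    (N : nat) (hN : mdim (prodM M) = N)
    (f : prodM M -> 'rV[R]_N) (hf : local_isometry g f) :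
  exists (n : 'I_r -> nat) (E : forall a, 'M[R]_(n a, N))
         (fa : forall a, fibers M a -> 'rV[R]_(n a)) (s : nat)
         (phi : prodM (fibers M) * 'rV[R]_s -> normal_bundle (product_map E fa))
         (f0 : M ord0 -> 'rV[R]_s),
    [/\ orthogonal_decomposition E,
        (forall a, immersion (fa a) /\ flat_normal_bundle (fa a)) /\
        flat_normal_bundle (product_map E fa),
        parallel_bundle_isometry phi,
        local_isometry g0 f0 /\ (forall p0, Omega phi (f0 p0)) &
        forall p, f p = endpoint (phi (tail p, f0 (p ord0)))].
Proof.
have cM := factor_connected hM0 hM; have [q _] := hM0.
have Mo := chart_atP (q ord0); have oo := dom_chart_at (q ord0).
(* The orthonormal basis is recorded through its coefficients [C] in the chart basis, so that one
   constant matrix serves all leaves. *)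
have [B [BB BJ]] := gram_schmidt (slotJ_free hf hN Mo oo).
have /submxP[C BC] : (B <= slotJ f q (chart_at (q ord0)))%MS by rewrite BJ.
have hC : (C *m slotJ f q (chart_at (q ord0))) *m
    (C *m slotJ f q (chart_at (q ord0)))^T = 1%:M by rewrite -BC.
have [n [E [dE UE]]] := exists_factor_spaces hg hf cM q hr.
exists n, E, (factor_map f q E), (mdim (M ord0)).
exists (frame_bundle hg hf hN cM hC dE UE), (base_map f q C); split=> //.
- split=> [a|]; last exact: (flat_product_map hg hf hN cM hC dE UE).
  split; first exact: (immersion_factor_map hf hN dE UE).
  exact: (flat_factor_map hg hf hN cM hC dE UE).
- exact: frame_bundle_parallel.
- split=> [|p0 pt]; first exact: (base_map_isometry hg hf hN cM hC).
  exact: (omega_point hg hf hN cM hC dE UE).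
- move=> p; exact: (map_tail hg hf hN cM hC dE UE).
Qed.
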